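(* Let $0<\alpha<n$, $0<\beta<1$, and let $\vec p=(p_1,\dots,p_n)$, $\vec q=(q_1,\dots,q_n)$ satisfy $1<p_i\le q_i<\infty$ for every $i=1,\dots,n$, $p_{i_0}\ne q_{i_0}$ for at least one index $i_0$, and $$\alpha+\beta=\sum_{i=1}^n\frac1{p_i}-\sum_{i=1}^n\frac1{q_i}.$$ Let $b$ be a locally integrable function on $\mathbb{R}^n$. Then the following conditions are equivalent: (a) $b\in\dot\Lambda_\beta$; (b) the commutator $[b,I_\alpha]$ is bounded from $L^{\vec p}(\mathbb{R}^n)$ to $L^{\vec q}(\mathbb{R}^n)$.
   Context: Mixed-norm Lebesgue space: for $1<p_i<\infty$, $L^{\vec p}(\mathbb{R}^n)$ is the set of measurable $f$ on $\mathbb{R}^n$ with $$\|f\|_{L^{\vec p}(\mathbb{R}^n)}=\Big(\int_{\mathbb{R}}\cdots\Big(\int_{\mathbb{R}}|f(x)|^{p_1}\,dx_1\Big)^{p_2/p_1}\cdots\,dx_n\Big)^{1/p_n}<\infty,$$ the norms being taken successively in $x_1,x_2,\dots,x_n$. Fractional integral: $I_\alpha f(x)=\int_{\mathbb{R}^n}\frac{f(y)}{|x-y|^{n-\alpha}}\,dy$. Commutator: for locally integrable $b$, $$[b,I_\alpha]f(x)=b(x)I_\alpha f(x)-I_\alpha(bf)(x)=\int_{\mathbb{R}^n}\frac{(b(x)-b(y))f(y)}{|x-y|^{n-\alpha}}\,dy.$$ Boundedness from $L^{\vec p}$ to $L^{\vec q}$ means that there is a constant $C$ with $\|[b,I_\alpha]f\|_{L^{\vec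 q}(\mathbb{R}^n)}\le C\|f\|_{L^{\vec p}(\mathbb{R}^n)}$ for all $f\in L^{\vec p}(\mathbb{R}^n)$. Homogeneous Lipschitz space: $\dot\Lambda_\beta=\{f:\text{ there is a constant }C\text{ with }|f(x)-f(y)|\le C|x-y|^\beta\text{ for all }x,y\in\mathbb{R}^n\}$. Functions that agree almost everywhere are identified, so $b\in\dot\Lambda_\beta$ means that $b$ coincides a.e. with a function satisfying this condition. *)

(* Defs.v *)
From HB Require Import structures.
From mathcomp Require Import all_boot all_order all_algebra.
From mathcomp Require Import all_classical all_reals all_analysis.

Set Implicit Arguments.
Unset Strict Implicit.
Unset Printing Implicit Defensive.

Import Order.TTheory GRing.Theory Num.Theory.
Import numFieldNormedType.Exports.

Local Open Scope classical_set_scope.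
Local Open Scope ring_scope.

(* R^n, with the product sigma-algebra (the Borel sets). The alias
   measurableTypeR R of R is the type on which lebesgue_measure is defined. *)

Notation Rn R n := (n.-tuple (measurableTypeR R)).

Definition cons_tup (R : realType) (n : nat) (z : measurableTypeR R * Rn R n) :
  Rn R n.+1 := [tuple of z.1 :: z.2].

Lemma measurable_cons_tup (R : realType) (n : nat) :
  measurable_fun [set: measurableTypeR R * Rn R n] (@cons_tup R n).
Proof.
exact: (@measurable_cons _ _ _ _ fst n snd measurable_fst measurable_snd).
Qed.

Section lebesgue_step.
Context (R : realType) (n : nat).
Variable mu : {sigma_finite_measure set (Rn R n) -> \bar R}.

Definition lebesgue_step : set (Rn R n.+1) -> \bar R :=
  pushforward (@lebesgue_measure R \x mu)%E (@cons_tup R n).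

Let lebesgue_step0 : lebesgue_step set0 = 0%E.
Proof. by rewrite /lebesgue_step /pushforward preimage_set0 measure0. Qed.

Let lebesgue_step_ge0 A : (0 <= lebesgue_step A)%E.
Proof. by rewrite /lebesgue_step /pushforward. Qed.

Let lebesgue_step_sigma_additive : semi_sigma_additive lebesgue_step.
Proof.
have mf := @measurable_cons_tup R n.
move=> F mF tF mUF; rewrite /lebesgue_step /pushforward preimage_bigcup.
apply: measure_semi_sigma_additive.
- by move=> k; rewrite -[X in measurable X]setTI; exact: mf.
- apply/trivIsetP => /= i j _ _ ij; rewrite -preimage_setI.
  by move/trivIsetP : tF => /(_ _ _ _ _ ij) ->//; rewrite preimage_set0.
- by rewrite -preimage_bigcup -[X in measurable X]setTI; exact: mf.
Qed.

HB.instance Definition _ := isMeasure.Build _ _ _ lebesgue_step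
  lebesgue_step0 lebesgue_step_ge0 lebesgue_step_sigma_additive.

Let lebesgue_step_sigma_finite : sigma_finite setT lebesgue_step.
Proof.
have /sigma_finiteP[F [TF ndF Foo]] := sigma_finiteT (@lebesgue_measure R).
have /sigma_finiteP[G [TG ndG Goo]] := sigma_finiteT mu.
pose u (t : Rn R n.+1) : measurableTypeR R * Rn R n :=
  (thead t, [tuple of behead t]).
have uK : cancel u (@cons_tup R n).
  by move=> t; apply/val_inj; rewrite /= [in RHS](tuple_eta t).
have cK : cancel (@cons_tup R n) u.
  by move=> [x t]; rewrite /u/= theadE; congr pair; apply/val_inj.
have mu_u : measurable_fun setT u.
  apply/measurable_fun_pairP; split; first exact: measurable_tnth.
  exact: measurable_behead.
exists (fun k => u @^-1` (F k `*` G k)).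
  rewrite -preimage_bigcup -[LHS](@preimage_setT _ _ u); congr (u @^-1` _).
  rewrite -setXTT TF TG predeqE => -[x y]; split => [|[k _ []/= ? ?]].
    move=> [/= [k _ Fkx] [l _ Gly]]; exists (maxn k l) => //; split.
    - by move: x Fkx; exact/subsetPset/ndF/leq_maxl.
    - by move: y Gly; exact/subsetPset/ndG/leq_maxr.
  by split; exists k.
move=> k; have [mF Fk] := Foo k; have [mG Gk] := Goo k; split.
  by rewrite -[X in measurable X]setTI; apply: mu_u => //; exact: measurableX.
rewrite /lebesgue_step /pushforward -comp_preimage.
rewrite (_ : u \o _ = id); last by apply/funext => z /=; exact: cK.
by rewrite product_measure1E// lte_mul_pinfty// ge0_fin_numE.
Qed.

HB.instance Definition _ := Measure_isSigmaFinite.Build _ _ _ lebesgue_step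
  lebesgue_step_sigma_finite.

End lebesgue_step.

(* Lebesgue measure on R^n: the n-fold product of the one-dimensional one,
   transported along R * R^n ~ R^(n+1); the unit point mass when n = 0. *)
Fixpoint lebesgue_tuple (R : realType) (n : nat) :
    {sigma_finite_measure set (Rn R n) -> \bar R} :=
  if n is n'.+1 then lebesgue_step (lebesgue_tuple R n')
  else \d_([tuple] : Rn R 0).

Definition edist (R : realType) (n : nat) (x y : Rn R n) : R :=
  Num.sqrt (\sum_(i < n) (tnth x i - tnth y i) ^+ 2).

(* The norms are taken successively in x_1, ..., x_n: the head variable is
   integrated first, i.e. innermost. *)
Fixpoint mixed_norm (R : realType) (n : nat) :
    n.-tuple R -> (Rn R n -> \bar R) -> \bar R :=
  if n is n'.+1 then fun p f =>
    mixed_norm [tuple of behead p] (fun t : Rn R n' =>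
      Lnorm (@lebesgue_measure R) (thead p)%:E (fun x => f (cons_tup (x, t))))
  else fun _ f => `|f [tuple]|%E.

Definition mixed_Lebesgue (R : realType) (n : nat) (p : n.-tuple R) :
    set (Rn R n -> R) :=
  [set f | measurable_fun setT f /\ (mixed_norm p (EFin \o f) < +oo)%E].

Definition loc_integrable (R : realType) (n : nat) (b : Rn R n -> R) :=
  measurable_fun setT b /\
  forall (a : Rn R n) (r : R),
    (lebesgue_tuple R n).-integrable [set x | edist x a <= r] (EFin \o b).

Definition lipschitz_space (R : realType) (n : nat) (beta : R) :
    set (Rn R n -> R) :=
  [set g | exists C : R, forall x y : Rn R n,
     `|g x - g y| <= C * edist x y `^ beta].

Definition in_lipschitz (R : realType) (n : nat) (beta : R)
    (b : Rn R n -> R) :=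
  exists2 g : Rn R n -> R, lipschitz_space beta g &
    {ae lebesgue_tuple R n, forall x, b x = g x}.

(* The kernel is 0 instead of undefined at y = x, a null set. For a measurable
   integrand the value is finite exactly when the integral converges
   absolutely; otherwise it is +oo or -oo (+oo - oo is -oo). *)
Definition frac_integral (R : realType) (n : nat) (alpha : R)
    (f : Rn R n -> R) (x : Rn R n) : \bar R :=
  (\int[lebesgue_tuple R n]_y (f y / edist x y `^ (n%:R - alpha))%:E)%E.

(* [b, I_alpha] f (x) = \int (b(x) - b(y)) f(y) / |x - y|^(n - alpha) dy. *)
Definition commutator (R : realType) (n : nat) (b : Rn R n -> R) (alpha : R)
    (f : Rn R n -> R) (x : Rn R n) : \bar R :=
  frac_integral alpha (fun y => (b x - b y) * f y) x.

(* Since an infinite value of T f enters the norm as +oo, the inequality also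
   forces T f to be finite almost everywhere. *)
Definition mixed_bounded (R : realType) (n : nat) (p q : n.-tuple R)
    (T : (Rn R n -> R) -> Rn R n -> \bar R) :=
  exists C : R, forall f : Rn R n -> R, mixed_Lebesgue p f ->
    (mixed_norm q (T f) <= C%:E * mixed_norm p (EFin \o f))%E.

(* Main.v *)
From mathcomp Require Import all_boot all_order all_algebra.
From mathcomp Require Import all_classical all_reals all_analysis.
From mathcomp Require Import measurable_realfun ring lra zify.
Require Import Defs.

Set Implicit Arguments.
Unset Strict Implicit.
Unset Printing Implicit Defensive.

Import Order.TTheory GRing.Theory Num.Theory.
Import numFieldNormedType.Exports.

Local Open Scope classical_set_scope.
Local Open Scope ring_scope.

(** From (a) to (b). If [b] is Lipschitz of exponent [beta], then almost everywhere
    [|[b, I_alpha] f|] is at most a multiple of the Riesz potential of order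
    [gamma = alpha + beta] of [|f|], and [gamma] is the sum of the differences
    [1 / p_i - 1 / q_i]. So (b) is the Hardy-Littlewood-Sobolev inequality in mixed
    norms ([riesz_potential_bounded]). It is proved in a dyadic model. On the line,
    two shifted dyadic grids have the property that any two points whose distance
    exceeds the mesh lie in a common cell, of one of the grids, of length comparable
    with their distance ([grids_cover]). Hence the kernel [|x - y| ^ (gamma - n)] is
    dominated by the sum over the dyadic scales [l] of [l ^ gamma] times a product of
    one-variable averages at the scale [l] ([riesz_kernel_le]). Split [l ^ gamma] into the factors
    [l ^ (1 / p_i - 1 / q_i)]. In the first variable with [p_i < q_i] the sum over the
    scales is a fractional sum; in the other variables a single scale is bounded by a
    maximal function if [p_i = q_i] and by a fractional sum otherwise
    ([sum_tuple_average_le_operator]).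

    The resulting operator is bounded variable by variable
    ([mixed_operator_bounded]). A fractional sum in one variable maps [L^p] to [L^q]
    by Hedberg's argument ([frac_sum_bounded]), and the norm of a fractional sum of
    vectors is at most the fractional sum of the norms. For a maximal function this
    last step fails, and what is needed is its boundedness on [L^p] of functions with
    values in a space with an iterated norm ([good_norm_iter]). For one suitable
    exponent of the outer integral this follows from Tonelli's theorem; a
    good-lambda inequality ([good_lambda_maximal]), obtained by stopping the function
    where the averages of its norm become large, then gives all exponents. The
    constants depend neither on the mesh nor on the number of scales, and a monotone
    limit leads back to the Riesz potential.

    From (b) to (a). Let [Q] be a cube of radius [r] and [t] the mean of [b] over
    [Q]. The commutator, applied to the indicator of the part of [Q] where [b <= t],
    has no cancellation on the part where [b > t], and its integral there is at least
    a multiple of [r ^ (alpha - n) |Q|] times the integral of [|b - t|] over [Q].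
    The bound (b) and Jensen's inequality in each variable give an upper bound, and
    together [\int_Q |b - t| <= K r ^ (n + beta)] ([mean_oscillation_le]). By
    Campanato's argument ([in_lipschitz_of_oscillation]) the means of [b] over the
    cubes centred at a point converge, their limit is Lipschitz of exponent [beta],
    and it agrees with [b] almost everywhere: the integral of the difference over
    small cubes is [O (r ^ (n + beta))], and averaging over all small cubes shows
    that it vanishes. *)

(** * Monotonicity, powers and Jensen's inequality *)

Section monotone_integral.
Context d (T : measurableType d) (R : realType).
Variable mu : {measure set T -> \bar R}.
Local Open Scope ereal_scope.

(** The integral of a nonnegative function is a supremum over the simple
    functions below it, hence monotone on arbitrary functions. *)
Lemma le_integralT (f g : T -> \bar R) :
  (forall x, 0 <= f x) -> (forall x, f x <= g x) ->
  \int[mu]_x f x <= \int[mu]_x g x.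
Proof.
move=> f0 fg; have g0 x : 0 <= g x by exact: le_trans (fg x).
rewrite !ge0_integralTE//; apply: ereal_sup_le => _ [h /= hf <-].
by exists h => // x; exact: le_trans (fg x).
Qed.

Lemma le_Lnorm (r : R) (f g : T -> \bar R) : (0 < r)%R ->
  (forall x, `|f x| <= `|g x|) ->
  Lnorm mu r%:E f <= Lnorm mu r%:E g.
Proof.
move=> r0 fg; rewrite unlock.
apply: gt0_ler_poweR; rewrite ?invr_ge0 ?(ltW r0)//.
- by rewrite in_itv/= leey integral_ge0// => x _; exact: poweR_ge0.
- by rewrite in_itv/= leey integral_ge0// => x _; exact: poweR_ge0.
apply: le_integralT => x; first exact: poweR_ge0.
by apply: gt0_ler_poweR; rewrite ?(ltW r0)// in_itv/= abse_ge0 leey.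
Qed.

End monotone_integral.

Section powers.
Context {R : realType}.
Local Open Scope ereal_scope.

Lemma ge0_le_poweR (r : R) (x y : \bar R) :
  (0 <= r)%R -> 0 <= x -> x <= y -> x `^ r <= y `^ r.
Proof.
move=> r0 x0 xy; apply: gt0_ler_poweR => //; rewrite in_itv/= leey andbT//.
exact: le_trans xy.
Qed.

Lemma poweRK (r : R) (x : \bar R) : r != 0%R -> 0 <= x -> (x `^ r) `^ r^-1 = x.
Proof. by move=> r0 x0; rewrite -poweRrM mulfV// poweRe1. Qed.

Lemma poweRVK (r : R) (x : \bar R) : r != 0%R -> 0 <= x -> (x `^ r^-1) `^ r = x.
Proof. by move=> r0 x0; rewrite -poweRrM mulVf// poweRe1. Qed.

Lemma le_poweR_root (r : R) (x y : \bar R) :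
  (0 < r)%R -> 0 <= x -> 0 <= y -> x `^ r <= y `^ r -> x <= y.
Proof.
move=> r0 x0 y0 xy; rewrite -(@poweRK r x) ?gt_eqF// -(@poweRK r y) ?gt_eqF//.
by apply: ge0_le_poweR; rewrite ?invr_ge0 ?(ltW r0)// poweR_ge0.
Qed.

(** The graph of [t |-> t ^ r] lies above its tangent at [c]. *)
Lemma powR_tangent (r c t : R) : (1 < r)%R -> (0 <= c)%R -> (0 <= t)%R ->
  (r * c `^ (r - 1) * t <= t `^ r + (r - 1) * c `^ r)%R.
Proof.
move=> r1 c0 t0; have r0 : (0 < r)%R by exact: lt_trans r1.
have rB1 : (0 < r - 1)%R by rewrite subr_gt0.
have q0 : (0 < r / (r - 1))%R by rewrite divr_gt0.
have pq : (r^-1 + (r / (r - 1))^-1 = 1)%R.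
  by rewrite invf_div; field; rewrite !gt_eqF.
have := conjugate_powR t0 (powR_ge0 c (r - 1)) r0 q0 pq.
rewrite -powRrM (_ : ((r - 1) * (r / (r - 1)) = r)%R); last first.
  by rewrite mulrCA mulfV ?mulr1// gt_eqF.
rewrite -(ler_pM2l r0) => /le_trans-/(_ (t `^ r + (r - 1) * c `^ r))%R.
rewrite mulrA mulrAC; apply; rewrite le_eqVlt; apply/orP; left; apply/eqP.
by field; rewrite !gt_eqF.
Qed.

Lemma poweR_tangent (r c : R) (t : \bar R) : (1 < r)%R -> (0 <= c)%R -> 0 <= t ->
  (r * c `^ (r - 1))%:E * t <= t `^ r + ((r - 1) * c `^ r)%:E.
Proof.
move=> r1 c0; case: t => [t| |]// t0.
  by rewrite -EFinM poweR_EFin -EFinD lee_fin; apply: powR_tangent.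
by rewrite poweRyr ?gt_eqF ?(lt_trans _ r1)// addye// leey.
Qed.

End powers.

Section jensen.
Context d (T : measurableType d) (R : realType).
Variable mu : {measure set T -> \bar R}.
Local Open Scope ereal_scope.

(** Jensen's inequality for the power [r], for a weight [w] of total mass at
    most [1]: integrate the tangent inequality and choose the point of tangency
    to be the mean itself. *)
Lemma jensen_poweR (r : R) (w h : T -> \bar R) : (1 <= r)%R ->
  measurable_fun setT w -> measurable_fun setT h ->
  (forall x, 0 <= w x) -> (forall x, 0 <= h x) -> \int[mu]_x w x <= 1 ->
  (\int[mu]_x (h x * w x)) `^ r <= \int[mu]_x (h x `^ r * w x).
Proof.
rewrite le_eqVlt => /predU1P[<- mw mh w0 h0 _|r1 mw mh w0 h0 w1].
  rewrite poweRe1; last by apply: integral_ge0 => x _; rewrite mule_ge0.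
  by apply: le_integralT => x; [rewrite mule_ge0|rewrite poweRe1].
have r0 : (0 < r)%R by exact: lt_trans r1.
set A := \int[mu]_x (h x * w x); set B := (X in _ <= X).
have A0 : 0 <= A by apply: integral_ge0 => x _; rewrite mule_ge0.
have B0 : 0 <= B by apply: integral_ge0 => x _; rewrite mule_ge0// poweR_ge0.
have key c : (0 <= c)%R ->
    (r * c `^ (r - 1))%:E * A <= B + ((r - 1) * c `^ r)%:E.
  move=> c0; rewrite /A -ge0_integralZl//; last 3 first.
  - exact: emeasurable_funM.
  - by move=> x _; rewrite mule_ge0.
  - by rewrite lee_fin mulr_ge0 ?powR_ge0// ltW.
  apply: (@le_trans _ _ (\int[mu]_x (h x `^ r * w x +
      ((r - 1) * c `^ r)%:E * w x))).
    apply: le_integralT => x.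
      by rewrite mule_ge0 ?mule_ge0 ?lee_fin ?mulr_ge0 ?powR_ge0// ltW.
    rewrite muleA -ge0_muleDl ?poweR_ge0//; last first.
      by rewrite lee_fin mulr_ge0 ?powR_ge0// subr_ge0 ltW.
    by apply: lee_wpmul2r => //; exact: poweR_tangent.
  rewrite ge0_integralD//; last 4 first.
  - by move=> x _; rewrite mule_ge0// poweR_ge0.
  - apply: emeasurable_funM => //.
    exact: (measurableT_comp (measurable_poweR _)).
  - by move=> x _; rewrite mule_ge0// lee_fin mulr_ge0 ?powR_ge0// subr_ge0 ltW.
  - exact: measurable_funeM.
  rewrite leeD2l// ge0_integralZl//; last first.
    by rewrite lee_fin mulr_ge0 ?powR_ge0// subr_ge0 ltW.
  rewrite -[leRHS]mule1 lee_wpmul2l// lee_fin mulr_ge0 ?powR_ge0//.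
  by rewrite subr_ge0 ltW.
have [Aoo|Afin] := eqVneq A +oo.
  have := key 1%R ler01; rewrite powR1 /= !mulr1 Aoo gt0_muley ?lte_fin//.
  by case: B B0 {key} => [b _|_ _|]; rewrite ?leey -?EFinD ?leye_eq.
have Af : A \is a fin_num by rewrite ge0_fin_numE// ltey.
have := key _ (fine_ge0 A0); rewrite -[in X in X -> _](fineK Af) -EFinM.
rewrite -mulrA mulrC (mulrC _ (fine A)) mulr_powRB1 ?fine_ge0//.
rewrite -(fineK Af) poweR_EFin; case: B B0 {key} => [b _|_ _|//]; last exact: leey.
by rewrite -EFinD !lee_fin; lra.
Qed.

End jensen.

(** * Minkowski's integral inequality *)

Section minkowski_integral.
Context d1 d2 (T1 : measurableType d1) (T2 : measurableType d2) (R : realType).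
Variables (mu1 : {sigma_finite_measure set T1 -> \bar R})
          (mu2 : {sigma_finite_measure set T2 -> \bar R}).
Local Open Scope ereal_scope.

Lemma measurable_section1 (f : T1 * T2 -> \bar R) (y : T2) :
  measurable_fun setT f -> measurable_fun setT (fun x => f (x, y)).
Proof. by move=> mf; exact: (measurableT_comp mf (pair2_measurable y)). Qed.

Lemma measurable_section2 (f : T1 * T2 -> \bar R) (x : T1) :
  measurable_fun setT f -> measurable_fun setT (fun y => f (x, y)).
Proof. by move=> mf; exact: (measurableT_comp mf (pair1_measurable x)). Qed.

Lemma measurable_fun_poweR d (T : measurableType d) (g : T -> \bar R) (r : R) :
  measurable_fun setT g -> measurable_fun setT (fun x => g x `^ r).
Proof. exact: (measurableT_comp (measurable_poweR _)). Qed.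

Lemma ge0_Lnorm d (T : measurableType d) (mu : {measure set T -> \bar R})
    (r : R) (g : T -> \bar R) : (forall x, 0 <= g x) ->
  Lnorm mu r%:E g = (\int[mu]_x (g x `^ r)) `^ r^-1.
Proof.
by move=> g0; rewrite unlock; under eq_integral do rewrite gee0_abs//.
Qed.

Lemma ge0_Lnorm_poweR d (T : measurableType d) (mu : {measure set T -> \bar R})
    (r : R) (g : T -> \bar R) : (forall x, 0 <= g x) -> r != 0%R ->
  Lnorm mu r%:E g `^ r = \int[mu]_x (g x `^ r).
Proof.
move=> g0 r0; rewrite ge0_Lnorm// poweRVK//.
by apply: integral_ge0 => x _; exact: poweR_ge0.
Qed.

Lemma measurable_Lnorm_section1 (f : T1 * T2 -> \bar R) (r : R) :
  measurable_fun setT f -> (forall z, 0 <= f z) ->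
  measurable_fun setT (fun y => Lnorm mu1 r%:E (fun x => f (x, y))).
Proof.
move=> mf f0.
rewrite (_ : (fun y => _) = fun y => (\int[mu1]_x (f (x, y) `^ r)) `^ r^-1).
  apply/measurable_fun_poweR.
  apply: (measurable_fun_fubini_tonelli_G (fun z => f z `^ r)).
  - exact: measurable_fun_poweR.
  - by move=> z; exact: poweR_ge0.
by apply/funext => y; rewrite ge0_Lnorm.
Qed.

(** Minkowski's integral inequality is Jensen's inequality in [y] for the weight
    proportional to the norms [n y] of the sections, applied to [f / n]. The
    sections of norm zero or infinite contribute nothing. *)
Lemma minkowski_integral (f : T1 * T2 -> \bar R) (r : R) : (1 <= r)%R ->
  measurable_fun setT f -> (forall z, 0 <= f z) ->
  Lnorm mu1 r%:E (fun x => \int[mu2]_y f (x, y)) <=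
  \int[mu2]_y Lnorm mu1 r%:E (fun x => f (x, y)).
Proof.
move=> r1 mf f0; have r0 : (0 < r)%R by exact: lt_le_trans r1.
have rn0 : r != 0%R by rewrite gt_eqF.
pose n y := Lnorm mu1 r%:E (fun x => f (x, y)).
have n0 y : 0 <= n y by exact: Lnorm_ge0.
have mn : measurable_fun setT n by exact: measurable_Lnorm_section1.
rewrite -/(n _); set A := \int[mu2]_y n y.
have A0 : 0 <= A by exact: integral_ge0.
have [->|Aoo] := eqVneq A +oo; first exact: leey.
have Af : A \is a fin_num by rewrite ge0_fin_numE// ltey.
suff H (a : R) : A < a%:E -> Lnorm mu1 r%:E (fun x => \int[mu2]_y f (x, y)) <= a%:E.
  apply/lee_addgt0Pr => e e0; rewrite -(fineK Af) -EFinD; apply: H.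
  by rewrite -[X in X < _](fineK Af) lte_fin ltrDl.
move=> Aa; have a0 : (0 < a)%R by rewrite -lte_fin (le_lt_trans A0).
pose g y : \bar R := if 0 < n y < +oo then (a * fine (n y) `^ (-1))%:E else 0.
have g0 y : 0 <= g y.
  by rewrite /g; case: ifP => // _; rewrite lee_fin mulr_ge0 ?powR_ge0// ltW.
have mB : measurable_fun setT (fun y => 0 < n y < +oo).
  by apply: measurable_and; exact: measurable_fun_lte.
have mg : measurable_fun setT g.
  apply: measurable_fun_ifT => //.
  apply/measurable_EFinP/measurable_funM => //.
  apply: (@measurableT_comp _ _ _ _ _ _ (fun x : R => x `^ (-1))%R) => //.
  exact: (measurableT_comp (@fine_measurable _ _ measurableT) mn).
pose w y := n y * (a^-1)%:E.
have w0 y : 0 <= w y by rewrite mule_ge0// lee_fin invr_ge0 ltW.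
have mw : measurable_fun setT w.
  exact: emeasurable_funM.
have w1 : \int[mu2]_y w y <= 1.
  rewrite ge0_integralZr// ?lee_fin ?invr_ge0 ?(ltW a0)//.
  by rewrite lee_pdivrMr// mul1e ltW.
have mh : measurable_fun setT (fun z : T1 * T2 => f z * g z.2).
  by apply: emeasurable_funM => //; exact: measurableT_comp.
have h0 z : 0 <= f z * g z.2 by rewrite mule_ge0.
(* the exceptional sections are negligible *)
have Z : {ae mu1, forall x, \int[mu2]_y f (x, y) =
    \int[mu2]_y (f (x, y) * g y * w y)}.
  pose k (z : T1 * T2) := if 0 < n z.2 < +oo then 0 else f z.
  have k0 z : 0 <= k z by rewrite /k; case: ifP.
  have mk : measurable_fun setT k.
    apply: measurable_fun_ifT => //.
    exact: (measurableT_comp mB).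
  have E x y : f (x, y) = f (x, y) * g y * w y + k (x, y).
    rewrite /k /w /g/=; case: ifPn => [/andP[n1 n2]|_].
      have fn0 : (0 < fine (n y))%R by rewrite fine_gt0// n1.
      rewrite adde0 -[X in _ = _ * _ * (X * _)](@fineK _ (n y)) ?ge0_fin_numE//.
      rewrite -muleA -!EFinM powR_inv1 ?fine_ge0//.
      rewrite (_ : (_ * _)%R = 1%R) ?mule1//; field.
      by rewrite !gt_eqF.
    by rewrite mule0 mul0e add0e.
  have : \int[mu1]_x \int[mu2]_y k (x, y) = 0.
    rewrite fubini_tonelli//.
    rewrite (_ : 0 = \int[mu2]_y cst 0 y); last by rewrite integral0.
    apply: ge0_ae_eq_integral => //.
    - exact: measurable_fun_fubini_tonelli_G.
    - by move=> y _; exact: integral_ge0.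
    have : {ae mu2, forall y, n y \is a fin_num}.
      have : mu2.-integrable setT n.
        apply/integrableP; split => //.
        by under eq_integral do rewrite gee0_abs//; rewrite ltey.
      by move=> /(integrable_ae measurableT); apply: filterS => y; exact.
    apply: filterS => y ny _ /=.
    rewrite /k/=; have [nP|] := boolP (0 < n y < +oo).
      exact: integral0_eq.
    rewrite -ge0_fin_numE// ny andbT => nP; have n00 : n y <= 0 by rewrite leNgt.
    have ny0 : n y = 0 by apply/eqP; rewrite eq_le n00 n0.
    have := @Lnorm_eq0_eq0 _ _ _ mu1 (fun x => f (x, y)) r%:E
      (measurable_section1 y mf).
    rewrite lte_fin => /(_ r0 ny0) fy0.
    rewrite (_ : 0 = \int[mu1]_y cst 0 y); last by rewrite integral0.
    apply: ge0_ae_eq_integral => //; exact: measurable_section1.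
  move=> k0'; have : ae_eq mu1 setT (fun x => \int[mu2]_y k (x, y)) (cst 0).
    apply/ae_eq_integral_abs => //; first exact: measurable_fun_fubini_tonelli_F.
    apply: etrans k0'; apply: eq_integral => x _.
    by rewrite gee0_abs// integral_ge0.
  apply: filterS => x /(_ I) /= kx.
  rewrite (eq_integral (fun y => f (x, y) * g y * w y + k (x, y))); last by
    move=> y _; exact: E.
  rewrite ge0_integralD// ?kx ?adde0//.
  - by move=> y _; rewrite mule_ge0// (h0 (x, y)).
  - apply: emeasurable_funM => //.
    exact: (measurable_section2 x mh).
  - exact: measurable_section2.
have ha y : \int[mu1]_x ((f (x, y) * g y) `^ r * w y) <= (a `^ r)%:E * w y.
  rewrite ge0_integralZr//; last 2 first.
  - apply: measurable_fun_poweR; exact: (measurable_section1 y mh).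
  - by move=> x _; exact: poweR_ge0.
  apply: lee_wpmul2r => //.
  rewrite (eq_integral (fun x => f (x, y) `^ r * g y `^ r)); last by
    move=> x _; rewrite poweRM.
  rewrite ge0_integralZr//; last 3 first.
  - by apply: measurable_fun_poweR; exact: measurable_section1.
  - by move=> x _; exact: poweR_ge0.
  - exact: poweR_ge0.
  rewrite -ge0_Lnorm_poweR// -poweRM ?Lnorm_ge0// -poweR_EFin.
  apply: ge0_le_poweR; [exact: ltW|by rewrite mule_ge0 ?Lnorm_ge0|].
  rewrite -/(n y) /g; case: ifPn => [/andP[n1 n2]|_]; last first.
    by rewrite mule0 lee_fin ltW.
  have fn0 : (0 < fine (n y))%R by rewrite fine_gt0// n1.
  rewrite -[X in X * _](@fineK _ (n y)) ?ge0_fin_numE// -EFinM lee_fin.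
  by rewrite mulrCA powR_inv1 ?fine_ge0// mulfV ?mulr1// gt_eqF.
apply: (le_poweR_root r0) => //; first by rewrite Lnorm_ge0.
  by rewrite lee_fin ltW.
rewrite ge0_Lnorm_poweR//; last by move=> x; exact: integral_ge0.
rewrite (_ : \int[mu1]_x _ =
    \int[mu1]_x (\int[mu2]_y (f (x, y) * g y * w y)) `^ r); last first.
  have m2 : measurable_fun setT (fun z : T1 * T2 => f z * g z.2 * w z.2).
    by apply: emeasurable_funM => //; exact: measurableT_comp.
  apply: ge0_ae_eq_integral => //.
  - by apply: measurable_fun_poweR; exact: measurable_fun_fubini_tonelli_F.
  - apply: measurable_fun_poweR.
    by apply: (measurable_fun_fubini_tonelli_F _ m2) => z; rewrite mule_ge0.
  - by move=> x _; exact: poweR_ge0.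
  - by move=> x _; exact: poweR_ge0.
  - by move: Z; apply: filterS => x -> _.
apply: (@le_trans _ _
    (\int[mu1]_x \int[mu2]_y ((f (x, y) * g y) `^ r * w y))).
  apply: le_integralT => x; first exact: poweR_ge0.
  by apply: jensen_poweR => //; exact: (measurable_section2 x mh).
have m3 : measurable_fun setT (fun z : T1 * T2 => (f z * g z.2) `^ r * w z.2).
  apply: emeasurable_funM; last exact: measurableT_comp.
  exact: measurable_fun_poweR.
rewrite (fubini_tonelli _ m3); last by move=> z; rewrite mule_ge0// poweR_ge0.
apply: (@le_trans _ _ (\int[mu2]_y ((a `^ r)%:E * w y))).
  apply: le_integralT => y //.
  by apply: integral_ge0 => x _; rewrite mule_ge0// poweR_ge0.
rewrite ge0_integralZl// ?lee_fin ?powR_ge0// -[leRHS]mule1.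
by apply: lee_wpmul2l => //; rewrite lee_fin powR_ge0.
Qed.

End minkowski_integral.

(** * Iterated norms of functions *)

Section function_norms.
Context (R : realType).
Local Open Scope ereal_scope.

(** The properties of a norm on nonnegative functions that pass from [N] to the
    [L^r] norm of [N] of the sections. Subadditivity follows from the integral
    inequality, see [fnormD]. *)
Record function_norm d (U : measurableType d) (N : (U -> \bar R) -> \bar R) :
    Prop := FunctionNorm {
  fnorm_ge0 : forall f, 0 <= N f ;
  fnorm_le : forall f g, (forall u, 0 <= f u) -> (forall u, f u <= g u) ->
    N f <= N g ;
  fnormZ_le : forall (c : R) f, (0 <= c)%R -> measurable_fun setT f ->
    (forall u, 0 <= f u) -> N (fun u => c%:E * f u) <= c%:E * N f ;
  fnorm_integral : forall d' (V : measurableType d')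
    (nu : {sigma_finite_measure set V -> \bar R}) (f : U * V -> \bar R),
    measurable_fun setT f -> (forall z, 0 <= f z) ->
    N (fun u => \int[nu]_v f (u, v)) <= \int[nu]_v N (fun u => f (u, v)) ;
  fnorm_measurable : forall d' (V : measurableType d') (f : U * V -> \bar R),
    measurable_fun setT f -> (forall z, 0 <= f z) ->
    measurable_fun setT (fun v => N (fun u => f (u, v))) }.

Lemma function_norm_unit : function_norm (fun f : unit -> \bar R => `|f tt|).
Proof.
split => //.
- by move=> f g f0 fg; rewrite !gee0_abs// (le_trans (f0 tt)).
- by move=> c f c0 mf f0; rewrite abseM !gee0_abs.
- move=> d' V nu f mf f0; rewrite gee0_abs ?integral_ge0//.
  by apply: le_integralT => // v; rewrite gee0_abs.
- move=> d' V f mf f0; apply: measurableT_comp => //.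
  exact: measurable_section2.
Qed.

Lemma measurable_pair d d1 d2 (T : measurableType d) (T1 : measurableType d1)
    (T2 : measurableType d2) (f : T -> T1) (g : T -> T2) :
  measurable_fun setT f -> measurable_fun setT g ->
  measurable_fun setT (fun x => (f x, g x)).
Proof. by move=> mf mg; apply/measurable_fun_pairP. Qed.

Section iterated_norm.
Context d (U : measurableType d) (N : (U -> \bar R) -> \bar R)
  d' (T : measurableType d') (mu : {sigma_finite_measure set T -> \bar R})
  (r : R) (r1 : (1 <= r)%R) (hN : function_norm N).

Definition iter_norm (f : U * T -> \bar R) : \bar R :=
  Lnorm mu r%:E (fun x => N (fun u => f (u, x))).

Let r0 : (0 < r)%R. Proof. exact: lt_le_trans r1. Qed.

Lemma measurable_swap_pair d1 d2 d3 (A : measurableType d1) (B : measurableType d2)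
    (C : measurableType d3) (f : A * B * C -> \bar R) :
  measurable_fun setT f ->
  measurable_fun setT (fun z : A * (B * C) => f (z.1, z.2.1, z.2.2)).
Proof.
move=> mf; apply: (measurableT_comp mf); apply: measurable_pair.
  apply: measurable_pair => //.
  exact: (measurableT_comp measurable_fst measurable_snd).
exact: (measurableT_comp measurable_snd measurable_snd).
Qed.

Lemma LnormZ_ge0 (c : R) (g : T -> \bar R) : (0 <= c)%R ->
  measurable_fun setT g -> (forall x, 0 <= g x) ->
  Lnorm mu r%:E (fun x => c%:E * g x) = c%:E * Lnorm mu r%:E g.
Proof.
move=> c0 mg g0; rewrite !ge0_Lnorm//; last by move=> x; rewrite mule_ge0.
rewrite (eq_integral (fun x => (c `^ r)%:E * (g x `^ r))); last first.
  by move=> x _; rewrite poweRM.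
rewrite ge0_integralZl ?lee_fin ?powR_ge0//; last 2 first.
- exact: measurable_fun_poweR.
- by move=> x _; exact: poweR_ge0.
rewrite poweRM ?lee_fin ?powR_ge0//; last first.
  by apply: integral_ge0 => x _; exact: poweR_ge0.
by rewrite poweR_EFin -powRrM mulfV ?gt_eqF// powRr1.
Qed.

(** The integral inequality is Minkowski's inequality applied to the norms of the
    sections. *)
Lemma function_norm_iter : function_norm iter_norm.
Proof.
split.
- by move=> f; exact: Lnorm_ge0.
- move=> f g f0 fg; apply: le_Lnorm => // x.
  by rewrite !gee0_abs ?(fnorm_ge0 hN)//; exact: (fnorm_le hN).
- move=> c f c0 mf f0; rewrite -LnormZ_ge0//; last 2 first.
  - exact: (fnorm_measurable hN).
  - by move=> x; exact: (fnorm_ge0 hN).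
  apply: le_Lnorm => // x; rewrite abseM !gee0_abs ?(fnorm_ge0 hN)//.
  by apply: (fnormZ_le hN) => //; exact: measurable_section1.
- move=> d2 V nu f mf f0.
  have mg : measurable_fun setT
      (fun z : T * V => N (fun u => f (u, z.1, z.2))).
    exact: (fnorm_measurable hN (measurable_swap_pair mf)).
  apply: (@le_trans _ _
      (Lnorm mu r%:E (fun x => \int[nu]_v N (fun u => f (u, x, v))))); last first.
    apply: (minkowski_integral mu nu r1 mg) => z; exact: (fnorm_ge0 hN).
  apply: le_Lnorm => // x.
  rewrite !gee0_abs ?(fnorm_ge0 hN) ?integral_ge0//; last first.
    by move=> v _; exact: (fnorm_ge0 hN).
  apply: (@fnorm_integral _ _ _ hN _ _ nu (fun z => f (z.1, x, z.2))) => //.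
  apply: (measurableT_comp mf); apply: measurable_pair => //.
  exact: measurable_pair.
- move=> d2 V f mf f0.
  apply: (@measurable_Lnorm_section1 _ _ _ _ _ mu (fun z : T * V => N (fun u => f (u, z.1, z.2)))).
    exact: (fnorm_measurable hN (measurable_swap_pair mf)).
  by move=> z; exact: (fnorm_ge0 hN).
Qed.

End iterated_norm.

Section subadditivity.
Context d (U : measurableType d) (N : (U -> \bar R) -> \bar R)
  (hN : function_norm N).

(** The triangle inequality is the integral inequality for a function of [y]
    equal to [f] on an interval of length one and to [g] on another. *)
Lemma fnormD (f g : U -> \bar R) :
  measurable_fun setT f -> measurable_fun setT g ->
  (forall u, 0 <= f u) -> (forall u, 0 <= g u) ->
  N (fun u => f u + g u) <= N f + N g.
Proof.
move=> mf mg f0 g0.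
pose mu := @lebesgue_measure R : {sigma_finite_measure set (measurableTypeR R) -> \bar R}.
pose I0 : set (measurableTypeR R) := `[0%R, 1%R]%classic.
pose I1 : set (measurableTypeR R) := `]1%R, 2%R]%classic.
have m0 : measurable I0 by exact: measurable_itv.
have m1 : measurable I1 by exact: measurable_itv.
have mu0 : mu I0 = 1 by rewrite /mu/= lebesgue_measure_itv/= lte_fin ltr01 sube0.
have mu1 : mu I1 = 1.
  rewrite /mu/= lebesgue_measure_itv/= lte_fin ltr1n -EFinB; congr EFin; lra.
have intI (I : set (measurableTypeR R)) (c : \bar R) : measurable I -> 0 <= c ->
    mu I = 1 -> \int[mu]_y (c * (\1_I y)%:E) = c.
  move=> mI c0 muI; rewrite ge0_integralZl//; last first.
    by apply/measurable_EFinP; exact: measurable_indic.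
  by rewrite integral_indic// setIT [X in _ * X]muI mule1.
have key (a b : \bar R) : 0 <= a -> 0 <= b ->
    \int[mu]_y (a * (\1_I0 y)%:E + b * (\1_I1 y)%:E) = a + b.
  move=> a0 b0; rewrite ge0_integralD//; first by rewrite !intI.
  - by move=> y _; rewrite mule_ge0// lee_fin.
  - apply: measurable_funeM; apply/measurable_EFinP; exact: measurable_indic.
  - by move=> y _; rewrite mule_ge0// lee_fin.
  - apply: measurable_funeM; apply/measurable_EFinP; exact: measurable_indic.
pose h (z : U * measurableTypeR R) := f z.1 * (\1_I0 z.2)%:E + g z.1 * (\1_I1 z.2)%:E.
have -> : (fun u => f u + g u) = (fun u => \int[mu]_y h (u, y)).
  by apply/funext => u; rewrite /h/= key.
apply: le_trans; first apply: (fnorm_integral hN).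
- apply: emeasurable_funD; apply: emeasurable_funM.
  + exact: measurableT_comp.
  + apply/measurable_EFinP; apply: measurableT_comp => //; exact: measurable_indic.
  + exact: measurableT_comp.
  + apply/measurable_EFinP; apply: measurableT_comp => //; exact: measurable_indic.
- by move=> z; rewrite /h adde_ge0// mule_ge0// lee_fin.
rewrite -(key (N f) (N g)) ?(fnorm_ge0 hN)//.
apply: le_integralT => y; first exact: (fnorm_ge0 hN).
have N0 : N (fun u => 0 * f u) <= 0.
  by have := fnormZ_le hN (lexx 0%R) mf f0; rewrite [X in _ <= X]mul0e.
rewrite /h/= !indicE; case: (boolP (y \in I0)) => y0; case: (boolP (y \in I1)) => y1.
- move: y0 y1; rewrite !inE /I0 /I1/= !in_itv/= => /andP[_ a] /andP[b _].
  by have := lt_le_trans b a; rewrite ltxx.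
- rewrite !mule1 !mule0 adde0; under [X in N X]funext do rewrite mule1 mule0 adde0.
  exact: lexx.
- rewrite !mule1 !mule0 add0e; under [X in N X]funext do rewrite mule1 mule0 add0e.
  exact: lexx.
- rewrite !mule0 adde0; apply: le_trans N0.
  by apply: (fnorm_le hN) => u; rewrite !mule0 ?adde0// mul0e.
Qed.

Lemma fnorm_max (f g : U -> \bar R) :
  measurable_fun setT f -> measurable_fun setT g ->
  (forall u, 0 <= f u) -> (forall u, 0 <= g u) ->
  N (fun u => maxe (f u) (g u)) <= N f + N g.
Proof.
move=> mf mg f0 g0; apply: le_trans (fnormD mf mg f0 g0).
apply: (fnorm_le hN) => u; first by rewrite le_max f0.
by rewrite ge_max leeDl ?leeDr// ; apply/andP.
Qed.

End subadditivity.
End function_norms.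

(** * Geometric sums *)

Section geometric_sums.
Context (R : realType).

Definition geom (e : R) : R := (1 - 2 `^ (- e))^-1.

Lemma geom_gt0 (e : R) : 0 < e -> 0 < geom e.
Proof.
move=> e0; rewrite invr_gt0 subr_gt0.
rewrite powRN invf_lt1 ?powR_gt0//.
have := @gt0_ltr_powR _ _ e0 1 2; rewrite powR1; apply; rewrite ?nnegrE//.
exact: ltr1n.
Qed.

Lemma geomE (e : R) : 0 < e -> 1 + 2 `^ (- e) * geom e = geom e.
Proof.
move=> e0; rewrite /geom; field.
by have := geom_gt0 e0; rewrite invr_gt0 => /lt0r_neq0.
Qed.

(** A geometric sum is controlled by its largest term. *)
Lemma geometric_sum_below (e x z : R) (N : nat) : 0 < e -> 0 < x -> 0 < z ->
  \sum_(n < N) (if x * 2 ^+ n < z then (x * 2 ^+ n) `^ e else 0)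
    <= geom e * z `^ e.
Proof.
move=> e0 x0 z0; have g0 := geom_gt0 e0.
have geo M : \sum_(n < M.+1) (x * 2 ^+ n) `^ e <= geom e * (x * 2 ^+ M) `^ e.
  elim: M => [|M IH].
    rewrite big_ord_recr big_ord0/= add0r -[leLHS]mul1r ler_wpM2r ?powR_ge0//.
    by rewrite -(geomE e0) lerDl mulr_ge0 ?powR_ge0// ltW.
  rewrite big_ord_recr/=; apply: le_trans (lerD IH (lexx _)) _.
  rewrite -[X in _ <= X * _](geomE e0) mulrDl mul1r addrC lerD2l.
  have E : 2 `^ (- e) * 2 `^ e = 1 :> R.
    by rewrite -powRD ?pnatr_eq0 ?implybT// addNr powRr0.
  rewrite exprS mulrCA [X in _ <= _ * X]powRM ?mulr_ge0 ?exprn_ge0 ?(ltW x0)//.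
  by rewrite mulrACA E mul1r.
elim: N => [|N IH]; first by rewrite big_ord0 mulr_ge0 ?powR_ge0// ltW.
have [xz|xz] := ltP (x * 2 ^+ N) z; last first.
  by rewrite big_ord_recr/= ltNge xz/= addr0.
apply: (@le_trans _ _ (\sum_(n < N.+1) (x * 2 ^+ n) `^ e)).
  by apply: ler_sum => n _; case: ifP => // _; exact: powR_ge0.
apply: le_trans (geo N) _; rewrite ler_wpM2l ?(ltW g0)//.
by rewrite ge0_ler_powR ?(ltW e0) ?nnegrE ?mulr_ge0 ?exprn_ge0 ?ltW.
Qed.

Lemma geometric_sum_above (e x z : R) (N : nat) : 0 < e -> 0 < x -> 0 < z ->
  \sum_(n < N) (if z < x * 2 ^+ n then (x * 2 ^+ n) `^ (- e) else 0)
    <= geom e * z `^ (- e).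
Proof.
move=> e0 + z0; have g0 := geom_gt0 e0.
have geo M : forall x, 0 < x ->
    \sum_(n < M) (x * 2 ^+ n) `^ (- e) <= geom e * x `^ (- e).
  elim: M => [|M IH] y y0; first by rewrite big_ord0 mulr_ge0 ?powR_ge0 ?ltW.
  rewrite big_ord_recl/= expr0 mulr1.
  rewrite (eq_bigr (fun n : 'I_M => ((y * 2) * 2 ^+ n) `^ (- e))); last first.
    by move=> n _; rewrite /bump/= add1n exprS mulrA.
  apply: le_trans (lerD (lexx _) (IH _ _)) _; first by rewrite mulr_gt0.
  rewrite -[X in _ <= X * _](geomE e0) mulrDl mul1r lerD2l.
  rewrite powRM ?(ltW y0)// le_eqVlt; apply/orP; left; apply/eqP; ring.
elim: N x => [|N IH] x x0; first by rewrite big_ord0 mulr_ge0 ?powR_ge0 ?ltW.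
have [zx|zx] := ltP z x.
  apply: (@le_trans _ _ (\sum_(n < N.+1) (x * 2 ^+ n) `^ (- e))).
    by apply: ler_sum => n _; case: ifP => // _; exact: powR_ge0.
  apply: le_trans (geo _ _ x0) _; rewrite ler_wpM2l ?(ltW g0)//.
  rewrite !powRN lef_pV2 ?posrE ?powR_gt0//.
  by rewrite ge0_ler_powR ?(ltW e0) ?nnegrE ?ltW.
rewrite big_ord_recl/= expr0 mulr1 ltNge zx/= add0r.
rewrite (eq_bigr (fun n : 'I_N => if z < (x * 2) * 2 ^+ n
    then ((x * 2) * 2 ^+ n) `^ (- e) else 0)); last first.
  by move=> n _; rewrite /bump/= add1n exprS mulrA.
by apply: IH; rewrite mulr_gt0.
Qed.

End geometric_sums.

(** * Integrals of powers and distribution functions *)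

Section layer_cake.
Context (R : realType).
Local Open Scope ereal_scope.
Implicit Types (e : R) (A B : R -> \bar R) (z : \bar R).

(** A discrete stand-in for [\int_0^oo l ^ (e - 1) A l dl]. *)
Definition level_sum e A : \bar R :=
  \sum_(n <oo) (((2 ^+ n) `^ e)%:E * A (2 ^+ n)%R +
                ((2 ^- n) `^ e)%:E * A (2 ^- n)%R).

Let term_ge0 e A n : (forall l, 0 <= A l) ->
  0 <= ((2 ^+ n) `^ e)%:E * A (2 ^+ n)%R + ((2 ^- n) `^ e)%:E * A (2 ^- n)%R.
Proof. by move=> A0; rewrite adde_ge0// mule_ge0// lee_fin powR_ge0. Qed.

Lemma le_level_sum e A B : (forall l, 0 <= A l) ->
  (forall l, (0 < l)%R -> A l <= B l) -> level_sum e A <= level_sum e B.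
Proof.
move=> A0 AB; apply: lee_nneseries => n _; first by rewrite term_ge0.
apply: leeD; apply: lee_wpmul2l; rewrite ?lee_fin ?powR_ge0//; apply: AB.
  by rewrite exprn_gt0.
by rewrite invr_gt0 exprn_gt0.
Qed.

Lemma level_sumD e A B : (forall l, 0 <= A l) -> (forall l, 0 <= B l) ->
  level_sum e (fun l => A l + B l) = level_sum e A + level_sum e B.
Proof.
move=> A0 B0; rewrite /level_sum -nneseriesD; last 2 first.
- by move=> *; exact: term_ge0.
- by move=> *; exact: term_ge0.
apply: eq_eseriesr => n _.
by rewrite !ge0_muleDr// addeACA.
Qed.

Lemma level_sumZ e A (c : R) : (0 <= c)%R -> (forall l, 0 <= A l) ->
  level_sum e (fun l => c%:E * A l) = c%:E * level_sum e A.
Proof.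
move=> c0 A0; rewrite /level_sum -nneseriesZl; last first.
  by move=> *; exact: term_ge0.
apply: eq_eseriesr => n _; rewrite ge0_muleDr ?mule_ge0 ?lee_fin ?powR_ge0//.
by rewrite [in RHS]muleCA [X in _ = _ + X]muleCA.
Qed.

Lemma level_sumV e A : (forall l, 0 <= A l) ->
  level_sum e (fun l => (l^-1)%:E * A l) = level_sum (e - 1) A.
Proof.
move=> A0; apply: eq_eseriesr => n _; rewrite !muleA -!EFinM.
rewrite !powRB ?expf_neq0 ?invr_eq0 ?implybT ?expf_neq0 ?implybT//.
by rewrite !powRr1// ?invr_ge0 ?exprn_ge0.
Qed.

(** Comparable with [z ^ e]: the levels below [z] form a geometric sum whose
    largest term is at least [(z / 2) ^ e]. *)
Definition levels e z := level_sum e (fun l => ((l%:E < z)%E)%:R%:E).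

Lemma levels_ge0 e z : 0 <= levels e z.
Proof.
apply: nneseries_ge0 => n _ _.
by apply: (@term_ge0 e (fun l => ((l%:E < z)%E)%:R%:E)) => l; rewrite lee_fin.
Qed.

Lemma levels_le e z : (0 < e)%R -> 0 <= z ->
  levels e z <= (2 * geom e)%:E * z `^ e.
Proof.
move=> e0; have g0 := geom_gt0 e0; case: z => [z| |]//; last first.
  by rewrite poweRyr ?gt_eqF// gt0_muley ?leey// lte_fin mulr_gt0.
rewrite lee_fin le_eqVlt => /predU1P[<-|z0].
  rewrite /levels /level_sum eseries0 ?mule_ge0 ?poweR_ge0 ?lee_fin ?mulr_ge0 ?ltW//.
  move=> n _ _; rewrite !lte_fin !ltNge invr_ge0 !exprn_ge0//=.
  by rewrite !mule0 adde0.
apply: lime_le.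
  apply: is_cvg_nneseries => n _ _.
  by apply: (@term_ge0 e (fun l => ((l%:E < z%:E)%E)%:R%:E)) => l; rewrite lee_fin.
apply: nearW => N; rewrite big_mkord.
rewrite (eq_bigr (fun n : 'I_N =>
  ((if 1 * 2 ^+ n < z then (1 * 2 ^+ n) `^ e else 0) +
   (if z^-1 < 1 * 2 ^+ n then (1 * 2 ^+ n) `^ (- e) else 0))%:E))%R; last first.
  move=> n _; rewrite !mul1r -!EFinM -EFinD !lte_fin; congr EFin; congr (_ + _)%R.
    by case: ifP; rewrite ?mulr1 ?mulr0.
  rewrite powRN -[in LHS]ltf_pV2 ?posrE ?invr_gt0 ?exprn_gt0// invrK.
  case: ifP; rewrite ?mulr1 ?mulr0// => _.
  by rewrite -powR_inv1 ?exprn_ge0// -powRrM mulN1r powRN.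
rewrite sumEFin lee_fin big_split/= -mulrA mulr_natl mulr2n.
apply: lerD; first exact: geometric_sum_below.
have <- : (z^-1 `^ (- e) = z `^ e)%R.
  by rewrite -[X in (X `^ _)%R = _]powR_inv1 ?(ltW z0)// -powRrM mulrNN mul1r.
by apply: geometric_sum_above; rewrite ?invr_gt0.
Qed.

Lemma le_levels e z1 z2 : z1 <= z2 -> levels e z1 <= levels e z2.
Proof.
move=> z12; apply: le_level_sum => [l|l _]; rewrite lee_fin// ler_nat.
by case: (ltP l%:E z1) => // /lt_le_trans-/(_ _ z12) ->.
Qed.

Lemma level_term_le e (n : nat) A : (forall l, 0 <= A l) ->
  ((2 ^+ n) `^ e)%:E * A (2 ^+ n)%R <= level_sum e A /\
  ((2 ^- n) `^ e)%:E * A (2 ^- n)%R <= level_sum e A.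
Proof.
move=> A0; pose u n := ((2 ^+ n) `^ e)%:E * A (2 ^+ n)%R +
                ((2 ^- n) `^ e)%:E * A (2 ^- n)%R.
have un : u n <= level_sum e A.
  apply: le_trans; last first.
    by apply: (@nneseries_lim_ge _ u xpredT 0 n.+1) => *; exact: term_ge0.
  rewrite big_mkord big_ord_recr/= leeDr// sume_ge0// => i _; exact: term_ge0.
split; apply: le_trans un; rewrite /u ?leeDl ?leeDr//.
  by rewrite mule_ge0 ?lee_fin ?powR_ge0.
by rewrite mule_ge0 ?lee_fin ?powR_ge0.
Qed.

Lemma levels_ge_real e (z : R) : (0 < e)%R -> (0 <= z)%R ->
  (z `^ e)%:E <= (2 `^ e)%:E * levels e z%:E.
Proof.
move=> e0; rewrite le_eqVlt => /predU1P[<-|z0].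
  by rewrite powR0 ?gt_eqF// mule_ge0 ?levels_ge0// lee_fin powR_ge0.
have A0 : forall l, 0 <= ((l%:E < z%:E)%E)%:R%:E :> \bar R.
  by move=> l; rewrite lee_fin.
have fin (y : R) : (0 <= y)%R -> (z <= 2 * y)%R -> (y `^ e)%:E <= levels e z%:E ->
    (z `^ e)%:E <= (2 `^ e)%:E * levels e z%:E.
  move=> y0 zy yl; apply: le_trans (lee_wpmul2l _ yl); last first.
    by rewrite lee_fin powR_ge0.
  rewrite -EFinM lee_fin -powRM// ge0_ler_powR ?(ltW e0) ?nnegrE ?(ltW z0)//.
  by rewrite mulr_ge0.
(* the largest level below [z] is [2 ^ n] or [2 ^ - n] *)
have [z1|z1] := ltP 1%R z.
  have ex : exists n, (z <= 2 ^+ n.+1)%R.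
    exists (Num.Def.archi_bound z); apply: ltW.
    exact: upper_nthrootP.
  case: (ex_minnP ex) => n zn nmin.
  have nz : (2 ^+ n < z)%R.
    by case: n zn nmin => [|n] _ nmin //; rewrite ltNge; apply/negP => /nmin; rewrite ltnn.
  apply: (fin (2 ^+ n)%R); rewrite ?exprn_ge0 -?exprS//.
  have [+ _] := level_term_le e n A0; rewrite lte_fin nz mule1; exact.
have ex : exists n, (2 ^- n < z)%R.
  exists (Num.Def.archi_bound z^-1).
  rewrite -[X in (_ < X)%R]invrK ltf_pV2 ?posrE ?exprn_gt0 ?invr_gt0//.
  exact: upper_nthrootP.
case: (ex_minnP ex) => n nz nmin.
have zn : (z <= 2 * 2 ^- n)%R.
  case: n nz nmin => [|n] _ nmin.
    by rewrite expr0 invr1 mulr1; apply: le_trans z1 _; rewrite ler1n.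
  rewrite exprS invfM mulrA mulfV ?mul1r// leNgt.
  by apply/negP => /nmin; rewrite ltnn.
apply: (fin (2 ^- n)%R); rewrite ?invr_ge0 ?exprn_ge0//.
have [_ +] := level_term_le e n A0; rewrite lte_fin nz mule1; exact.
Qed.

Lemma levels_ge e z : (0 < e)%R -> 0 <= z ->
  z `^ e <= (2 `^ e)%:E * levels e z.
Proof.
move=> e0; case: z => [z| |]//; first exact: levels_ge_real.
move=> _; suff -> : levels e +oo = +oo.
  by rewrite gt0_muley ?leey// lte_fin powR_gt0.
apply/eqyP => y y0.
pose z := ((2 `^ e * y) `^ e^-1)%R.
have z0 : (0 <= z)%R by exact: powR_ge0.
have ze : (z `^ e = 2 `^ e * y)%R.
  rewrite /z -powRrM mulVf ?gt_eqF// powRr1// mulr_ge0 ?powR_ge0//.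
  exact: ltW.
have := levels_ge_real e0 z0; rewrite ze EFinM lee_pmul2l//.
by move=> /le_trans; apply; apply: le_levels; exact: leey.
Qed.

Lemma nneseriesZl_ereal (c : \bar R) (u : nat -> \bar R) : 0 <= c ->
  (forall n, 0 <= u n) -> \sum_(n <oo) (c * u n) = c * \sum_(n <oo) u n.
Proof.
move=> c0 u0; rewrite -!ge0_integral_count//; last by move=> n; rewrite mule_ge0.
exact: ge0_integralZl.
Qed.

Section integrals.
Context d (T : measurableType d) (mu : {measure set T -> \bar R}).

Lemma measurable_level (Z : T -> \bar R) (l : R) : measurable_fun setT Z ->
  measurable_fun setT (fun x => ((l%:E < Z x)%E)%:R%:E : \bar R).
Proof.
move=> mZ; rewrite (_ : (fun _ => _) = fun x => if l%:E < Z x then 1 else 0).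
  by apply: measurable_fun_ifT => //; exact: measurable_fun_lte.
by apply/funext => x; case: ifP.
Qed.

Lemma measurable_levels e (Z : T -> \bar R) : measurable_fun setT Z ->
  measurable_fun setT (fun x => levels e (Z x)).
Proof.
move=> mZ; apply: ge0_emeasurable_sum => [n x _ _|n _].
  by apply: (@term_ge0 e (fun l => ((l%:E < Z x)%E)%:R%:E)) => l; rewrite lee_fin.
by apply: emeasurable_funD; apply: measurable_funeM; exact: measurable_level.
Qed.

Lemma integral_levels e (F Z : T -> \bar R) :
  measurable_fun setT F -> measurable_fun setT Z -> (forall x, 0 <= F x) ->
  \int[mu]_x (F x * levels e (Z x)) =
  level_sum e (fun l => \int[mu]_x (F x * ((l%:E < Z x)%E)%:R%:E)).
Proof.
move=> mF mZ F0.
have E x : F x * levels e (Z x) = \sum_(n <oo)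
    (((2 ^+ n) `^ e)%:E * (F x * (((2 ^+ n)%:E < Z x)%E)%:R%:E) +
     ((2 ^- n) `^ e)%:E * (F x * (((2 ^- n)%:E < Z x)%E)%:R%:E)).
  rewrite -nneseriesZl_ereal//; last first.
    move=> n.
    by apply: (@term_ge0 e (fun l => ((l%:E < Z x)%E)%:R%:E)) => l; rewrite lee_fin.
  apply: eq_eseriesr => n _.
  by rewrite ge0_muleDr ?mule_ge0 ?lee_fin ?powR_ge0// !(muleCA (F x)).
rewrite (eq_integral _ _ (fun x _ => E x)) integral_nneseries//; last 2 first.
- move=> n; apply: emeasurable_funD; apply: measurable_funeM;
    by apply: emeasurable_funM => //; exact: measurable_level.
- move=> n x _.
  by rewrite adde_ge0// mule_ge0 ?lee_fin ?powR_ge0// mule_ge0// lee_fin.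
have mFZ l : measurable_fun setT (fun x => F x * ((l%:E < Z x)%E)%:R%:E).
  by apply: emeasurable_funM => //; exact: measurable_level.
apply: eq_eseriesr => n _; rewrite ge0_integralD//; last 4 first.
- by move=> x _; rewrite mule_ge0 ?lee_fin ?powR_ge0// mule_ge0// lee_fin.
- exact: measurable_funeM.
- by move=> x _; rewrite mule_ge0 ?lee_fin ?powR_ge0// mule_ge0// lee_fin.
- exact: measurable_funeM.
by rewrite !ge0_integralZl// ?lee_fin ?powR_ge0// => x _; rewrite mule_ge0// lee_fin.
Qed.

Lemma integral_level (Z : T -> \bar R) (l : R) : measurable_fun setT Z ->
  \int[mu]_x ((l%:E < Z x)%E)%:R%:E = mu [set x | l%:E < Z x].
Proof.
move=> mZ; set E := [set x | _]; have mE : measurable E.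
  by rewrite -[X in measurable X]setTI; exact: emeasurable_fun_o_infty.
rewrite (eq_integral (fun x => (\1_E x)%:E)).
  by rewrite integral_indic ?setIT.
by move=> x _; rewrite indicE mem_setE.
Qed.

End integrals.

(** Strong type from a weak type inequality in which the large values of [F]
    alone enter: this is Marcinkiewicz interpolation with [L^oo]. *)
Lemma strong_type_of_weak_type e : (1 < e)%R -> exists C : R, (0 <= C)%R /\
  forall d (T : measurableType d) (mu : {measure set T -> \bar R})
    (F G : T -> \bar R), measurable_fun setT F -> measurable_fun setT G ->
  (forall x, 0 <= F x) -> (forall x, 0 <= G x) ->
  (forall l, (0 < l)%R -> l%:E * mu [set x | (2 * l)%:E < G x] <=
     \int[mu]_x (F x * ((l%:E < F x)%E)%:R%:E)) ->
  \int[mu]_x (G x `^ e) <= C%:E * \int[mu]_x (F x `^ e).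
Proof.
move=> e1; have e0 : (0 < e)%R by exact: lt_trans e1.
have eB : (0 < e - 1)%R by rewrite subr_gt0.
have gB := geom_gt0 eB.
exists (2 `^ e * 2 `^ e * (2 * geom (e - 1)))%R; split.
  by rewrite !mulr_ge0 ?powR_ge0// ltW.
move=> d T mu F G mF mG F0 G0 weak.
pose H x := 2^-1%:E * G x.
have mH : measurable_fun setT H by exact: measurable_funeM.
have H0 x : 0 <= H x by rewrite mule_ge0// lee_fin invr_ge0.
have HG x : G x = 2%:E * H x by rewrite /H muleA -EFinM mulfV ?mul1e// pnatr_eq0.
have step1 : \int[mu]_x (G x `^ e) <=
    (2 `^ e * 2 `^ e)%:E * \int[mu]_x (cst 1 x * levels e (H x)).
  rewrite -ge0_integralZl//; last 2 first.
  - by apply: emeasurable_funM => //; exact: measurable_levels.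
  - by move=> x _; rewrite mul1e levels_ge0.
  apply: le_integralT => x; first exact: poweR_ge0.
  rewrite HG poweRM// poweR_EFin mul1e EFinM -muleA; apply: lee_wpmul2l.
    by rewrite lee_fin powR_ge0.
  exact: levels_ge.
apply: le_trans step1 _; rewrite [in leRHS]EFinM -[leRHS]muleA.
apply: lee_wpmul2l; first by rewrite lee_fin mulr_ge0 ?powR_ge0.
rewrite integral_levels//.
apply: (@le_trans _ _ (\int[mu]_x (F x * levels (e - 1) (F x)))).
  rewrite integral_levels// -level_sumV; last first.
    by move=> l; apply: integral_ge0 => x _; rewrite mule_ge0// lee_fin.
  apply: le_level_sum => [l|l l0].
    by apply: integral_ge0 => x _; rewrite mul1e lee_fin.
  rewrite lee_pdivlMl//; apply: le_trans (weak _ l0).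
  rewrite lee_pmul2l// (eq_integral (fun x => ((l%:E < H x)%E)%:R%:E)); last first.
    by move=> x _; rewrite mul1e.
  rewrite integral_level//; apply: le_measure; rewrite ?inE.
  - by rewrite -[X in measurable X]setTI; exact: emeasurable_fun_o_infty.
  - by rewrite -[X in measurable X]setTI; exact: emeasurable_fun_o_infty.
  by move=> x /=; rewrite HG EFinM lte_pmul2l// lte_fin.
rewrite -ge0_integralZl//; last 3 first.
- exact: measurable_fun_poweR.
- by move=> x _; exact: poweR_ge0.
- by rewrite lee_fin mulr_ge0// ltW.
apply: le_integralT => x; first by rewrite mule_ge0// levels_ge0.
apply: le_trans (lee_wpmul2l (F0 x) (levels_le eB (F0 x))) _.
rewrite muleCA; apply: lee_wpmul2l; first by rewrite lee_fin mulr_ge0// ltW.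
have [->|Fx0] := eqVneq (F x) 0; first by rewrite mul0e poweR_ge0.
rewrite -[X in X * _]poweRe1// -poweRD; first by rewrite addrC subrK.
by apply: nneg_neq0_poweRD_def => //; exact: ltW.
Qed.

(** Integration of a good-lambda inequality. The finiteness of the left-hand
    side is what allows the term with [Z] to be absorbed. *)
Lemma good_lambda e : (0 < e)%R -> exists a C : R, (0 < a)%R /\ (0 <= C)%R /\
  forall d (T : measurableType d) (mu : {measure set T -> \bar R})
    (Z H : T -> \bar R), measurable_fun setT Z -> measurable_fun setT H ->
  (forall x, 0 <= Z x) -> (forall x, 0 <= H x) ->
  \int[mu]_x (Z x `^ e) < +oo ->
  (forall l, (0 < l)%R -> mu [set x | (2 * l)%:E < Z x] <=
     a%:E * mu [set x | l%:E < Z x] + mu [set x | l%:E < H x]) ->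
  \int[mu]_x (Z x `^ e) <= C%:E * \int[mu]_x (H x `^ e).
Proof.
move=> e0; have g0 := geom_gt0 e0.
pose K := (2 `^ e * 2 `^ e * (2 * geom e))%R.
have K0 : (0 < K)%R by rewrite !mulr_gt0 ?powR_gt0.
exists (2^-1 / K)%R, (2 * K)%R; split; first by rewrite !divr_gt0 ?invr_gt0.
split; first by rewrite mulr_ge0 ?ltW.
move=> d T mu Z H mZ mH Z0 H0 Zfin gl.
pose Y x := 2^-1%:E * Z x.
have mY : measurable_fun setT Y by exact: measurable_funeM.
have Y0 x : 0 <= Y x by rewrite mule_ge0// lee_fin invr_ge0.
have YZ x : Z x = 2%:E * Y x by rewrite /Y muleA -EFinM mulfV ?mul1e// pnatr_eq0.
have step1 : \int[mu]_x (Z x `^ e) <=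
    (2 `^ e * 2 `^ e)%:E * \int[mu]_x (cst 1 x * levels e (Y x)).
  rewrite -ge0_integralZl//; last 2 first.
  - by apply: emeasurable_funM => //; exact: measurable_levels.
  - by move=> x _; rewrite mul1e levels_ge0.
  apply: le_integralT => x; first exact: poweR_ge0.
  rewrite YZ poweRM// poweR_EFin mul1e EFinM -muleA; apply: lee_wpmul2l.
    by rewrite lee_fin powR_ge0.
  exact: levels_ge.
have up (W : T -> \bar R) : measurable_fun setT W -> (forall x, 0 <= W x) ->
    \int[mu]_x (cst 1 x * levels e (W x)) <= (2 * geom e)%:E * \int[mu]_x (W x `^ e).
  move=> mW W0; rewrite -ge0_integralZl//; last 3 first.
  - exact: measurable_fun_poweR.
  - by move=> x _; exact: poweR_ge0.
  - by rewrite lee_fin mulr_ge0// ltW.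
  apply: le_integralT => x; first by rewrite mul1e levels_ge0.
  by rewrite mul1e levels_le.
have one (W : T -> \bar R) l : measurable_fun setT W ->
    \int[mu]_x (cst 1 x * ((l%:E < W x)%E)%:R%:E) = mu [set x | l%:E < W x].
  move=> mW; rewrite -integral_level//.
  by apply: eq_integral => x _; rewrite mul1e.
have step2 : \int[mu]_x (cst 1 x * levels e (Y x)) <=
    (2^-1 / K)%:E * \int[mu]_x (cst 1 x * levels e (Z x)) +
    \int[mu]_x (cst 1 x * levels e (H x)).
  rewrite !integral_levels// -level_sumZ; last 2 first.
  - by rewrite divr_ge0 ?invr_ge0 ?ltW.
  - by move=> l; apply: integral_ge0 => x _; rewrite mul1e lee_fin.
  rewrite -level_sumD; last 2 first.
  - move=> l; rewrite mule_ge0 ?lee_fin ?divr_ge0 ?invr_ge0 ?(ltW K0)//.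
    by apply: integral_ge0 => x _; rewrite mul1e lee_fin.
  - by move=> l; apply: integral_ge0 => x _; rewrite mul1e lee_fin.
  apply: le_level_sum => [l|l l0].
    by apply: integral_ge0 => x _; rewrite mul1e lee_fin.
  rewrite !one//; apply: le_trans (gl _ l0).
  apply: le_measure; rewrite ?inE.
  - by rewrite -[X in measurable X]setTI; exact: emeasurable_fun_o_infty.
  - by rewrite -[X in measurable X]setTI; exact: emeasurable_fun_o_infty.
  by move=> x /=; rewrite YZ EFinM lte_pmul2l// lte_fin.
have : \int[mu]_x (Z x `^ e) <= 2^-1%:E * \int[mu]_x (Z x `^ e) +
    K%:E * \int[mu]_x (H x `^ e).
  apply: le_trans step1 _.
  have k0 : 0 <= (2 `^ e * 2 `^ e)%:E :> \bar R by rewrite lee_fin mulr_ge0 ?powR_ge0.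
  apply: le_trans (lee_wpmul2l k0 step2) _.
  have IH0 (W : T -> \bar R) : 0 <= \int[mu]_x (W x `^ e).
    by apply: integral_ge0 => x _; exact: poweR_ge0.
  have b0 : 0 <= (2^-1 / K)%:E :> \bar R by rewrite lee_fin divr_ge0 ?invr_ge0 ?ltW.
  rewrite ge0_muleDr; last 2 first.
  - by rewrite mule_ge0//; apply: integral_ge0 => x _; rewrite mul1e levels_ge0.
  - by apply: integral_ge0 => x _; rewrite mul1e levels_ge0.
  apply: leeD.
    rewrite muleA -EFinM.
    have c0 : 0 <= (2 `^ e * 2 `^ e * (2^-1 / K))%:E :> \bar R.
      by rewrite lee_fin !mulr_ge0 ?powR_ge0 ?invr_ge0 ?ltW.
    apply: le_trans (lee_wpmul2l c0 (up _ mZ Z0)) _.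
    rewrite muleA -EFinM (_ : (_ * (2 * geom e) = 2^-1)%R)//.
    by rewrite mulrAC -/K mulrCA mulfV ?mulr1// gt_eqF.
  apply: le_trans (lee_wpmul2l k0 (up _ mH H0)) _.
  by rewrite muleA -EFinM.
set I := \int[mu]_x _ in Zfin *; set J := \int[mu]_x (H x `^ e) => IJ.
have I0 : 0 <= I by apply: integral_ge0 => x _; exact: poweR_ge0.
have J0 : 0 <= J by apply: integral_ge0 => x _; exact: poweR_ge0.
have If : I \is a fin_num by rewrite ge0_fin_numE.
case: J J0 IJ => [j j0|_ _|//]; last first.
  by rewrite gt0_muley ?leey// lte_fin mulr_gt0.
by rewrite -(fineK If) -!EFinM -EFinD !lee_fin; lra.
Qed.

End layer_cake.

(** * Averages over nested partitions *)

Section dyadic_filtrations.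
Context (R : realType) d (T : measurableType d)
  (mu : {sigma_finite_measure set T -> \bar R}).
Local Open Scope ereal_scope.

(** Partitions of [T] into the level sets of [cell k], coarser and coarser as
    [k] grows, the cells of rank [k] having measure [lam k]. *)
Record dyadic_filtration (cell : nat -> T -> R) (lam : nat -> R) : Prop :=
  DyadicFiltration {
  cell_measurable : forall k, measurable_fun setT (cell k) ;
  cell_nested : forall k x y, cell k x = cell k y -> cell k.+1 x = cell k.+1 y ;
  lam_gt0 : forall k, (0 < lam k)%R ;
  lamS : forall k, lam k.+1 = (2 * lam k)%R ;
  cell_measure : forall k x, mu [set y | cell k x == cell k y] = (lam k)%:E }.

Variables (cell : nat -> T -> R) (lam : nat -> R).
Hypothesis hcell : dyadic_filtration cell lam.

Definition cell_kernel k x y : \bar R :=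
  if cell k x == cell k y then (lam k)^-1%:E else 0.

Definition cond_exp k (h : T -> \bar R) x : \bar R :=
  \int[mu]_y (cell_kernel k x y * h y).

Lemma cell_kernel_ge0 k x y : 0 <= cell_kernel k x y.
Proof.
by rewrite /cell_kernel; case: ifP => // _; rewrite lee_fin invr_ge0 ltW// (lam_gt0 hcell).
Qed.
Local Hint Resolve cell_kernel_ge0 : core.

Lemma cell_kernelC k x y : cell_kernel k x y = cell_kernel k y x.
Proof. by rewrite /cell_kernel eq_sym. Qed.

Lemma cell_kernel_cell k x x' y : cell k x = cell k x' ->
  cell_kernel k x y = cell_kernel k x' y.
Proof. by rewrite /cell_kernel => ->. Qed.

Lemma cell_le j k x y : (j <= k)%N -> cell j x = cell j y -> cell k x = cell k y.
Proof.
by move/subnK => <-; elim: (k - j)%N => // i IH /IH; exact: (cell_nested hcell).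
Qed.

Lemma measurable_cell_kernel2 k :
  measurable_fun setT (fun z : T * T => cell_kernel k z.1 z.2).
Proof.
apply: measurable_fun_ifT => //; apply: measurable_fun_eqr.
  exact: (measurableT_comp (cell_measurable hcell k)).
exact: (measurableT_comp (cell_measurable hcell k)).
Qed.

Lemma measurable_cell_kernel k x : measurable_fun setT (cell_kernel k x).
Proof. exact: (measurable_section2 x (measurable_cell_kernel2 k)). Qed.

Lemma cond_exp_ge0 k h x : (forall y, 0 <= h y) -> 0 <= cond_exp k h x.
Proof. by move=> h0; apply: integral_ge0 => y _; rewrite mule_ge0. Qed.

Lemma measurable_cond_exp_param d' (U : measurableType d') k (f : U * T -> \bar R) :
  measurable_fun setT f -> (forall z, 0 <= f z) ->
  measurable_fun setT (fun z : U * T => cond_exp k (fun y => f (z.1, y)) z.2).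
Proof.
move=> mf f0; apply: (measurable_fun_fubini_tonelli_F
  (fun w : (U * T) * T => cell_kernel k w.1.2 w.2 * f (w.1.1, w.2))).
  apply: emeasurable_funM.
    apply: (@measurableT_comp _ _ _ _ _ _ (fun z : T * T => cell_kernel k z.1 z.2)
      setT (fun w : (U * T) * T => (w.1.2, w.2)) (measurable_cell_kernel2 k)).
    apply: measurable_pair => //.
    exact: (measurableT_comp measurable_snd measurable_fst).
  apply: (@measurableT_comp _ _ _ _ _ _ f
    setT (fun w : (U * T) * T => (w.1.1, w.2)) mf).
  apply: measurable_pair => //.
  exact: (measurableT_comp measurable_fst measurable_fst).
by move=> w; rewrite mule_ge0.
Qed.

Lemma measurable_cond_exp k (h : T -> \bar R) :
  measurable_fun setT h -> (forall z, 0 <= h z) ->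
  measurable_fun setT (cond_exp k h).
Proof.
move=> mh h0.
have := @measurable_cond_exp_param _ unit k (fun z => h z.2)
  (measurableT_comp mh measurable_snd) (fun z => h0 z.2).
by move/(measurable_section2 tt).
Qed.

Lemma eq_cond_exp k g h x : (forall y, cell k x = cell k y -> g y = h y) ->
  cond_exp k g x = cond_exp k h x.
Proof.
move=> gh; apply: eq_integral => y _; rewrite /cell_kernel.
by case: eqP => [/gh ->//|_]; rewrite !mul0e.
Qed.

Lemma le_cond_exp k g h x : (forall y, 0 <= g y) -> (forall y, g y <= h y) ->
  cond_exp k g x <= cond_exp k h x.
Proof.
move=> g0 gh; apply: le_integralT => y; first by rewrite mule_ge0.
exact: lee_wpmul2l.
Qed.

Lemma cond_exp_cell k h x y : cell k x = cell k y ->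
  cond_exp k h x = cond_exp k h y.
Proof.
by move=> xy; apply: eq_integral => z _; rewrite (cell_kernel_cell _ xy).
Qed.

Lemma cond_expM k phi h x :
  measurable_fun setT h -> (forall y, 0 <= h y) -> (forall y, 0 <= phi y) ->
  (forall y, cell k x = cell k y -> phi y = phi x) ->
  cond_exp k (fun y => phi y * h y) x = phi x * cond_exp k h x.
Proof.
move=> mh h0 phi0 cphi; rewrite /cond_exp -ge0_integralZl//; last 2 first.
- by apply: emeasurable_funM => //; exact: measurable_cell_kernel.
- by move=> y _; rewrite mule_ge0.
apply: eq_integral => y _; rewrite muleCA muleA [RHS]muleA.
rewrite /cell_kernel; case: eqP => [/cphi ->//|_]; by rewrite !(mul0e, mule0).
Qed.

Lemma cond_expD k g h x :
  measurable_fun setT g -> (forall y, 0 <= g y) ->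
  measurable_fun setT h -> (forall y, 0 <= h y) ->
  cond_exp k (fun y => g y + h y) x = cond_exp k g x + cond_exp k h x.
Proof.
move=> mg g0 mh h0; rewrite /cond_exp -ge0_integralD//.
- by apply: eq_integral => y _; rewrite ge0_muleDr.
- by move=> y _; rewrite mule_ge0.
- by apply: emeasurable_funM => //; exact: measurable_cell_kernel.
- by move=> y _; rewrite mule_ge0.
- by apply: emeasurable_funM => //; exact: measurable_cell_kernel.
Qed.

Lemma cond_exp_sum k n (h : nat -> T -> \bar R) x :
  (forall i, measurable_fun setT (h i)) -> (forall i y, 0 <= h i y) ->
  cond_exp k (fun y => \sum_(i < n) h i y) x = \sum_(i < n) cond_exp k (h i) x.
Proof.
move=> mh h0; elim: n => [|n IH].
  rewrite big_ord0; apply: integral0_eq => y _.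
  by rewrite big_ord0 mule0.
rewrite big_ord_recr/= -IH -cond_expD//.
- by apply: eq_cond_exp => y _; rewrite big_ord_recr.
- exact: emeasurable_sum.
- by move=> y; exact: sume_ge0.
Qed.

Lemma cond_exp_cst k (c : \bar R) x : 0 <= c -> cond_exp k (cst c) x = c.
Proof.
move=> c0; rewrite /cond_exp /= ge0_integralZr//; last exact: measurable_cell_kernel.
rewrite [X in X * _](_ : _ = 1) ?mul1e//.
set S := [set y | cell k x == cell k y].
have mS : measurable S.
  rewrite -[X in measurable X]setTI.
  have /(_ measurableT [set true]) : measurable_fun setT (fun y => cell k x == cell k y).
    by apply: measurable_fun_eqr; [exact: measurable_cst|exact: (cell_measurable hcell k)].
  by apply.
rewrite (eq_integral (fun y => (lam k)^-1%:E * (\1_S y)%:E)); last first.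
  move=> y _; rewrite /cell_kernel indicE.
  have -> : (y \in S) = (cell k x == cell k y) by apply/idP/idP; rewrite inE.
  by case: (cell k x == _); rewrite ?mule1 ?mule0.
rewrite ge0_integralZl//; last 2 first.
- by apply/measurable_EFinP; exact: measurable_indic.
- by rewrite lee_fin invr_ge0 ltW// (lam_gt0 hcell).
rewrite integral_indic// setIT /S [X in _ * X](cell_measure hcell) -EFinM mulVf//.
by rewrite gt_eqF// (lam_gt0 hcell).
Qed.

Lemma cond_exp_adj k g h :
  measurable_fun setT g -> (forall y, 0 <= g y) ->
  measurable_fun setT h -> (forall y, 0 <= h y) ->
  \int[mu]_x (g x * cond_exp k h x) = \int[mu]_x (cond_exp k g x * h x).
Proof.
move=> mg g0 mh h0.
transitivity (\int[mu]_x \int[mu]_y (g x * (cell_kernel k x y * h y))).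
  apply: eq_integral => x _; rewrite -ge0_integralZl//.
  - by apply: emeasurable_funM => //; exact: measurable_cell_kernel.
  - by move=> y _; rewrite mule_ge0.
rewrite (fubini_tonelli (fun z => g z.1 * (cell_kernel k z.1 z.2 * h z.2))); last 2 first.
- apply: emeasurable_funM; first exact: measurableT_comp.
  apply: emeasurable_funM; first exact: measurable_cell_kernel2.
  exact: measurableT_comp.
- by move=> z; rewrite !mule_ge0.
apply: eq_integral => y _ /=; rewrite /cond_exp -ge0_integralZr//.
- by apply: eq_integral => x _; rewrite muleA (muleC (g x)) cell_kernelC.
- by apply: emeasurable_funM => //; exact: measurable_cell_kernel.
- by move=> x _; rewrite mule_ge0.
Qed.

(** The kernel of rank [k] is constant on the cells of rank [j], and averaging is
    symmetric. *)
Lemma cond_exp_tower j k h x : (j <= k)%N ->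
  measurable_fun setT h -> (forall y, 0 <= h y) ->
  cond_exp k (cond_exp j h) x = cond_exp k h x.
Proof.
move=> jk mh h0; rewrite {1}/cond_exp cond_exp_adj//; last exact: measurable_cell_kernel.
apply: eq_integral => y _; congr (_ * _).
transitivity (cond_exp j (fun z => cell_kernel k x z * cst 1 z) y).
  by apply: eq_cond_exp => z _; rewrite mule1.
rewrite cond_expM ?cond_exp_cst ?mule1// => z yz.
rewrite cell_kernelC [RHS]cell_kernelC; apply: cell_kernel_cell; apply/esym.
exact: cell_le yz.
Qed.

(** A cell has half the measure of its parent. *)
Lemma cond_expS_ge k h x : measurable_fun setT h -> (forall y, 0 <= h y) ->
  cond_exp k h x <= 2%:E * cond_exp k.+1 h x.
Proof.
move=> mh h0; rewrite /cond_exp -ge0_integralZl//; last 2 first.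
- by apply: emeasurable_funM => //; exact: measurable_cell_kernel.
- by move=> y _; rewrite mule_ge0.
apply: le_integralT => y; first by rewrite mule_ge0.
rewrite muleA; apply: lee_wpmul2r => //.
rewrite /cell_kernel; case: eqP => [xy|_].
  rewrite (cell_nested hcell xy) eqxx (lamS hcell) -EFinM lee_fin.
  by rewrite invfM mulrA mulfV// mul1r.
by case: ifP; rewrite ?mule0// -EFinM lee_fin mulr_ge0 ?invr_ge0// ltW// (lam_gt0 hcell).
Qed.

Lemma cond_exp_poweR k r h x : (1 <= r)%R ->
  measurable_fun setT h -> (forall y, 0 <= h y) ->
  cond_exp k h x `^ r <= cond_exp k (fun y => h y `^ r) x.
Proof.
move=> r1 mh h0; rewrite /cond_exp.
rewrite (eq_integral (fun y => h y * cell_kernel k x y)); last first.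
  by move=> y _; rewrite muleC.
rewrite [leRHS](eq_integral (fun y => h y `^ r * cell_kernel k x y)); last first.
  by move=> y _; rewrite muleC.
apply: jensen_poweR => //; first exact: measurable_cell_kernel.
have := @cond_exp_cst k 1 x lee01; rewrite /cond_exp /=.
by under eq_integral do rewrite mule1; move=> ->.
Qed.

End dyadic_filtrations.

(** * The dyadic maximal function *)

Section coarsest_rank.

Fixpoint coarsest (b : nat -> bool) (m : nat) : option nat :=
  if m is m'.+1 then if b m' then Some m' else coarsest b m' else None.

Lemma coarsestP (b : nat -> bool) m :
  match coarsest b m with
  | Some k => [/\ (k < m)%N, b k & forall j, (k < j < m)%N -> ~~ b j]
  | None => forall j, (j < m)%N -> ~~ b j
  end.
Proof.
elim: m => //= m IH; case: ifPn => bm.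
  by split => // j /andP[mj]; rewrite ltnS leqNgt mj.
case: (coarsest b m) IH => [k [km bk kP]|kP].
  split => //; first exact: ltnW.
  move=> j /andP[kj]; rewrite ltnS leq_eqVlt => /predU1P[->//|jm].
  by apply: kP; rewrite kj.
by move=> j; rewrite ltnS leq_eqVlt => /predU1P[->//|]; exact: kP.
Qed.

(** Whether the coarsest rank is [k] is decided by the ranks from [k] on; when
    [b j] depends on cells of rank [j], this makes the event [coarsest b m = k]
    a union of cells of rank [k]. *)
Lemma eq_coarsest (b b' : nat -> bool) m k :
  (forall j, (k <= j < m)%N -> b j = b' j) ->
  (coarsest b m == Some k) = (coarsest b' m == Some k).
Proof.
elim: m => //= m IH bb'.
have H : (coarsest b m == Some k) = (coarsest b' m == Some k).
  by apply: IH => j /andP[kj jm]; apply: bb'; rewrite kj ltnW.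
have [km|mk] := leqP k m.
    have -> : b m = b' m by apply: bb'; rewrite km ltnSn.
    by case: (b' m).
have no b0 : coarsest b0 m.+1 != Some k.
  have /= := coarsestP b0 m.+1; case: (if _ then _ else _) => // i [im _ _].
  by apply/eqP => -[ik]; rewrite ik ltnNge mk in im.
by rewrite (negbTE (no b)) (negbTE (no b')).
Qed.

(** Stopping nowhere means averaging at the finest rank. *)
Definition stop_rank b m := odflt 0%N (coarsest b m).

Lemma eq_stop_rank (b b' : nat -> bool) m k :
  (forall j, (k <= j < m)%N -> b j = b' j) ->
  (stop_rank b m == k) = (stop_rank b' m == k).
Proof.
case: k => [|k] bb'.
  suff -> : stop_rank b m = stop_rank b' m by [].
  rewrite /stop_rank; congr odflt; elim: m bb' => //= m IH bb'.
  have -> : b m = b' m by apply: bb'; rewrite ltnSn.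
  case: (b' m) => //.
  by apply: IH => j jm; apply: bb'; exact: ltnW.
rewrite /stop_rank; have := eq_coarsest bb'.
by case: (coarsest b m) => [?|]; case: (coarsest b' m) => [?|].
Qed.

Lemma measurable_coarsest d (T : measurableType d) (b : T -> nat -> bool) m o :
  (forall j, measurable_fun setT (b ^~ j)) ->
  measurable_fun setT (fun x => coarsest (b x) m == o).
Proof.
move=> mb; elim: m => [|m IH] /=; first exact: measurable_cst.
rewrite (_ : (fun _ => _) = fun x =>
  if b x m then Some m == o else coarsest (b x) m == o).
  by apply: measurable_fun_ifT.
by apply/funext => x; case: ifP.
Qed.

End coarsest_rank.

Section maximal_function.
Context (R : realType) d (T : measurableType d)
  (mu : {sigma_finite_measure set T -> \bar R}).
Local Open Scope ereal_scope.
Variables (cell : nat -> T -> R) (lam : nat -> R).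
Hypothesis hcell : dyadic_filtration mu cell lam.
Local Notation E := (cond_exp mu cell lam).

Definition max_cond_exp (k m : nat) (h : T -> \bar R) (x : T) : \bar R :=
  \big[maxe/0]_(k <= j < m) E j h x.

Lemma max_cond_exp_le k m h x z : 0 <= z ->
  (forall j, (k <= j < m)%N -> E j h x <= z) -> max_cond_exp k m h x <= z.
Proof.
move=> z0 H; rewrite /max_cond_exp big_nat.
by apply: (big_ind (fun y => y <= z)) => // a b az bz; rewrite ge_max az.
Qed.

Lemma max_cond_exp_ge k m h x j : (k <= j < m)%N ->
  E j h x <= max_cond_exp k m h x.
Proof.
move=> kjm; have : j \in index_iota k m by rewrite mem_index_iota.
rewrite /max_cond_exp; elim: (index_iota k m) => // i s IH.
rewrite inE big_cons le_max => /predU1P[->|/IH ->]; first by rewrite lexx.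
by rewrite orbT.
Qed.

Lemma max_cond_exp_ge0 k m h x : 0 <= max_cond_exp k m h x.
Proof.
rewrite /max_cond_exp; elim: (index_iota k m) => [|i s IH].
  by rewrite big_nil.
by rewrite big_cons le_max IH orbT.
Qed.

Lemma max_cond_exp_sub k k' m h x : (k' <= k)%N ->
  max_cond_exp k m h x <= max_cond_exp k' m h x.
Proof.
move=> kk'; apply: max_cond_exp_le => [|j /andP[kj jm]].
  exact: max_cond_exp_ge0.
by apply: max_cond_exp_ge; rewrite jm (leq_trans kk').
Qed.

Lemma max_cond_exp_cell k m h x y : cell k x = cell k y ->
  max_cond_exp k m h x = max_cond_exp k m h y.
Proof.
move=> xy; apply: eq_big_nat => j /andP[kj _]; apply: cond_exp_cell.
exact: (cell_le hcell kj).
Qed.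

Lemma measurable_max_cond_exp_param d' (U : measurableType d') k m
    (f : U * T -> \bar R) :
  measurable_fun setT f -> (forall z, 0 <= f z) ->
  measurable_fun setT
    (fun z : U * T => max_cond_exp k m (fun y => f (z.1, y)) z.2).
Proof.
move=> mf f0; rewrite /max_cond_exp; elim: (index_iota k m) => [|i s IH].
  by under eq_fun do rewrite big_nil; exact: measurable_cst.
under eq_fun do rewrite big_cons.
by apply: measurable_maxe => //; exact: measurable_cond_exp_param.
Qed.

Lemma measurable_max_cond_exp k m h :
  measurable_fun setT h -> (forall y, 0 <= h y) ->
  measurable_fun setT (max_cond_exp k m h).
Proof.
move=> mh h0.
have := @measurable_max_cond_exp_param _ unit k m (fun z => h z.2)
  (measurableT_comp mh measurable_snd) (fun z => h0 z.2).
by move/(measurable_section2 tt).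
Qed.

Lemma measurable_gt (g : T -> \bar R) (c : \bar R) : measurable_fun setT g ->
  measurable_fun setT (fun x => c < g x).
Proof. by move=> mg; exact: measurable_fun_lte. Qed.

Lemma measurable_set_gt (g : T -> \bar R) (c : \bar R) : measurable_fun setT g ->
  measurable [set x | c < g x].
Proof.
by move=> mg; rewrite -[X in measurable X]setTI; exact: emeasurable_fun_o_infty.
Qed.

(** The points where the maximal function exceeds [l] are sorted by the coarsest
    rank at which this happens; at each rank the average of [h] is at least [l]. *)
Lemma max_cond_exp_weak (l : R) m h : (0 < l)%R ->
  measurable_fun setT h -> (forall y, 0 <= h y) ->
  l%:E * mu [set x | l%:E < max_cond_exp 0 m h x] <= \int[mu]_x h x.
Proof.
move=> l0 mh h0; pose b x j := l%:E < E j h x.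
have mb j : measurable_fun setT (b ^~ j).
  by apply: measurable_gt; exact: measurable_cond_exp.
pose s k x : \bar R := if coarsest (b x) m == Some k then 1 else 0.
have s0 k x : 0 <= s k x by rewrite /s; case: ifP.
have ms k : measurable_fun setT (s k).
  by apply: measurable_fun_ifT => //; exact: measurable_coarsest.
have sE k x : E k (s k) x = s k x.
  transitivity (E k (cst (s k x)) x); last exact: (cond_exp_cst hcell).
  apply: eq_cond_exp => y xy; rewrite /s /=.
  have -> // : (coarsest (b y) m == Some k) = (coarsest (b x) m == Some k).
  apply: eq_coarsest => j /andP[kj _]; rewrite /b.
  by congr (_ < _); apply: cond_exp_cell; apply/esym; exact: (cell_le hcell kj).
have sumE (F : nat -> \bar R) x : \sum_(k < m) s k x * F k =
    if coarsest (b x) m is Some k then F k else 0.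
  rewrite /s; have := coarsestP (b x) m; case: (coarsest _ _) => [k [km _ _]|_].
    rewrite (bigD1 (Ordinal km))//= eqxx mul1e big1 ?adde0// => i /eqP ik.
    by case: eqP => [[ki]|_]; [exfalso; apply: ik; exact: val_inj|rewrite mul0e].
  by rewrite big1// => i _; rewrite mul0e.
have mE := measurable_set_gt l%:E (measurable_max_cond_exp 0 m mh h0).
set A := [set x | _] in mE *.
apply: (@le_trans _ _ (\int[mu]_x \sum_(k < m) s k x * E k h x)).
  rewrite (_ : l%:E * mu A = \int[mu]_x (l%:E * (\1_A x)%:E)); last first.
    rewrite ge0_integralZl// ?integral_indic ?setIT// ?lee_fin ?ltW//.
    by apply/measurable_EFinP; exact: measurable_indic.
  apply: le_integralT => x; first by rewrite mule_ge0// lee_fin ltW.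
  rewrite (sumE (fun k => E k h x)) indicE; have [|_] := boolP (x \in A); last first.
    by rewrite mule0; case: (coarsest _ _) => // k; exact: cond_exp_ge0.
  rewrite inE mule1 /A/= => lx; have := coarsestP (b x) m.
  case: (coarsest _ _) => [k [_ /ltW//]|H]; exfalso.
  move: lx; rewrite ltNge => /negP; apply; apply: max_cond_exp_le.
    by rewrite lee_fin ltW.
  by move=> j /= jm; have := H _ jm; rewrite /b -leNgt.
rewrite ge0_integral_sum//; last 2 first.
- by move=> k; apply: emeasurable_funM => //; exact: measurable_cond_exp.
- by move=> k x _; rewrite mule_ge0//; exact: cond_exp_ge0.
rewrite (eq_bigr (fun k : 'I_m => \int[mu]_x (s k x * h x))); last first.
  move=> k _; rewrite (cond_exp_adj hcell)//.
  by apply: eq_integral => x _; rewrite sE.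
rewrite -ge0_integral_sum//; last 2 first.
- by move=> k; exact: emeasurable_funM.
- by move=> k x _; rewrite mule_ge0.
apply: le_integralT => x; first by apply: sume_ge0 => k _; rewrite mule_ge0.
by rewrite (sumE (fun=> h x)); case: (coarsest _ _).
Qed.

(** The part of [F] below [l] contributes at most [l] to the maximal function. *)
Lemma max_cond_exp_weak_top (l : R) m F : (0 < l)%R ->
  measurable_fun setT F -> (forall y, 0 <= F y) ->
  l%:E * mu [set x | (2 * l)%:E < max_cond_exp 0 m F x] <=
  \int[mu]_x (F x * ((l%:E < F x)%E)%:R%:E).
Proof.
move=> l0 mF F0; pose G x := F x * ((l%:E < F x)%E)%:R%:E.
have mG : measurable_fun setT G.
  by apply: emeasurable_funM => //; exact: measurable_level.
have G0 x : 0 <= G x by rewrite mule_ge0// lee_fin.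
apply: le_trans (max_cond_exp_weak m l0 mG G0).
rewrite lee_pmul2l//; apply: le_measure; rewrite ?inE.
- by apply: measurable_set_gt; exact: measurable_max_cond_exp.
- by apply: measurable_set_gt; exact: measurable_max_cond_exp.
move=> x /= lx.
have FG y : F y <= l%:E + G y.
  rewrite /G; case: (ltP l%:E (F y)) => [_|Fl]; last by rewrite mule0 adde0.
  by rewrite mule1 leeDr// lee_fin ltW.
have : max_cond_exp 0 m F x <= l%:E + max_cond_exp 0 m G x.
  apply: max_cond_exp_le => [|j jm].
    by rewrite adde_ge0 ?max_cond_exp_ge0// lee_fin ltW.
  apply: (@le_trans _ _ (E j (fun y => l%:E + G y) x)).
    exact: (le_cond_exp hcell).
  rewrite (cond_expD hcell)//; last by move=> _; rewrite lee_fin ltW.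
  by rewrite (cond_exp_cst hcell) ?lee_fin ?(ltW l0)// leeD2l// max_cond_exp_ge.
move/(lt_le_trans lx); rewrite mulr_natl mulr2n EFinD lteD2lE//.
Qed.

End maximal_function.

Lemma doob (R : realType) (e : R) : (1 < e)%R -> exists C : R, (0 <= C)%R /\
  forall d (T : measurableType d) (mu : {sigma_finite_measure set T -> \bar R})
    cell lam, dyadic_filtration mu cell lam -> forall m (F : T -> \bar R),
  measurable_fun setT F -> (forall x, (0 <= F x)%E) ->
  (\int[mu]_x (max_cond_exp mu cell lam 0 m F x `^ e) <=
   C%:E * \int[mu]_x (F x `^ e))%E.
Proof.
move=> e1; have [C [C0 H]] := strong_type_of_weak_type e1.
exists C; split => // d T mu cell lam hcell m F mF F0.
apply: H => //; first exact: (measurable_max_cond_exp hcell).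
  by move=> x; exact: max_cond_exp_ge0.
by move=> l l0; exact: (max_cond_exp_weak_top hcell).
Qed.

(** * Maximal functions of vector-valued functions *)

Section vector_valued_maximal.
Context (R : realType) d (U : measurableType d) (N : (U -> \bar R) -> \bar R)
  (hN : function_norm N) d' (T : measurableType d')
  (mu : {sigma_finite_measure set T -> \bar R})
  (cell : nat -> T -> R) (lam : nat -> R)
  (hcell : dyadic_filtration mu cell lam).
Local Open Scope ereal_scope.
Local Notation E := (cond_exp mu cell lam).
Local Notation M := (max_cond_exp mu cell lam).

Lemma fnorm0 : N (fun=> 0) = 0.
Proof.
apply/eqP; rewrite eq_le (fnorm_ge0 hN) andbT.
have mc : measurable_fun setT (fun _ : U => 0 : \bar R) by exact: measurable_cst.
have := fnormZ_le hN (lexx 0%R) mc (fun=> lexx 0).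
rewrite [X in _ <= X -> _]mul0e; apply: le_trans.
by apply: (fnorm_le hN) => // u; rewrite mul0e.
Qed.

Lemma fnorm_cond_exp k (f : U * T -> \bar R) x :
  measurable_fun setT f -> (forall z, 0 <= f z) ->
  N (fun u => E k (fun y => f (u, y)) x) <= E k (fun y => N (fun u => f (u, y))) x.
Proof.
move=> mf f0; apply: le_trans.
  apply: (@fnorm_integral _ _ _ _ hN _ _ mu
    (fun z => cell_kernel cell lam k x z.2 * f z)).
    apply: emeasurable_funM => //.
    apply: (measurableT_comp _ measurable_snd).
    exact: (measurable_cell_kernel hcell).
  by move=> z; rewrite mule_ge0// (cell_kernel_ge0 hcell).
apply: le_integralT => y; first exact: (fnorm_ge0 hN).
rewrite /cell_kernel; case: ifP => _ /=.
  apply: (fnormZ_le hN) => //; first by rewrite invr_ge0 ltW// (lam_gt0 hcell).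
  exact: measurable_section1.
by apply: (fnormZ_le hN) => //; exact: measurable_section1.
Qed.

Lemma chebyshev_poweR (e l : R) (W : T -> \bar R) : (0 < e)%R -> (0 < l)%R ->
  measurable_fun setT W -> (forall x, 0 <= W x) ->
  (l `^ e)%:E * mu [set x | l%:E < W x] <= \int[mu]_x (W x `^ e).
Proof.
move=> e0 l0 mW W0; rewrite -integral_level// -ge0_integralZl//; last 2 first.
- exact: measurable_level.
- by rewrite lee_fin powR_ge0.
apply: le_integralT => x; first by rewrite mule_ge0 ?lee_fin ?powR_ge0.
case: ltP => [lW|_]; last by rewrite mule0 poweR_ge0.
by rewrite mule1 -poweR_EFin; apply: ge0_le_poweR; rewrite ?lee_fin ltW.
Qed.

Section good_lambda.
Variables (f : U * T -> \bar R) (m : nat).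
Hypotheses (mf : measurable_fun setT f) (f0 : forall z, 0 <= f z)
  (m0 : (0 < m)%N).

Let F y := N (fun u => f (u, y)).
Let tail k x := N (fun u => M k m (fun y => f (u, y)) x).
Let Z := tail 0.

Let F0 y : 0 <= F y. Proof. exact: (fnorm_ge0 hN). Qed.
Let mF : measurable_fun setT F. Proof. exact: (fnorm_measurable hN). Qed.

Lemma measurable_fnorm_max k m' (g : U * T -> \bar R) :
  measurable_fun setT g -> (forall z, 0 <= g z) ->
  measurable_fun setT (fun x => N (fun u => M k m' (fun y => g (u, y)) x)).
Proof.
move=> mg g0; apply: (@fnorm_measurable _ _ _ _ hN _ _
  (fun z : U * T => M k m' (fun y => g (z.1, y)) z.2)).
  exact: (measurable_max_cond_exp_param hcell).
by move=> z; exact: max_cond_exp_ge0.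
Qed.

Variables (l eps : R).
Hypotheses (l0 : (0 < l)%R) (eps0 : (0 < eps)%R).

(* [f] is stopped at the coarsest rank where the average of [F] exceeds
   [eps * l]; if this is already the coarsest rank of all, it is replaced by 0,
   since the average over a parent cell then gives no information. *)
Let b y j := (eps * l)%:E < E j F y.
Let tau y := stop_rank (b y) m.
Let top y := coarsest (b y) m == Some m.-1.
Let ft (z : U * T) : \bar R :=
  if top z.2 then 0 else E (tau z.2) (fun y => f (z.1, y)) z.2.
Let fh (z : U * T) : \bar R := if l%:E < Z z.2 then ft z else 0.

Let mb j : measurable_fun setT (b ^~ j).
Proof. by apply: measurable_gt; exact: (measurable_cond_exp hcell). Qed.

Let mtau j : measurable_fun setT (fun y => tau y == j).
Proof.
rewrite (_ : (fun _ => _) = fun y => (coarsest (b y) m == Some j) ||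
    ((j == 0%N) && (coarsest (b y) m == None))).
  apply: measurable_or; first exact: measurable_coarsest.
  by apply: measurable_and; [exact: measurable_cst|exact: measurable_coarsest].
apply/funext => y; rewrite /tau /stop_rank; case: (coarsest _ _) => [i|] /=.
  by rewrite andbF orbF.
by rewrite andbT eq_sym.
Qed.

Let tau_le y : (tau y < m.+1)%N.
Proof.
rewrite /tau /stop_rank; have := coarsestP (b y) m.
by case: (coarsest _ _) => //= k [km _ _]; exact: ltnW.
Qed.

Let ft0 z : 0 <= ft z.
Proof. by rewrite /ft; case: ifP => // _; exact: (cond_exp_ge0 hcell). Qed.

Let mft : measurable_fun setT ft.
Proof.
rewrite /ft; apply: measurable_fun_ifT => //.
  have mt : measurable_fun setT top by exact: measurable_coarsest.
  exact: (measurableT_comp mt measurable_snd).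
rewrite (_ : (fun _ => _) = fun z : U * T => \sum_(j < m.+1)
    if tau z.2 == j then E j (fun y => f (z.1, y)) z.2 else 0).
  apply: emeasurable_sum => j; apply: measurable_fun_ifT => //.
    exact: (measurableT_comp (mtau j) measurable_snd).
  exact: (measurable_cond_exp_param hcell).
apply/funext => z; rewrite (bigD1 (Ordinal (tau_le z.2)))//= eqxx big1 ?adde0//.
move=> i /eqP ij; case: eqP => // tj.
by exfalso; apply: ij; exact: val_inj.
Qed.

Let mZ : measurable_fun setT Z. Proof. exact: measurable_fnorm_max. Qed.

Let fh0 z : 0 <= fh z. Proof. by rewrite /fh; case: ifP. Qed.

Let mfh : measurable_fun setT fh.
Proof.
apply: measurable_fun_ifT => //.
exact: (measurableT_comp (measurable_gt l%:E mZ) measurable_snd).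
Qed.

Let eps_l : (0 < eps * l)%R. Proof. exact: mulr_gt0. Qed.

(** The parent of the cell where [f] is stopped has an average of [F] of at most
    [eps * l], so the cell itself has an average of at most twice as much. *)
Let fh_bound y :
  N (fun u => fh (u, y)) <= (2 * eps * l)%:E * ((l%:E < Z y)%E)%:R%:E.
Proof.
have e0 : 0 <= (2 * eps * l)%:E :> \bar R by rewrite lee_fin -mulrA mulr_ge0 ?ltW.
rewrite /fh /=; case: (l%:E < Z y); last by rewrite fnorm0 mule0.
rewrite mule1 /ft /=; case: (boolP (top y)) => [_|]; first by rewrite fnorm0.
rewrite /top /tau /stop_rank => nt; apply: (le_trans (fnorm_cond_exp _ _ mf f0)).
have := coarsestP (b y) m; case: (coarsest _ _) nt => [k|] /= nt.
  move=> [km _ kP]; have km1 : (k.+1 < m)%N.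
    rewrite ltn_neqAle km andbT; apply: contra nt => /eqP <-; exact: eqxx.
  apply: (le_trans (cond_expS_ge hcell k y mF F0)).
  rewrite -mulrA EFinM; apply: lee_wpmul2l => //.
  by have := kP k.+1; rewrite /b -leNgt ltnSn km1; exact.
move=> /(_ _ m0); rewrite /b -leNgt => /le_trans; apply.
by rewrite lee_fin -mulrA ler_peMl ?ler1n// ltW.
Qed.

Let max_small x : M 0 m F x <= (eps * l)%:E ->
  forall j, (j < m)%N -> E j F x <= (eps * l)%:E.
Proof. by move=> H j jm; apply: le_trans H; exact: max_cond_exp_ge. Qed.

(** On the cell of rank [j] of [x] the stopping rank is at most [j], because all
    the coarser averages of [F] are small; so stopping is absorbed by averaging at
    rank [j]. *)
Let ft_cond_exp u x j : M 0 m F x <= (eps * l)%:E -> (j < m)%N ->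
  E j (fun y => ft (u, y)) x = E j (fun y => f (u, y)) x.
Proof.
move=> /max_small Fx jm; pose s i y : \bar R := if tau y == i then 1 else 0.
have s0 i y : 0 <= s i y by rewrite /s; case: ifP.
have ms i : measurable_fun setT (s i) by exact: measurable_fun_ifT.
pose g y := f (u, y).
have mg : measurable_fun setT g by exact: measurable_section2.
have g0 y : 0 <= g y by exact: f0.
have small y i : cell j x = cell j y -> (j <= i < m)%N -> b y i = false.
  move=> xy /andP[ji im]; apply/negbTE; rewrite -leNgt.
  have -> : E i F y = E i F x.
    by apply: cond_exp_cell; apply/esym; exact: (cell_le hcell ji xy).
  exact: Fx.
have tau_small y : cell j x = cell j y -> (tau y < j.+1)%N.
  move=> xy; rewrite /tau /stop_rank; have := coarsestP (b y) m.
  case: (coarsest _ _) => //= k [km bk _]; rewrite ltnS leqNgt; apply/negP => jk.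
  by move: bk; rewrite small// ltnW.
have sum_s (h : nat -> \bar R) y : cell j x = cell j y ->
    \sum_(i < j.+1) s i y * h i = h (tau y).
  move=> /tau_small ty; rewrite (bigD1 (Ordinal ty))//= /s eqxx mul1e.
  rewrite big1 ?adde0// => i /eqP iy; case: eqP => [yi|_]; last by rewrite mul0e.
  by exfalso; apply: iy; exact: val_inj.
transitivity (E j (fun y => \sum_(i < j.+1) s i y * E i g y) x).
  apply: eq_cond_exp => y xy; rewrite (sum_s (fun i => E i g y))// /ft /=.
  case: ifP => // /eqP ty; have := coarsestP (b y) m; rewrite ty => -[_ + _].
  by rewrite small// -[X in (_ && X)]ltnS prednK// ltnSn andbT -ltnS prednK.
rewrite (@cond_exp_sum _ _ _ _ _ _ hcell j j.+1 (fun i y => s i y * E i g y))//;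
  last 2 first.
- by move=> i; apply: emeasurable_funM => //; exact: (measurable_cond_exp hcell).
- by move=> i y; rewrite mule_ge0//; exact: (cond_exp_ge0 hcell).
transitivity (\sum_(i < j.+1) E j (fun y => s i y * g y) x).
  apply: eq_bigr => i _; rewrite -(@cond_exp_tower _ _ _ _ _ _ hcell i j (fun y => s i y * g y) x)//.
  - apply: eq_cond_exp => y _; rewrite (cond_expM hcell)// => y' yy'.
    rewrite /s; congr (if _ then _ else _); apply: eq_stop_rank => i' /andP[ii' _].
    congr (_ < _); apply: cond_exp_cell; apply/esym.
    exact: (cell_le hcell ii').
  - by rewrite -ltnS.
  - exact: emeasurable_funM.
  - by move=> y; rewrite mule_ge0.
rewrite -(@cond_exp_sum _ _ _ _ _ _ hcell j j.+1 (fun i y => s i y * g y))//.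
- by apply: eq_cond_exp => y xy; rewrite (sum_s (fun=> g y)).
- by move=> i; exact: emeasurable_funM.
- by move=> i y; rewrite mule_ge0.
Qed.

Let good_lambda_incl x : (2 * l)%:E < Z x -> M 0 m F x <= (eps * l)%:E ->
  l%:E < N (fun u => M 0 m (fun y => fh (u, y)) x).
Proof.
move=> lZ Fx; have := coarsestP (fun j => l%:E < tail j x) m.
have lZ1 : l%:E < Z x.
  by apply: le_lt_trans lZ; rewrite lee_fin ler_peMl ?ler1n// ltW.
case: (coarsest _ _) => [k [km lk kP]|/(_ _ m0)]; last by rewrite lZ1.
have tk : tail k.+1 x <= l%:E.
  have [km1|km1] := ltnP k.+1 m; first by have := kP k.+1; rewrite -leNgt ltnSn km1; exact.
  rewrite /tail /max_cond_exp; under [X in N X]funext do rewrite big_geq//.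
  by rewrite fnorm0 lee_fin ltW.
have split : Z x <= N (fun u => M 0 k.+1 (fun y => f (u, y)) x) + tail k.+1 x.
  apply: le_trans; last apply: (fnorm_max hN).
  - apply: (fnorm_le hN) => u; first exact: max_cond_exp_ge0.
    apply: max_cond_exp_le => [|j /= jm]; first by rewrite le_max max_cond_exp_ge0.
    rewrite le_max; have [jk|kj] := ltnP j k.+1.
      by rewrite max_cond_exp_ge.
    by rewrite [X in _ || X]max_cond_exp_ge ?kj// orbT.
  - exact: (measurable_section1 x (measurable_max_cond_exp_param hcell 0 k.+1 mf f0)).
  - exact: (measurable_section1 x (measurable_max_cond_exp_param hcell k.+1 m mf f0)).
  - by move=> u; exact: max_cond_exp_ge0.
  - by move=> u; exact: max_cond_exp_ge0.
have : l%:E < N (fun u => M 0 k.+1 (fun y => f (u, y)) x).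
  rewrite ltNge; apply/negP => H; have := le_trans split (leeD H tk).
  by rewrite leNgt -EFinD -mulr2n -mulr_natl lZ.
move=> /lt_le_trans; apply; apply: (fnorm_le hN) => u.
  exact: max_cond_exp_ge0.
apply: max_cond_exp_le => [|j /= jk]; first exact: max_cond_exp_ge0.
have jm : (j < m)%N by exact: leq_ltn_trans km.
rewrite -(ft_cond_exp u Fx jm).
rewrite (@eq_cond_exp _ _ _ _ _ _ j (fun y => ft (u, y)) (fun y => fh (u, y)));
  first by apply: max_cond_exp_ge; rewrite jm.
move=> y xy; rewrite /fh /=.
suff -> : l%:E < Z y by [].
have xyk : cell k x = cell k y by exact: (cell_le hcell (jk : (j <= k)%N) xy).
apply: (@lt_le_trans _ _ (tail k y)).
  rewrite (_ : tail k y = tail k x)//; rewrite /tail; congr N; apply/funext => u'.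
  exact/esym/(max_cond_exp_cell hcell).
apply: (fnorm_le hN) => u'; first exact: max_cond_exp_ge0.
exact: max_cond_exp_sub.
Qed.

(** Past the first rank where the truncated maximal function exceeds [l], it can
    only double by the contribution of finer cells. Where the scalar maximal
    function of [F] is at most [eps * l], this contribution is unchanged by
    stopping [f]; the stopped function is bounded by [2 * eps * l], so that the
    assumed inequality at the exponent [e] controls it. *)
Lemma good_lambda_maximal (e B : R) : (0 < e)%R -> (0 <= B)%R ->
  (forall g : U * T -> \bar R, measurable_fun setT g -> (forall z, 0 <= g z) ->
    \int[mu]_x (N (fun u => M 0 m (fun y => g (u, y)) x) `^ e) <=
    B%:E * \int[mu]_x (N (fun u => g (u, x)) `^ e)) ->
  mu [set x | (2 * l)%:E < Z x] <=
  (B * (2 * eps) `^ e)%:E * mu [set x | l%:E < Z x] +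
  mu [set x | l%:E < eps^-1%:E * M 0 m F x].
Proof.
move=> e0 B0 base; pose W x := N (fun u => M 0 m (fun y => fh (u, y)) x).
have mW : measurable_fun setT W by exact: measurable_fnorm_max.
have W0 x : 0 <= W x by exact: (fnorm_ge0 hN).
have mMF : measurable_fun setT (M 0 m F) by exact: (measurable_max_cond_exp hcell).
have mH : measurable_fun setT (fun x => eps^-1%:E * M 0 m F x).
  exact: measurable_funeM.
have mWl := measurable_set_gt l%:E mW.
have mHl := measurable_set_gt l%:E mH.
apply: (@le_trans _ _ (mu ([set x | l%:E < W x] `|`
    [set x | l%:E < eps^-1%:E * M 0 m F x]))).
  apply: le_measure; rewrite ?inE.
  - exact: measurable_set_gt.
  - exact: measurableU.
  move=> x /= lZ; have [Fx|Fx] := leP (M 0 m F x) (eps * l)%:E.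
    by left; exact: good_lambda_incl.
  by right; rewrite lte_pdivlMl// -EFinM.
apply: le_trans (measureU2 _ mWl mHl) _; apply: leeD => //.
have := chebyshev_poweR e0 l0 mW W0.
have le0 : (0 < l `^ e)%R by rewrite powR_gt0.
rewrite -lee_pdivlMl// => /le_trans; apply.
rewrite lee_pdivrMl//; apply: (le_trans (base fh mfh fh0)).
rewrite [leRHS]muleA.
have -> : (l `^ e)%:E * (B * (2 * eps) `^ e)%:E = B%:E * ((2 * eps * l) `^ e)%:E :> \bar R.
  rewrite -!EFinM (@powRM _ (2 * eps)%R l) ?mulr_ge0 ?ltW//; congr EFin; ring.
rewrite -muleA; apply: lee_wpmul2l; first by rewrite lee_fin.
rewrite -integral_level// -ge0_integralZl//; last 2 first.
- exact: measurable_level.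
- by rewrite lee_fin powR_ge0.
apply: le_integralT => x; first exact: poweR_ge0.
have := fh_bound x => /(ge0_le_poweR (ltW e0) (fnorm_ge0 hN _)) /le_trans; apply.
have c0 : (0 <= 2 * eps * l)%R by rewrite -mulrA mulr_ge0// ltW.
rewrite poweRM ?lee_fin//; apply: ler_wpM2l; first exact: powR_ge0.
by case: (l%:E < Z x); rewrite ?powR1// powR0// gt_eqF.
Qed.

End good_lambda.
End vector_valued_maximal.

Section maximal_bounded.
Context (R : realType).
Local Open Scope ereal_scope.

(** The Fefferman-Stein inequality for functions with values in the space normed
    by [N], uniformly over filtrations and numbers of ranks. *)
Definition maximal_bounded d (U : measurableType d) (N : (U -> \bar R) -> \bar R)
    (e : R) : Prop :=
  exists C : R, (0 < C)%R /\
  forall d' (T : measurableType d') (mu : {sigma_finite_measure set T -> \bar R})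
    cell lam, dyadic_filtration mu cell lam -> forall m (f : U * T -> \bar R),
  measurable_fun setT f -> (forall z, 0 <= f z) ->
  \int[mu]_x (N (fun u => max_cond_exp mu cell lam 0 m (fun y => f (u, y)) x) `^ e)
  <= C%:E * \int[mu]_x (N (fun u => f (u, x)) `^ e).

(** This bound deteriorates with the number of ranks; it provides the finiteness
    without which the good-lambda inequality cannot be integrated. *)
Lemma fnorm_max_cond_exp_le d (U : measurableType d) (N : (U -> \bar R) -> \bar R)
    (hN : function_norm N) d' (T : measurableType d')
    (mu : {sigma_finite_measure set T -> \bar R}) cell lam
    (hcell : dyadic_filtration mu cell lam) (f : U * T -> \bar R) m x :
  measurable_fun setT f -> (forall z, 0 <= f z) ->
  N (fun u => max_cond_exp mu cell lam 0 m (fun y => f (u, y)) x) <=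
  m%:R%:E * max_cond_exp mu cell lam 0 m (fun y => N (fun u => f (u, y))) x.
Proof.
move=> mf f0; pose F y := N (fun u => f (u, y)).
rewrite -/F; set Ms := max_cond_exp _ _ _ _ _ F x.
have Ms0 : 0 <= Ms by exact: max_cond_exp_ge0.
suff: forall m', (m' <= m)%N ->
    N (fun u => max_cond_exp mu cell lam 0 m' (fun y => f (u, y)) x) <= m'%:R%:E * Ms.
  exact.
elim=> [_|m' IH m'm].
  rewrite /max_cond_exp; under [X in N X]funext do rewrite big_geq//.
  by rewrite (fnorm0 hN) mul0e.
apply: le_trans.
  apply: (@fnorm_le _ _ _ _ hN _ (fun u =>
    maxe (max_cond_exp mu cell lam 0 m' (fun y => f (u, y)) x)
         (cond_exp mu cell lam m' (fun y => f (u, y)) x))).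
    by move=> u; exact: max_cond_exp_ge0.
  move=> u; apply: max_cond_exp_le => [|j /=].
    by rewrite le_max max_cond_exp_ge0.
  rewrite ltnS leq_eqVlt le_max => /predU1P[->|jm]; first by rewrite lexx orbT.
  by rewrite max_cond_exp_ge.
apply: le_trans; first apply: (fnorm_max hN).
- exact: (measurable_section1 x (measurable_max_cond_exp_param hcell 0 m' mf f0)).
- exact: (measurable_section1 x (measurable_cond_exp_param hcell m' mf f0)).
- by move=> u; exact: max_cond_exp_ge0.
- by move=> u; exact: (cond_exp_ge0 hcell).
rewrite -natr1 EFinD ge0_muleDl// mul1e; apply: leeD; first exact: (IH (ltnW m'm)).
apply: (le_trans (fnorm_cond_exp hN hcell _ _ mf f0)).
by apply: max_cond_exp_ge.
Qed.

Lemma maximal_bounded_unit (e : R) : (1 < e)%R ->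
  maximal_bounded (fun f : unit -> \bar R => `|f tt|) e.
Proof.
move=> e1; have [C [C0 H]] := doob e1.
exists (C + 1)%R; split; first by rewrite ltr_wpDl.
move=> d' T mu cell lam hcell m f mf f0.
have mF : measurable_fun setT (fun y => f (tt, y)) by exact: measurable_section2.
rewrite (eq_integral (fun x => max_cond_exp mu cell lam 0 m (fun y => f (tt, y)) x `^ e)); last first.
  by move=> x _; rewrite gee0_abs// max_cond_exp_ge0.
rewrite [X in _ <= _ * X](eq_integral (fun x => f (tt, x) `^ e)); last first.
  by move=> x _; rewrite gee0_abs.
apply: le_trans (H _ _ _ _ _ hcell m _ mF _) _ => //.
apply: lee_wpmul2r; first by apply: integral_ge0 => x _; exact: poweR_ge0.
by rewrite lee_fin lerDl.
Qed.

(** The exponent of the outer integral is arbitrary once one exponent works. *)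
Lemma maximal_bounded_exponent d (U : measurableType d)
    (N : (U -> \bar R) -> \bar R) (e0 e : R) : function_norm N ->
  (1 < e0)%R -> (1 < e)%R -> maximal_bounded N e0 -> maximal_bounded N e.
Proof.
move=> hN e01 e1 [B [B0 base]].
have e0gt0 : (0 < e0)%R by exact: lt_trans e01.
have egt0 : (0 < e)%R by exact: lt_trans e1.
have [a [C1 [a0 [C10 gl]]]] := good_lambda egt0.
have [C2 [C20 db]] := doob e1.
pose eps := ((a / B) `^ e0^-1 / 2)%R.
have eps0 : (0 < eps)%R by rewrite divr_gt0 ?powR_gt0 ?divr_gt0.
have Beps : (B * (2 * eps) `^ e0 = a)%R.
  rewrite /eps mulrCA mulfV ?pnatr_eq0// mulr1 -powRrM mulVf ?gt_eqF//.
  by rewrite powRr1 ?divr_ge0 ?ltW// mulrCA mulfV ?mulr1// gt_eqF.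
pose C := (C1 * ((eps^-1) `^ e * C2))%R.
have Cge0 : (0 <= C)%R by rewrite !mulr_ge0 ?powR_ge0.
exists (C + 1)%R; split; first by rewrite ltr_wpDl.
move=> d' T mu cell lam hcell m f mf f0.
pose F y := N (fun u => f (u, y)).
have F0 y : 0 <= F y by exact: (fnorm_ge0 hN).
have mF : measurable_fun setT F by exact: (fnorm_measurable hN).
pose Fs := max_cond_exp mu cell lam 0 m F.
have Fs0 x : 0 <= Fs x by exact: max_cond_exp_ge0.
have mFs : measurable_fun setT Fs by exact: (measurable_max_cond_exp hcell).
pose Z x := N (fun u => max_cond_exp mu cell lam 0 m (fun y => f (u, y)) x).
rewrite (_ : \int[mu]_x (N (fun u => f (u, x)) `^ e) = \int[mu]_x (F x `^ e))//.
rewrite (_ : \int[mu]_x _ = \int[mu]_x (Z x `^ e))//.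
have Z0 x : 0 <= Z x by exact: (fnorm_ge0 hN).
have mZ : measurable_fun setT Z by exact: (measurable_fnorm_max hN hcell).
have IF0 : 0 <= \int[mu]_x (F x `^ e) by apply: integral_ge0 => x _; exact: poweR_ge0.
have [->|IFoo] := eqVneq (\int[mu]_x (F x `^ e)) +oo.
  by rewrite gt0_muley ?leey// lte_fin ltr_wpDl.
have IFfin : \int[mu]_x (F x `^ e) < +oo by rewrite ltey.
have DF := db _ _ _ _ _ hcell m _ mF F0.
have Zfin : \int[mu]_x (Z x `^ e) < +oo.
  apply: (@le_lt_trans _ _ (\int[mu]_x ((m%:R `^ e)%:E * Fs x `^ e))).
    apply: le_integralT => x; first exact: poweR_ge0.
    rewrite -poweR_EFin -poweRM ?lee_fin//; apply: ge0_le_poweR => //; first exact: ltW.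
    exact: (fnorm_max_cond_exp_le hN hcell m x mf f0).
  rewrite ge0_integralZl ?lee_fin ?powR_ge0//; last 2 first.
  - exact: measurable_fun_poweR.
  - by move=> x _; exact: poweR_ge0.
  apply: lte_mul_pinfty; rewrite ?lee_fin ?powR_ge0//.
  apply: (le_lt_trans DF); apply: lte_mul_pinfty => //.
have [m0|] := posnP m.
  rewrite (_ : \int[mu]_x (Z x `^ e) = 0).
    by rewrite mule_ge0// lee_fin addr_ge0.
  apply: integral0_eq => x _; rewrite /Z m0 /max_cond_exp.
  under [X in N X]funext do rewrite big_geq//.
  by rewrite (fnorm0 hN) poweR0r// gt_eqF.
move=> m0; have mH : measurable_fun setT (fun x => eps^-1%:E * Fs x).
  exact: measurable_funeM.
have H0 x : 0 <= eps^-1%:E * Fs x by rewrite mule_ge0// lee_fin invr_ge0 ltW.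
apply: (le_trans (gl _ _ mu Z (fun x => eps^-1%:E * Fs x) mZ mH Z0 H0 Zfin _)).
  move=> l l0; rewrite -Beps; apply: (good_lambda_maximal hN hcell) => //.
    exact: ltW.
  by move=> g mg g0; exact: base.
apply: (@le_trans _ _ (C%:E * \int[mu]_x (F x `^ e))); last first.
  by apply: lee_wpmul2r => //; rewrite lee_fin lerDl.
rewrite /C EFinM -muleA; apply: lee_wpmul2l; first by rewrite lee_fin.
rewrite (eq_integral (fun x => ((eps^-1) `^ e)%:E * Fs x `^ e)); last first.
  by move=> x _; rewrite poweRM// lee_fin invr_ge0 ltW.
rewrite ge0_integralZl ?lee_fin ?powR_ge0//; last 2 first.
- exact: measurable_fun_poweR.
- by move=> x _; exact: poweR_ge0.
by rewrite EFinM -muleA; apply: lee_wpmul2l => //; rewrite lee_fin powR_ge0.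
Qed.

(** With equal exponents the two outer integrals can be exchanged, so that the
    inner variable becomes a parameter. *)
Lemma maximal_bounded_iter d (U : measurableType d) (N : (U -> \bar R) -> \bar R)
    d1 (V : measurableType d1) (nu : {sigma_finite_measure set V -> \bar R})
    (r : R) : function_norm N -> (1 < r)%R ->
  maximal_bounded N r -> maximal_bounded (iter_norm N nu r) r.
Proof.
move=> hN r1 [C [C0 H]]; exists C; split => //.
move=> d' T mu cell lam hcell m f mf f0.
have r0 : (0 < r)%R by exact: lt_trans r1.
have N0 f' : 0 <= N f' by exact: (fnorm_ge0 hN).
have mfs (v : V) : measurable_fun setT (fun z : U * T => f (z.1, v, z.2)).
  apply: (measurableT_comp mf); apply: measurable_pair => //.
  exact: measurable_pair.
rewrite (eq_integral (fun x => \int[nu]_v (N (fun u =>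
    max_cond_exp mu cell lam 0 m (fun y => f (u, v, y)) x) `^ r))); last first.
  by move=> x _; rewrite /iter_norm ge0_Lnorm_poweR// gt_eqF.
rewrite [X in _ <= _ * X](eq_integral (fun x => \int[nu]_v (N (fun u =>
    f (u, v, x)) `^ r))); last first.
  by move=> x _; rewrite /iter_norm ge0_Lnorm_poweR// gt_eqF.
rewrite (fubini_tonelli (m1 := mu) (m2 := nu) (fun z : T * V => N (fun u =>
    max_cond_exp mu cell lam 0 m (fun y => f (u, z.2, y)) z.1) `^ r)); last 2 first.
- apply: measurable_fun_poweR.
  apply: (@fnorm_measurable _ _ _ _ hN _ _ (fun w : U * (T * V) =>
    max_cond_exp mu cell lam 0 m (fun y => f (w.1, w.2.2, y)) w.2.1)).
    have mg := measurable_max_cond_exp_param hcell 0 m mf f0.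
    apply: (@measurableT_comp _ _ _ _ _ _ _ setT
      (fun w : U * (T * V) => ((w.1, w.2.2), w.2.1)) mg).
    apply: measurable_pair; last first.
      exact: (measurableT_comp measurable_fst measurable_snd).
    apply: measurable_pair => //.
    exact: (measurableT_comp measurable_snd measurable_snd).
  by move=> w; exact: max_cond_exp_ge0.
- by move=> z; exact: poweR_ge0.
have mN : measurable_fun setT (fun z : T * V => N (fun u => f (u, z.2, z.1)) `^ r).
  apply: measurable_fun_poweR.
  apply: (@fnorm_measurable _ _ _ _ hN _ _ (fun w : U * (T * V) =>
    f (w.1, w.2.2, w.2.1))) => //.
  apply: (@measurableT_comp _ _ _ _ _ _ _ setT
    (fun w : U * (T * V) => ((w.1, w.2.2), w.2.1)) mf).
  apply: measurable_pair; last first.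
    exact: (measurableT_comp measurable_fst measurable_snd).
  apply: measurable_pair => //.
  exact: (measurableT_comp measurable_snd measurable_snd).
rewrite (fubini_tonelli (m1 := mu) (m2 := nu) _ mN); last by move=> z; exact: poweR_ge0.
rewrite -ge0_integralZl//; last 3 first.
- apply: (measurable_fun_fubini_tonelli_G _ mN) => z; exact: poweR_ge0.
- by move=> v _; apply: integral_ge0 => x _; exact: poweR_ge0.
- by rewrite lee_fin ltW.
apply: le_integralT => v; first by apply: integral_ge0 => x _; exact: poweR_ge0.
by apply: (H _ _ _ _ _ hcell m (fun z => f (z.1, v, z.2))).
Qed.

(** Asking for all the exponents at once makes the property stable under
    iteration: [iter_norm N nu r] inherits the exponent [r] from [N] by exchanging
    integrals, and the other exponents follow from this one. *)
Record good_norm d (U : measurableType d) (N : (U -> \bar R) -> \bar R) : Prop :=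
  GoodNorm {
  good_function_norm : function_norm N ;
  good_maximal : forall e : R, (1 < e)%R -> maximal_bounded N e }.

Lemma good_norm_unit : good_norm (fun f : unit -> \bar R => `|f tt|).
Proof. by split; [exact: function_norm_unit|exact: maximal_bounded_unit]. Qed.

Lemma good_norm_iter d (U : measurableType d) (N : (U -> \bar R) -> \bar R)
    d1 (V : measurableType d1) (nu : {sigma_finite_measure set V -> \bar R})
    (r : R) : (1 < r)%R -> good_norm N -> good_norm (iter_norm N nu r).
Proof.
move=> r1 [hN mN].
have hN' : function_norm (iter_norm N nu r) by exact: (function_norm_iter _ (ltW r1)).
split => // e e1; apply: (maximal_bounded_exponent hN' r1 e1).
by apply: maximal_bounded_iter => //; exact: mN.
Qed.

End maximal_bounded.

(** * Dyadic fractional integrals in one variable *)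

Section two_grids.
Context (R : realType) d (T : measurableType d)
  (mu : {sigma_finite_measure set T -> \bar R})
  (cells : bool -> nat -> T -> R) (lam : nat -> R)
  (hcells : forall w, dyadic_filtration mu (cells w) lam) (m : nat).
Local Open Scope ereal_scope.

(** With both grids, this dominates the average over any interval of length
    comparable with [lam k]. *)
Definition average k (h : T -> \bar R) x : \bar R :=
  cond_exp mu (cells true) lam k h x + cond_exp mu (cells false) lam k h x.

(** The dyadic model of the fractional integral of order [g]: on the scale
    [lam k] the kernel [|x - y| ^ (g - 1)] is comparable with [lam k ^ g] times that
    of an average. *)
Definition frac_sum (g : R) (h : T -> \bar R) x : \bar R :=
  \sum_(k < m) ((lam k `^ g)%:E * average k h x).

Definition max_average (h : T -> \bar R) x : \bar R :=
  max_cond_exp mu (cells true) lam 0 m h x +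
  max_cond_exp mu (cells false) lam 0 m h x.

Lemma average_ge0 k h x : (forall y, 0 <= h y) -> 0 <= average k h x.
Proof.
by move=> h0; rewrite adde_ge0//; exact: (cond_exp_ge0 (hcells _)).
Qed.

Lemma frac_sum_ge0 g h x : (forall y, 0 <= h y) -> 0 <= frac_sum g h x.
Proof.
move=> h0; apply: sume_ge0 => k _; rewrite mule_ge0 ?average_ge0// lee_fin.
exact: powR_ge0.
Qed.

Lemma max_average_ge0 h x : 0 <= max_average h x.
Proof. by rewrite adde_ge0// max_cond_exp_ge0. Qed.

Lemma average_le_max k h x : (k < m)%N -> average k h x <= max_average h x.
Proof. by move=> km; apply: leeD; exact: max_cond_exp_ge. Qed.

Lemma measurable_average_param d' (U : measurableType d') k (f : U * T -> \bar R) :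
  measurable_fun setT f -> (forall z, 0 <= f z) ->
  measurable_fun setT (fun z : U * T => average k (fun y => f (z.1, y)) z.2).
Proof.
by move=> mf f0; apply: emeasurable_funD;
  exact: (measurable_cond_exp_param (hcells _)).
Qed.

Lemma measurable_frac_sum_param d' (U : measurableType d') g (f : U * T -> \bar R) :
  measurable_fun setT f -> (forall z, 0 <= f z) ->
  measurable_fun setT (fun z : U * T => frac_sum g (fun y => f (z.1, y)) z.2).
Proof.
move=> mf f0; apply: emeasurable_sum => k; apply: measurable_funeM.
exact: measurable_average_param.
Qed.

Lemma measurable_max_average_param d' (U : measurableType d') (f : U * T -> \bar R) :
  measurable_fun setT f -> (forall z, 0 <= f z) ->
  measurable_fun setT (fun z : U * T => max_average (fun y => f (z.1, y)) z.2).
Proof.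
by move=> mf f0; apply: emeasurable_funD;
  exact: (measurable_max_cond_exp_param (hcells _)).
Qed.

Lemma le_average k g h x : (forall y, 0 <= g y) -> (forall y, g y <= h y) ->
  average k g x <= average k h x.
Proof. by move=> g0 gh; apply: leeD; exact: (le_cond_exp (hcells _)). Qed.

Lemma lam_geometric k : lam k = (lam 0%N * 2 ^+ k)%R.
Proof.
elim: k => [|k IH]; first by rewrite expr0 mulr1.
by rewrite (lamS (hcells true)) IH exprS mulrCA.
Qed.

Lemma fnorm_average d' (U : measurableType d') (N : (U -> \bar R) -> \bar R)
    (hN : function_norm N) k (f : U * T -> \bar R) x :
  measurable_fun setT f -> (forall z, 0 <= f z) ->
  N (fun u => average k (fun y => f (u, y)) x) <=
  average k (fun y => N (fun u => f (u, y))) x.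
Proof.
move=> mf f0; apply: le_trans; first apply: (fnormD hN).
- exact: (measurable_section1 x (measurable_cond_exp_param (hcells _) k mf f0)).
- exact: (measurable_section1 x (measurable_cond_exp_param (hcells _) k mf f0)).
- by move=> u; exact: (cond_exp_ge0 (hcells _)).
- by move=> u; exact: (cond_exp_ge0 (hcells _)).
by apply: leeD; exact: (fnorm_cond_exp hN (hcells _)).
Qed.

Lemma fnorm_frac_sum d' (U : measurableType d') (N : (U -> \bar R) -> \bar R)
    (hN : function_norm N) g (f : U * T -> \bar R) x :
  measurable_fun setT f -> (forall z, 0 <= f z) ->
  N (fun u => frac_sum g (fun y => f (u, y)) x) <=
  frac_sum g (fun y => N (fun u => f (u, y))) x.
Proof.
move=> mf f0; rewrite /frac_sum; move: m => n; elim: n => [|n IH].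
  under [X in N X]funext do rewrite big_ord0.
  by rewrite big_ord0 (fnorm0 hN).
rewrite big_ord_recr/=; under [X in N X]funext do rewrite big_ord_recr/=.
have mav k := measurable_section1 x (measurable_average_param k mf f0).
have av0 k u : 0 <= (lam k `^ g)%:E * average k (fun y => f (u, y)) x.
  by rewrite mule_ge0 ?average_ge0// lee_fin powR_ge0.
apply: le_trans; first apply: (fnormD hN).
- by apply: emeasurable_sum => k; apply: measurable_funeM; exact: mav.
- by apply: measurable_funeM; exact: mav.
- by move=> u; exact: sume_ge0.
- by move=> u.
apply: leeD => //; apply: le_trans; first apply: (fnormZ_le hN).
- exact: powR_ge0.
- exact: mav.
- by move=> u; exact: average_ge0.
apply: lee_wpmul2l; first by rewrite lee_fin powR_ge0.
exact: (fnorm_average hN n x mf f0).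
Qed.

Lemma average_le_Lnorm (p : R) k h x : (1 <= p)%R ->
  measurable_fun setT h -> (forall y, 0 <= h y) ->
  average k h x <= (2 * lam k `^ (- p^-1))%:E * Lnorm mu p%:E h.
Proof.
move=> p1 mh h0; have p0 : (0 < p)%R by exact: lt_le_trans p1.
have l0 := lam_gt0 (hcells true) k.
have one w : cond_exp mu (cells w) lam k h x <=
    (lam k `^ (- p^-1))%:E * Lnorm mu p%:E h.
  rewrite ge0_Lnorm//; apply: (le_poweR_root p0).
  - exact: (cond_exp_ge0 (hcells _)).
  - by rewrite mule_ge0 ?poweR_ge0// lee_fin powR_ge0.
  apply: (le_trans (cond_exp_poweR (hcells w) k x p1 mh h0)).
  have I0 : 0 <= \int[mu]_x (h x `^ p).
    by apply: integral_ge0 => y _; exact: poweR_ge0.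
  rewrite poweRM ?lee_fin ?powR_ge0 ?poweR_ge0// poweRVK ?gt_eqF//.
  rewrite poweR_EFin -powRrM mulNr mulVf ?gt_eqF// powR_inv1 ?(ltW l0)//.
  rewrite -ge0_integralZl//; last 3 first.
  - exact: measurable_fun_poweR.
  - by move=> y _; exact: poweR_ge0.
  - by rewrite lee_fin invr_ge0 ltW.
  apply: le_integralT => y.
    by rewrite mule_ge0 ?poweR_ge0// (cell_kernel_ge0 (hcells w)).
  apply: lee_wpmul2r; first exact: poweR_ge0.
  by rewrite /cell_kernel; case: ifP => // _; rewrite lee_fin invr_ge0 ltW.
apply: (le_trans (leeD (one true) (one false))).
by rewrite -ge0_muleDl ?lee_fin ?powR_ge0// -EFinD mulr_natl mulr2n.
Qed.

End two_grids.

Section hedberg.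
Context (R : realType).

(** Hedberg's argument: for small [lam k] the bound by [t] is used, for large
    [lam k] the bound by [s]; both geometric sums are dominated by their value
    at the crossing point. *)
Lemma hedberg (p q s t l : R) (a : nat -> R) (m : nat) :
  1 < p -> p < q -> 0 < s -> 0 < t -> 0 < l ->
  (forall k, 0 <= a k) -> (forall k, (k < m)%N -> a k <= t) ->
  (forall k, (k < m)%N -> a k <= 2 * (l * 2 ^+ k) `^ (- p^-1) * s) ->
  \sum_(k < m) (l * 2 ^+ k) `^ (p^-1 - q^-1) * a k <=
  (geom (p^-1 - q^-1) + 2 * (geom q^-1 * 2^-1 `^ (- q^-1))) *
  (t * (s / t) `^ (1 - p / q)).
Proof.
move=> p1 pq s0 t0 l0 a0 at_ as_.
have p0 : 0 < p by exact: lt_trans p1.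
have q0 : 0 < q by exact: lt_trans pq.
set g := p^-1 - q^-1; have g0 : 0 < g by rewrite subr_gt0 ltf_pV2.
have q'0 : 0 < q^-1 by rewrite invr_gt0.
set z := s / t; have z0 : 0 < z by rewrite divr_gt0.
have sE : s = t * z by rewrite /z mulrCA mulfV ?mulr1// gt_eqF.
set A := t * z `^ (1 - p / q); have A0 : 0 < A by rewrite mulr_gt0 ?powR_gt0.
pose r := z `^ p; have r0 : 0 < r by rewrite powR_gt0.
pose y := l / r; have y0 : 0 < y by rewrite divr_gt0.
have lE k : l * 2 ^+ k = r * (y * 2 ^+ k).
  by rewrite /y; field; rewrite gt_eqF.
have yk0 k : 0 < y * 2 ^+ k by rewrite mulr_gt0 ?exprn_gt0.
have E1 : r `^ g * t = A.
  rewrite /r -powRrM /A mulrC; congr (_ * _ `^ _).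
  by rewrite /g mulrBr mulfV// gt_eqF.
have E2 : s * r `^ (- q^-1) = A.
  rewrite sE /r -powRrM /A -mulrA; congr (_ * _).
  rewrite -[X in X * _]powRr1 ?(ltW z0)// -powRD ?(gt_eqF z0) ?implybT//.
  by rewrite mulrN.
have bnd k : (k < m)%N -> (l * 2 ^+ k) `^ g * a k <=
    A * (if y * 2 ^+ k < 1 then (y * 2 ^+ k) `^ g else 0) +
    2 * A * (if 2^-1 < y * 2 ^+ k then (y * 2 ^+ k) `^ (- q^-1) else 0).
  move=> km; rewrite lE powRM ?(ltW r0) ?(ltW (yk0 k))//.
  have [yk|yk] := ltP (y * 2 ^+ k) 1.
    apply: ler_wpDr.
      by case: (2^-1 < _); rewrite ?mulr0// mulr_ge0 ?powR_ge0// mulr_ge0// ltW.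
    rewrite -E1 mulrAC; apply: ler_wpM2r; first exact: powR_ge0.
    by apply: ler_wpM2l; [exact: powR_ge0|exact: at_].
  rewrite mulr0 add0r.
  have -> : 2^-1 < y * 2 ^+ k.
    by apply: lt_le_trans yk; rewrite invf_lt1 ?ltr1n.
  apply: (@le_trans _ _ (r `^ g * (y * 2 ^+ k) `^ g *
      (2 * (l * 2 ^+ k) `^ (- p^-1) * s))).
    by rewrite ler_wpM2l ?mulr_ge0 ?powR_ge0// as_.
  rewrite lE; move: (yk0 k); set Y := y * _ => Y0.
  rewrite (powRM (- p^-1) (ltW r0) (ltW Y0)) -E2.
  have D (x : R) : 0 < x -> x `^ g * x `^ (- p^-1) = x `^ (- q^-1).
    move=> x0; rewrite -powRD ?(gt_eqF x0) ?implybT//; congr (_ `^ _).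
    by rewrite /g addrAC subrr add0r.
  rewrite -(D r r0) -(D Y Y0) le_eqVlt; apply/orP; left; apply/eqP; ring.
apply: (@le_trans _ _ (\sum_(k < m)
    (A * (if y * 2 ^+ k < 1 then (y * 2 ^+ k) `^ g else 0) +
    2 * A * (if 2^-1 < y * 2 ^+ k then (y * 2 ^+ k) `^ (- q^-1) else 0)))).
  by apply: ler_sum => k _; exact: bnd.
rewrite big_split/= -!mulr_sumr [leRHS]mulrDl; apply: lerD.
  rewrite mulrC ler_wpM2r ?(ltW A0)//.
  by have := geometric_sum_below m g0 y0 (@ltr01 R); rewrite powR1 mulr1.
rewrite -mulrA -[leRHS]mulrA; apply: ler_wpM2l => //.
rewrite [leLHS]mulrC; apply: ler_wpM2r; first exact: ltW.
by apply: geometric_sum_above; rewrite ?invr_gt0.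
Qed.

End hedberg.

Section hardy_littlewood_sobolev.
Context (R : realType).
Local Open Scope ereal_scope.

Lemma poweRD_le (r : R) (a b : \bar R) : (0 < r)%R -> 0 <= a -> 0 <= b ->
  (a + b) `^ r <= (2 `^ r)%:E * (a `^ r + b `^ r).
Proof.
move=> r0; wlog ab : a b / a <= b.
  move=> H a0 b0; have [ab|/ltW ba] := leP a b; first exact: H.
  by rewrite addeC [X in _ * X]addeC; exact: H.
move=> a0 b0; apply: (@le_trans _ _ ((2%:E * b) `^ r)).
  apply: ge0_le_poweR; rewrite ?(ltW r0) ?adde_ge0//.
  rewrite [X in X * _](_ : 2%:E = 1 + 1); last by rewrite -EFinD.
  by rewrite ge0_muleDl// !mul1e leeD2r.
rewrite poweRM// poweR_EFin; apply: lee_wpmul2l; first by rewrite lee_fin powR_ge0.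
by rewrite leeDr// poweR_ge0.
Qed.

Lemma max_average_bounded d (U : measurableType d) (N : (U -> \bar R) -> \bar R)
    (e : R) : function_norm N -> (1 < e)%R -> maximal_bounded N e ->
  exists C : R, (0 < C)%R /\
  forall d' (T : measurableType d') (mu : {sigma_finite_measure set T -> \bar R})
    cells lam, (forall w, dyadic_filtration mu (cells w) lam) ->
  forall m (f : U * T -> \bar R),
  measurable_fun setT f -> (forall z, 0 <= f z) ->
  Lnorm mu e%:E (fun x => N (fun u => max_average mu cells lam m (fun y => f (u, y)) x))
  <= C%:E * Lnorm mu e%:E (fun x => N (fun u => f (u, x))).
Proof.
move=> hN e1 [C [C0 H]]; have e0 : (0 < e)%R by exact: lt_trans e1.
have K0 : (0 < 2 `^ e * (2 * C))%R by rewrite !mulr_gt0 ?powR_gt0.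
exists ((2 `^ e * (2 * C)) `^ e^-1)%R; split; first by rewrite powR_gt0.
move=> d' T mu cells lam hcells m f mf f0.
have N0 g : 0 <= N g by exact: (fnorm_ge0 hN).
apply: (le_poweR_root e0); rewrite ?Lnorm_ge0 ?mule_ge0 ?Lnorm_ge0 ?lee_fin ?powR_ge0//.
rewrite poweRM ?Lnorm_ge0 ?lee_fin ?powR_ge0// !ge0_Lnorm_poweR ?gt_eqF//.
rewrite poweR_EFin -powRrM mulVf ?gt_eqF// powRr1 ?(ltW K0)//.
pose M w x := N (fun u => max_cond_exp mu (cells w) lam 0 m (fun y => f (u, y)) x).
have mM w : measurable_fun setT (M w) by exact: (measurable_fnorm_max hN (hcells w)).
have M0 w x : 0 <= M w x by exact: N0.
apply: (@le_trans _ _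
    (\int[mu]_x ((2 `^ e)%:E * (M true x `^ e + M false x `^ e)))).
  apply: le_integralT => x; first exact: poweR_ge0.
  apply: le_trans (poweRD_le e0 (M0 true x) (M0 false x)).
  apply: ge0_le_poweR; rewrite ?(ltW e0)//; apply: (fnormD hN).
  - exact: (measurable_section1 x (measurable_max_cond_exp_param (hcells _) 0 m mf f0)).
  - exact: (measurable_section1 x (measurable_max_cond_exp_param (hcells _) 0 m mf f0)).
  - by move=> u; exact: max_cond_exp_ge0.
  - by move=> u; exact: max_cond_exp_ge0.
have mMe w : measurable_fun setT (fun x => M w x `^ e) by exact: measurable_fun_poweR.
have Me0 w x : 0 <= M w x `^ e by exact: poweR_ge0.
rewrite ge0_integralZl ?lee_fin ?powR_ge0//; last 2 first.
- exact: emeasurable_funD.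
- by move=> x _; rewrite adde_ge0.
rewrite [in leRHS]EFinM -[leRHS]muleA; apply: lee_wpmul2l.
  by rewrite lee_fin powR_ge0.
rewrite ge0_integralD//; apply: le_trans.
  by apply: leeD; apply: (H _ _ _ _ _ (hcells _) m f mf f0).
set I := \int[mu]_x _; have I0 : 0 <= I by apply: integral_ge0 => x _; exact: poweR_ge0.
by rewrite -ge0_muleDl ?lee_fin ?(ltW C0)// -EFinD mulr_natl mulr2n.
Qed.

(** The Hardy-Littlewood-Sobolev inequality, for the dyadic model of the
    fractional integral. *)
Lemma frac_sum_bounded (p q : R) : (1 < p)%R -> (p < q)%R ->
  exists C : R, (0 < C)%R /\
  forall d (T : measurableType d) (mu : {sigma_finite_measure set T -> \bar R})
    cells lam, (forall w, dyadic_filtration mu (cells w) lam) ->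
  forall m (h : T -> \bar R), measurable_fun setT h -> (forall y, 0 <= h y) ->
  Lnorm mu q%:E (frac_sum mu cells lam m (p^-1 - q^-1) h) <=
  C%:E * Lnorm mu p%:E h.
Proof.
move=> p1 pq; have p0 : (0 < p)%R by exact: lt_trans p1.
have q0 : (0 < q)%R by exact: lt_trans pq.
have q'0 : (0 < q^-1)%R by rewrite invr_gt0.
set g := (p^-1 - q^-1)%R; have g0 : (0 < g)%R by rewrite subr_gt0 ltf_pV2.
have [D [D0 HD]] := max_average_bounded (function_norm_unit R) p1
  (maximal_bounded_unit p1).
pose A := (geom g + 2 * (geom q^-1 * 2^-1 `^ (- q^-1)))%R.
have A0 : (0 < A)%R.
  by rewrite addr_gt0 ?geom_gt0// !mulr_gt0 ?geom_gt0// powR_gt0.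
exists (A * D `^ (p / q))%R; split; first by rewrite mulr_gt0 ?powR_gt0.
move=> d T mu cells lam hcells m h mh h0.
set s := Lnorm mu p%:E h; have s0 : 0 <= s by exact: Lnorm_ge0.
have AD0 : (0 < A * D `^ (p / q))%R by rewrite mulr_gt0 ?powR_gt0.
pose S := frac_sum mu cells lam m g h.
pose t := max_average mu cells lam m h.
have S0 x : 0 <= S x by exact: (frac_sum_ge0 hcells).
have t0 x : 0 <= t x by exact: max_average_ge0.
have mt : measurable_fun setT t.
  have := @measurable_max_average_param _ _ _ mu _ _ hcells m _ unit
    (fun z => h z.2) (measurableT_comp mh measurable_snd) (fun z => h0 z.2).
  by move/(measurable_section2 tt).
have av0 k x : 0 <= average mu cells lam k h x by exact: (average_ge0 hcells).
have S_0 x : (forall k, (k < m)%N -> average mu cells lam k h x <= 0) -> S x = 0.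
  move=> H; apply: big1 => k _.
  have -> : average mu cells lam k h x = 0.
    by apply/eqP; rewrite eq_le av0 H//=.
  by rewrite mule0.
have [soo|sfin] := eqVneq s +oo.
  by rewrite soo gt0_muley ?leey// lte_fin.
have sf : s \is a fin_num by rewrite ge0_fin_numE// ltey.
have [s_eq0|sn0] := eqVneq s 0.
  have -> : Lnorm mu q%:E (frac_sum mu cells lam m g h) = 0.
    rewrite (_ : frac_sum _ _ _ _ _ _ = cst 0) ?Lnorm0 ?eqe ?gt_eqF//.
    apply/funext => x; apply: S_0 => k km.
    apply: (le_trans (average_le_Lnorm hcells k x (ltW p1) mh h0)).
    by rewrite -/s s_eq0 mule0.
  by rewrite mule_ge0// lee_fin ltW.
have sE := fineK sf; set s' := fine s in sE.
have s'0 : (0 < s')%R by rewrite -lte_fin sE lt0e sn0.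
(* the pointwise bound of Hedberg *)
have key x : S x `^ q <= (A `^ q * s' `^ (q - p))%:E * t x `^ p.
  have [toox|tfin] := eqVneq (t x) +oo.
    rewrite toox poweRyr ?gt_eqF// gt0_muley ?leey// lte_fin.
    by rewrite mulr_gt0 ?powR_gt0.
  have tf : t x \is a fin_num by rewrite ge0_fin_numE// ltey.
  have avt k : (k < m)%N -> average mu cells lam k h x <= t x.
    exact: average_le_max.
  have [tx0|tx0] := eqVneq (t x) 0.
    by rewrite S_0 ?poweR0r ?gt_eqF ?mule_ge0 ?poweR_ge0// ?tx0 => [|k /avt];
      rewrite ?lee_fin ?mulr_ge0 ?powR_ge0// tx0.
  have tE := fineK tf; set t' := fine (t x) in tE.
  have t'0 : (0 < t')%R by rewrite -lte_fin tE lt0e tx0 t0.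
  pose a k := fine (average mu cells lam k h x).
  have aE k : (k < m)%N -> average mu cells lam k h x = (a k)%:E.
    move=> km; rewrite fineK// ge0_fin_numE//.
    by apply: (le_lt_trans (avt _ km)); rewrite -tE ltry.
  have a0 k : (0 <= a k)%R by rewrite fine_ge0.
  have l0 := lam_gt0 (hcells true) 0%N.
  have := @hedberg R p q s' t' (lam 0%N) a m p1 pq s'0 t'0 l0 a0.
  rewrite -/g -/A => H.
  have {H} : S x <= (A * (t' * (s' / t') `^ (1 - p / q)))%:E.
    rewrite /S /frac_sum (eq_bigr (fun k : 'I_m =>
      ((lam 0%N * 2 ^+ k) `^ g * a k)%:E)%R); last first.
      by move=> k _; rewrite aE// -EFinM -(lam_geometric hcells).
    rewrite sumEFin lee_fin; apply: H => k km.
      by rewrite -lee_fin -aE// tE avt.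
    rewrite -lee_fin -aE// EFinM sE -(lam_geometric hcells).
    exact: (average_le_Lnorm hcells k x (ltW p1) mh h0).
  move=> /(ge0_le_poweR (ltW q0) (S0 x)) /le_trans; apply.
  rewrite -tE !poweR_EFin -EFinM lee_fin le_eqVlt; apply/orP; left; apply/eqP.
  have z0 : (0 < s' / t')%R by rewrite divr_gt0.
  rewrite powRM ?(ltW A0) ?mulr_ge0 ?powR_ge0 ?(ltW t'0)//.
  rewrite -mulrA; congr (_ * _)%R.
  rewrite powRM ?(ltW t'0) ?powR_ge0// -powRrM mulrBl mul1r divfK ?gt_eqF//.
  have -> : (s' `^ (q - p) = (s' / t') `^ (q - p) * t' `^ (q - p))%R.
    by rewrite -powRM ?(ltW z0) ?(ltW t'0)// divfK// gt_eqF.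
  by rewrite -mulrA -powRD ?(gt_eqF t'0) ?implybT// subrK mulrC.
apply: (le_poweR_root q0); rewrite ?Lnorm_ge0 ?mule_ge0// ?lee_fin ?(ltW AD0)//.
rewrite ge0_Lnorm_poweR ?gt_eqF//.
apply: (@le_trans _ _ (\int[mu]_x ((A `^ q * s' `^ (q - p))%:E * t x `^ p))).
  by apply: le_integralT => x; [exact: poweR_ge0|exact: key].
rewrite ge0_integralZl//; last 3 first.
- exact: measurable_fun_poweR.
- by move=> x _; exact: poweR_ge0.
- by rewrite lee_fin mulr_ge0 ?powR_ge0.
have tp : \int[mu]_x (t x `^ p) <= (D `^ p)%:E * (s' `^ p)%:E.
  have := HD _ _ mu cells lam hcells m (fun z => h z.2)
    (measurableT_comp mh measurable_snd) (fun z => h0 z.2).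
  rewrite /= -[X in Lnorm mu p%:E X <= _](_ : t = _); last first.
    by apply/funext => x; rewrite gee0_abs// max_average_ge0.
  rewrite -[X in _ <= _ * Lnorm mu p%:E X](_ : h = _); last first.
    by apply/funext => x; rewrite gee0_abs.
  move=> /(ge0_le_poweR (ltW p0) (Lnorm_ge0 _ _ _)).
  rewrite ge0_Lnorm_poweR ?gt_eqF// => /le_trans; apply.
  by rewrite poweRM ?lee_fin ?(ltW D0)// -/s -sE.
apply: (@le_trans _ _ ((A `^ q * s' `^ (q - p))%:E * ((D `^ p)%:E * (s' `^ p)%:E))).
  by apply: lee_wpmul2l => //; rewrite lee_fin mulr_ge0 ?powR_ge0.
rewrite -sE -!EFinM poweR_EFin lee_fin.
have -> : ((A * D `^ (p / q) * s') `^ q = A `^ q * D `^ p * s' `^ q)%R.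
  rewrite powRM ?(ltW AD0) ?(ltW s'0)// powRM ?(ltW A0) ?powR_ge0//.
  by rewrite -powRrM divfK ?gt_eqF.
have -> : (s' `^ q = s' `^ (q - p) * s' `^ p)%R.
  by rewrite -powRD ?(gt_eqF s'0) ?implybT// subrK.
by rewrite le_eqVlt; apply/orP; left; apply/eqP; ring.
Qed.

End hardy_littlewood_sobolev.

(** * Two shifted dyadic grids of the line *)

Section shifted_grids.
Context (R : realType).
Local Notation mu := (@lebesgue_measure R).

(** Displacement of the cells of rank [k], in units of the finest mesh. The second
    grid is moved by half a mesh at every other rank, which keeps it nested. *)
Fixpoint grid_shift (w : bool) (k : nat) : nat :=
  if k is k'.+1 then (grid_shift w k' + (w && ~~ odd k') * 2 ^ k')%N else 0%N.

Lemma grid_shift_false k : grid_shift false k = 0%N.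
Proof. by elim: k => //= k ->. Qed.

(** The shift is one third of the period at even ranks and two thirds at odd
    ranks, up to rounding; hence the endpoints of the two grids stay apart. *)
Lemma grid_shift_true k :
  (3 * grid_shift true k + 1 = if odd k then 2 ^ k.+1 else 2 ^ k)%N.
Proof.
elim: k => //= k IH; case: (odd k) IH => /= IH.
  by rewrite mul0n addn0 IH.
by rewrite mul1n mulnDr addnAC IH !expnS; lia.
Qed.

Lemma grid_shift_third k : (0 < k)%N ->
  (2 ^ k <= 4 * grid_shift true k <= 3 * 2 ^ k)%N.
Proof.
move=> k0; have := grid_shift_true k.
have : (2 <= 2 ^ k)%N by case: k k0 => // k _; rewrite expnS leq_pmulr// expn_gt0.
case: ifP => ko; first by rewrite expnS; lia.
have : (4 <= 2 ^ k)%N.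
  by case: k k0 ko => [//|[//|k]] _ _; rewrite !expnS mulnA leq_pmulr// expn_gt0.
lia.
Qed.

Definition grid_length (eps : R) (k : nat) : R := eps * 2 ^+ k.

Definition grid_index (eps : R) (w : bool) (k : nat) (x : R) : int :=
  Num.floor ((x - eps * (grid_shift w k)%:R) / grid_length eps k).

Definition grid_cell (eps : R) (w : bool) (k : nat) (x : measurableTypeR R) : R :=
  (grid_index eps w k x)%:~R.

Lemma floor_half (z1 z2 : R) (c : bool) : Num.floor z1 = Num.floor z2 ->
  Num.floor ((z1 - c%:R) / 2) = Num.floor ((z2 - c%:R) / 2) :> int.
Proof.
have H (z : R) : Num.floor ((z - c%:R) / 2) = ((Num.floor z - c%:R) %/ 2)%Z.
  set f := Num.floor z; set n := ((f - c%:R) %/ 2)%Z.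
  have /andP[f1 f2] := floor_itv z; rewrite -/f in f1 f2.
  have E := divz_eq (f - c%:R) 2; rewrite -/n in E.
  set r := ((f - c%:R) %% 2)%Z in E.
  have r0 : 0 <= r by rewrite modz_ge0.
  have r1 : r <= 1 by rewrite -ltzD1 ltz_pmod.
  have ER : f%:~R - c%:R = n%:~R * 2 + r%:~R :> R.
    have := congr1 (fun i : int => i%:~R : R) E.
    have C : (c%:R : int)%:~R = c%:R :> R by case: (c).
    by rewrite /= intrB [in X in _ = X -> _]intrD intrM C.
  have r0' : 0 <= r%:~R :> R by rewrite ler0z.
  have r1' : r%:~R <= 1 :> R by rewrite lerz1.
  apply: floor_def; apply/andP; split.
    by rewrite ler_pdivlMr//; lra.
  by rewrite ltr_pdivrMr// intrD; rewrite intrD in f2; lra.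
by move=> e; rewrite !H e.
Qed.

Lemma grid_nested (eps : R) w k x y : 0 < eps ->
  grid_index eps w k x = grid_index eps w k y ->
  grid_index eps w k.+1 x = grid_index eps w k.+1 y.
Proof.
move=> e0; rewrite /grid_index /= => H.
have l0 : 0 < 2 ^+ k :> R by rewrite exprn_gt0.
have E z : (z - eps * (grid_shift w k + (w && ~~ odd k) * 2 ^ k)%:R) /
    grid_length eps k.+1 =
    ((z - eps * (grid_shift w k)%:R) / grid_length eps k - (w && ~~ odd k)%:R) / 2.
  rewrite /grid_length exprS natrD natrM natrX; field.
  by rewrite !gt_eqF.
by rewrite !E; apply: floor_half.
Qed.

Lemma grid_indexE (eps : R) w k x y : 0 < eps ->
  (grid_index eps w k x == grid_index eps w k y) =
  (eps * (grid_shift w k)%:R + (grid_index eps w k x)%:~R * grid_length eps k <= y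
    < eps * (grid_shift w k)%:R + ((grid_index eps w k x)%:~R + 1) * grid_length eps k).
Proof.
move=> e0; have l0 : 0 < grid_length eps k by rewrite mulr_gt0 ?exprn_gt0.
rewrite eq_sym {1}/grid_index floor_eq ler_pdivlMr// ltr_pdivrMr//.
by rewrite intrD lerBrDl ltrBlDl.
Qed.

Lemma grid_cell_eq (eps : R) w k x y :
  (grid_cell eps w k x == grid_cell eps w k y) =
  (grid_index eps w k x == grid_index eps w k y).
Proof. by rewrite /grid_cell eqr_int. Qed.

Lemma dyadic_filtration_grid (eps : R) w : 0 < eps ->
  dyadic_filtration mu (grid_cell eps w) (grid_length eps).
Proof.
move=> e0.
have l0 k : 0 < grid_length eps k by rewrite mulr_gt0 ?exprn_gt0.
split => //.
- move=> k; apply: nondecreasing_measurable => // x y xy.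
  rewrite ler_int; apply: le_floor.
  by rewrite ler_pM2r ?invr_gt0// lerD2r.
- move=> k x y /eqP; rewrite grid_cell_eq => /eqP H.
  by apply/eqP; rewrite grid_cell_eq; apply/eqP; exact: grid_nested.
- by move=> k; rewrite /grid_length exprS mulrCA.
move=> k x; set a := eps * (grid_shift w k)%:R + (grid_index eps w k x)%:~R * grid_length eps k.
rewrite (_ : [set y | _] = `[a, a + grid_length eps k[%classic).
  rewrite /= lebesgue_measure_itv/= lte_fin ltrDl l0 -EFinB.
  by rewrite addrAC subrr add0r.
apply/seteqP; split => y /=; rewrite grid_cell_eq grid_indexE// in_itv/= /a.
  by rewrite mulrDl mul1r addrA.
by rewrite mulrDl mul1r addrA.
Qed.

(** Two points at distance at most a quarter of the mesh lie in a common cell of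
    one of the two grids: otherwise an endpoint of each grid would separate
    them. *)
Lemma grids_cover (eps : R) k (x y : R) : 0 < eps -> (0 < k)%N ->
  `|x - y| * 4 <= grid_length eps k ->
  exists w, grid_cell eps w k x = grid_cell eps w k y.
Proof.
move=> e0 k0; wlog xy : x y / x <= y.
  move=> H; have [/H//|/ltW yx] := leP x y.
  by rewrite distrC => /(H _ _ yx)[w E]; exists w; rewrite E.
rewrite ler0_norm ?subr_le0// opprB => d.
have l0 : 0 < grid_length eps k by rewrite mulr_gt0 ?exprn_gt0.
suff : grid_index eps false k x == grid_index eps false k y \/
    grid_index eps true k x == grid_index eps true k y.
  by case=> H; [exists false|exists true]; apply/eqP; rewrite grid_cell_eq.
have sep w : grid_index eps w k x == grid_index eps w k y \/
    exists j : int, x < eps * (grid_shift w k)%:R + j%:~R * grid_length eps k <= y.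
  have := grid_indexE w k x x e0; rewrite eqxx => /esym/andP[x1 x2].
  have [|ny] := boolP (grid_index eps w k x == grid_index eps w k y); first by left.
  right; exists (grid_index eps w k x + 1); rewrite intrD x2/=.
  rewrite leNgt; apply: contra ny => yl.
  by rewrite grid_indexE// yl andbT (le_trans x1).
case: (sep false) => [|[j0 /andP[a0 b0]]]; first by left.
case: (sep true) => [|[j1 /andP[a1 b1]]]; first by right.
exfalso; rewrite grid_shift_false mulr0 add0r in a0 b0.
have /andP[t1 t2] := grid_shift_third k0.
have t1' : 2 ^+ k <= 4 * (grid_shift true k)%:R :> R by rewrite -natrX -natrM ler_nat.
have t2' : 4 * (grid_shift true k)%:R <= 3 * 2 ^+ k :> R.
  by rewrite -natrX -!natrM ler_nat.
set s := (grid_shift true k)%:R in t1' t2' a1 b1.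
have E2 : 0 < 2 ^+ k :> R by rewrite exprn_gt0.
have dd : `|eps * s + (j1 - j0)%:~R * grid_length eps k| * 4 < grid_length eps k.
  have : `|eps * s + (j1 - j0)%:~R * grid_length eps k| < y - x.
    by rewrite intrB mulrBl ltr_norml; apply/andP; split; lra.
  by lra.
move: dd; rewrite /grid_length mulrCA -mulrDr normrM gtr0_norm// -mulrA.
rewrite ltr_pM2l// => dd.
have [j0j|j1j] := leP j0 j1.
  have jj : 0 <= (j1 - j0)%:~R :> R by rewrite ler0z subr_ge0.
  have : 0 <= (j1 - j0)%:~R * 2 ^+ k :> R by rewrite mulr_ge0// ltW.
  move: dd => + h; rewrite ger0_norm; last by lra.
  by lra.
have jj : (j1 - j0)%:~R <= -1 :> R.
  by rewrite -(intrN _ 1) ler_int lerBlDr addrC -ltzD1 subrK.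
have h : (j1 - j0)%:~R * 2 ^+ k <= -1 * 2 ^+ k :> R by rewrite ler_wpM2r// ltW.
by move: dd; rewrite ler0_norm; lra.
Qed.

End shifted_grids.

(** * Dyadic fractional integrals in several variables *)

Section tuples.
Context (R : realType).
Local Open Scope ereal_scope.
Local Notation T := (measurableTypeR R).
Local Notation mu := (@lebesgue_measure R).

Lemma behead_cons_tup n (x : T) (t : Rn R n) :
  [tuple of behead (cons_tup (x, t))] = t.
Proof. exact: val_inj. Qed.

Lemma cons_tup_eta n (x : Rn R n.+1) :
  cons_tup (thead x, [tuple of behead x]) = x.
Proof. by apply/val_inj => /=; rewrite [in RHS](tuple_eta x). Qed.

Lemma tnth_lift0 n (p : n.+1.-tuple R) (i : 'I_n) :
  tnth p (lift ord0 i) = tnth [tuple of behead p] i.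
Proof. by rewrite [in LHS](tuple_eta p) tnthS. Qed.

Lemma measurable_thead n : measurable_fun setT (fun x : Rn R n.+1 => thead x).
Proof. exact: measurable_tnth. Qed.

Lemma measurable_tail n :
  measurable_fun setT (fun x : Rn R n.+1 => [tuple of behead x] : Rn R n).
Proof. exact: measurable_behead. Qed.

Lemma measurable_cons_section n (f : Rn R n.+1 -> \bar R) :
  measurable_fun setT f -> measurable_fun setT (fun z : T * Rn R n => f (cons_tup z)).
Proof. by move=> mf; exact: (measurableT_comp mf (measurable_cons_tup (n := n))). Qed.

Lemma integral_lebesgue_tupleS n (f : Rn R n.+1 -> \bar R) :
  measurable_fun setT f -> (forall x, 0 <= f x) ->
  \int[lebesgue_tuple R n.+1]_x f x =
  \int[lebesgue_tuple R n]_t \int[mu]_x f (cons_tup (x, t)).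
Proof.
move=> mf f0; have mc := measurable_cons_section mf.
transitivity (\int[(mu \x lebesgue_tuple R n)%E]_z f (cons_tup z)).
  rewrite /= /lebesgue_step.
  have := @ge0_integral_pushforward _ _ _ _ R (@cons_tup R n)
    (measurable_cons_tup (n := n)) (mu \x lebesgue_tuple R n)%E setT f.
  rewrite preimage_setT; apply => //.
by rewrite fubini_tonelli2.
Qed.

Lemma integral_lebesgue_tuple0 (f : Rn R 0 -> \bar R) :
  measurable_fun setT f -> \int[lebesgue_tuple R 0]_x f x = f [tuple].
Proof. by move=> mf; rewrite /= integral_dirac// diracT mul1e. Qed.

Lemma mixed_norm_ge0 n (p : n.-tuple R) (f : Rn R n -> \bar R) : 0 <= mixed_norm p f.
Proof. by elim: n p f => [p f|n IH p f] /=; [exact: abse_ge0|exact: IH]. Qed.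

Lemma le_mixed_norm n (p : n.-tuple R) (f g : Rn R n -> \bar R) :
  (forall i, 0 < tnth p i)%R -> (forall x, `|f x| <= `|g x|) ->
  mixed_norm p f <= mixed_norm p g.
Proof.
elim: n p f g => [p f g _|n IH p f g p0 fg] /=; first exact.
apply: IH => [i|t]; first by rewrite tnth_behead.
rewrite !gee0_abs ?Lnorm_ge0//; apply: le_Lnorm => //.
exact: p0.
Qed.

Lemma measurable_Lnorm_cons n (r : R) (f : Rn R n.+1 -> \bar R) :
  measurable_fun setT f -> (forall x, 0 <= f x) ->
  measurable_fun setT (fun t : Rn R n => Lnorm mu r%:E (fun x => f (cons_tup (x, t)))).
Proof.
move=> mf f0.
by apply: (@measurable_Lnorm_section1 _ _ _ _ _ mu (fun z => f (cons_tup z)) r);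
  [exact: measurable_cons_section|].
Qed.

Lemma mixed_normZ_le n (p : n.-tuple R) (c : R) (f : Rn R n -> \bar R) :
  (forall i, 1 <= tnth p i)%R -> (0 <= c)%R -> measurable_fun setT f ->
  (forall x, 0 <= f x) ->
  mixed_norm p (fun x => c%:E * f x) <= c%:E * mixed_norm p f.
Proof.
elim: n p f => [p f _ c0 _ f0|n IH p f p1 c0 mf f0] /=.
  by rewrite abseM gee0_abs.
have p1' : (1 <= thead p)%R by exact: p1.
apply: (@le_trans _ _ (mixed_norm [tuple of behead p] (fun t : Rn R n =>
    c%:E * Lnorm mu (thead p)%:E (fun x => f (cons_tup (x, t)))))).
  apply: le_mixed_norm => [i|t].
    by rewrite tnth_behead (lt_le_trans ltr01).
  rewrite (LnormZ_ge0 mu p1' c0)//.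
  exact: (measurable_section1 t (measurable_cons_section mf)).
apply: IH => //.
- by move=> i; rewrite tnth_behead.
- exact: measurable_Lnorm_cons.
- by move=> t; exact: Lnorm_ge0.
Qed.

Section operators.
Variables (cells : bool -> nat -> T -> R) (lam : nat -> R)
  (hcells : forall w, dyadic_filtration mu (cells w) lam) (m : nat).

(** The product over the variables of the kernels of [average]. *)
Definition tuple_kernel k : forall n, Rn R n -> Rn R n -> \bar R :=
  fix kernel n := if n is n'.+1 then fun x y =>
    (cell_kernel (cells true) lam k (thead x) (thead y) +
     cell_kernel (cells false) lam k (thead x) (thead y)) *
    kernel n' [tuple of behead x] [tuple of behead y]
  else fun _ _ => 1.

Definition tuple_average k n (f : Rn R n -> \bar R) (x : Rn R n) : \bar R :=
  \int[lebesgue_tuple R n]_y (tuple_kernel k x y * f y).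

(** Fractional integration in the variables where the exponent changes, maximal
    functions in the others. *)
Definition mixed_operator : forall n, n.-tuple R -> n.-tuple R ->
    (Rn R n -> \bar R) -> Rn R n -> \bar R :=
  fix op n := if n is n'.+1 then fun p q f x =>
    let p' := [tuple of behead p] in let q' := [tuple of behead q] in
    let x' := [tuple of behead x] in
    if thead p == thead q then
      op n' p' q' (fun t => max_average mu cells lam m
        (fun y => f (cons_tup (y, t))) (thead x)) x'
    else frac_sum mu cells lam m ((thead p)^-1 - (thead q)^-1)
      (fun y => op n' p' q' (fun t => f (cons_tup (y, t))) x') (thead x)
  else fun _ _ f x => f x.

Lemma tuple_kernel_ge0 k n (x y : Rn R n) : 0 <= tuple_kernel k x y.
Proof.
elim: n x y => //= n IH x y; rewrite mule_ge0//.
by rewrite adde_ge0// (cell_kernel_ge0 (hcells _)).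
Qed.

Lemma measurable_kernel2 k : measurable_fun setT (fun z : T * T =>
  cell_kernel (cells true) lam k z.1 z.2 + cell_kernel (cells false) lam k z.1 z.2).
Proof.
by apply: emeasurable_funD; exact: (measurable_cell_kernel2 (hcells _)).
Qed.

Lemma measurable_tuple_kernel k n :
  measurable_fun setT (fun z : Rn R n * Rn R n => tuple_kernel k z.1 z.2).
Proof.
elim: n => [|n IH] /=; first exact: measurable_cst.
apply: emeasurable_funM.
  apply: (@measurableT_comp _ _ _ _ _ _ _ setT
    (fun z : Rn R n.+1 * Rn R n.+1 => (thead z.1, thead z.2)) (measurable_kernel2 k)).
  apply: measurable_pair.
    exact: (measurableT_comp (@measurable_thead n) measurable_fst).
  exact: (measurableT_comp (@measurable_thead n) measurable_snd).
apply: (@measurableT_comp _ _ _ _ _ _ _ setT (fun z : Rn R n.+1 * Rn R n.+1 =>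
  ([tuple of behead z.1] : Rn R n, [tuple of behead z.2] : Rn R n)) IH).
apply: measurable_pair.
  exact: (measurableT_comp (@measurable_tail n) measurable_fst).
exact: (measurableT_comp (@measurable_tail n) measurable_snd).
Qed.

Lemma averageE k (h : T -> \bar R) x :
  measurable_fun setT h -> (forall y, 0 <= h y) ->
  average mu cells lam k h x =
  \int[mu]_y ((cell_kernel (cells true) lam k x y +
               cell_kernel (cells false) lam k x y) * h y).
Proof.
move=> mh h0; rewrite /average /cond_exp -ge0_integralD//.
- by apply: eq_integral => y _; rewrite ge0_muleDl// (cell_kernel_ge0 (hcells _)).
- by move=> y _; rewrite mule_ge0// (cell_kernel_ge0 (hcells _)).
- by apply: emeasurable_funM => //; exact: (measurable_cell_kernel (hcells _)).
- by move=> y _; rewrite mule_ge0// (cell_kernel_ge0 (hcells _)).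
- by apply: emeasurable_funM => //; exact: (measurable_cell_kernel (hcells _)).
Qed.

Let measurable_avg_integrand k n (f : Rn R n.+1 -> \bar R) (x : T) (t : Rn R n) :
  measurable_fun setT f -> (forall x, 0 <= f x) ->
  measurable_fun setT (fun z : T * Rn R n =>
    (cell_kernel (cells true) lam k x z.1 + cell_kernel (cells false) lam k x z.1) *
    tuple_kernel k t z.2 * f (cons_tup z)).
Proof.
move=> mf f0; apply: emeasurable_funM; last exact: measurable_cons_section.
apply: emeasurable_funM.
  exact: (measurableT_comp (measurable_section2 x (measurable_kernel2 k)) measurable_fst).
exact: (@measurableT_comp _ _ _ _ _ _ (fun t' => tuple_kernel k t t') setT
    (fun z : T * Rn R n => z.2)
    (measurable_section2 t (measurable_tuple_kernel k (n := n))) measurable_snd).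
Qed.

Let avg_integrand_ge0 k n (f : Rn R n.+1 -> \bar R) (x : T) (t : Rn R n) z :
  (forall x, 0 <= f x) ->
  0 <= (cell_kernel (cells true) lam k x z.1 + cell_kernel (cells false) lam k x z.1) *
    tuple_kernel k t z.2 * f (cons_tup z).
Proof.
by move=> f0; rewrite !mule_ge0 ?adde_ge0 ?tuple_kernel_ge0// (cell_kernel_ge0 (hcells _)).
Qed.

(** By Tonelli's theorem the head variable can be averaged first or last. *)
Lemma tuple_average_out k n (f : Rn R n.+1 -> \bar R) (x : T) (t : Rn R n) :
  measurable_fun setT f -> (forall x, 0 <= f x) ->
  tuple_average k f (cons_tup (x, t)) =
  tuple_average k (fun t' => average mu cells lam k (fun y => f (cons_tup (y, t'))) x) t.
Proof.
move=> mf f0; rewrite /tuple_average integral_lebesgue_tupleS; last 2 first.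
- apply: emeasurable_funM => //.
  exact: (measurable_section2 (cons_tup (x, t)) (measurable_tuple_kernel k (n := n.+1))).
- by move=> y; rewrite mule_ge0// tuple_kernel_ge0.
apply: eq_integral => t' _.
have mft : measurable_fun setT (fun y => f (cons_tup (y, t'))).
  exact: (measurable_section1 t' (measurable_cons_section mf)).
rewrite averageE// -ge0_integralZl//; last 3 first.
- apply: emeasurable_funM => //.
  exact: (measurable_section2 x (measurable_kernel2 k)).
- by move=> y _; rewrite mule_ge0// adde_ge0// (cell_kernel_ge0 (hcells _)).
- exact: tuple_kernel_ge0.
apply: eq_integral => y _; rewrite /= !behead_cons_tup.
by rewrite -muleA muleCA.
Qed.

Lemma tuple_average_in k n (f : Rn R n.+1 -> \bar R) (x : T) (t : Rn R n) :
  measurable_fun setT f -> (forall x, 0 <= f x) ->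
  tuple_average k f (cons_tup (x, t)) =
  average mu cells lam k (fun y => tuple_average k (fun t' => f (cons_tup (y, t'))) t) x.
Proof.
move=> mf f0; have mz := measurable_avg_integrand k x t mf f0.
have z0 z := avg_integrand_ge0 k x t z f0.
rewrite /tuple_average integral_lebesgue_tupleS; last 2 first.
- apply: emeasurable_funM => //.
  exact: (measurable_section2 (cons_tup (x, t)) (measurable_tuple_kernel k (n := n.+1))).
- by move=> y; rewrite mule_ge0// tuple_kernel_ge0.
transitivity (\int[lebesgue_tuple R n]_t' \int[mu]_y
   ((cell_kernel (cells true) lam k x y + cell_kernel (cells false) lam k x y) *
    tuple_kernel k t t' * f (cons_tup (y, t')))).
  by apply: eq_integral => t' _; apply: eq_integral => y _; rewrite /= !behead_cons_tup.
rewrite -(fubini_tonelli (m1 := mu) (m2 := lebesgue_tuple R n) _ mz)//.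
have mtf : measurable_fun setT (fun z : T * Rn R n => tuple_kernel k t z.2 * f (cons_tup z)).
  apply: emeasurable_funM; last exact: measurable_cons_section.
  exact: (@measurableT_comp _ _ _ _ _ _ (fun t' => tuple_kernel k t t') setT
    (fun z : T * Rn R n => z.2)
    (measurable_section2 t (measurable_tuple_kernel k (n := n))) measurable_snd).
have tf0 (z : T * Rn R n) : 0 <= tuple_kernel k t z.2 * f (cons_tup z).
  by rewrite mule_ge0// tuple_kernel_ge0.
rewrite averageE; last 2 first.
- by apply: (measurable_fun_fubini_tonelli_F (m2 := lebesgue_tuple R n) _ mtf).
- by move=> y; apply: integral_ge0 => t' _; exact: (tf0 (y, t')).
apply: eq_integral => y _; rewrite -ge0_integralZl//; last 3 first.
- exact: (measurable_section2 y mtf).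
- by move=> t' _; exact: (tf0 (y, t')).
- by rewrite adde_ge0// (cell_kernel_ge0 (hcells _)).
by apply: eq_integral => t' _; rewrite muleA.
Qed.

Lemma averageZ k (c : R) (h : T -> \bar R) x : (0 <= c)%R ->
  measurable_fun setT h -> (forall y, 0 <= h y) ->
  average mu cells lam k (fun y => c%:E * h y) x =
  c%:E * average mu cells lam k h x.
Proof.
move=> c0 mh h0; rewrite !averageE//; last 2 first.
- exact: measurable_funeM.
- by move=> y; rewrite mule_ge0.
rewrite -ge0_integralZl//; last 2 first.
- apply: emeasurable_funM => //.
  exact: (measurable_section2 x (measurable_kernel2 k)).
- by move=> y _; rewrite mule_ge0// adde_ge0// (cell_kernel_ge0 (hcells _)).
by apply: eq_integral => y _; rewrite muleCA.
Qed.

Lemma measurable_tuple_average_section k n (f : Rn R n.+1 -> \bar R) (t : Rn R n) :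
  measurable_fun setT f -> (forall x, 0 <= f x) ->
  measurable_fun setT (fun y : T => tuple_average k (fun t' => f (cons_tup (y, t'))) t).
Proof.
move=> mf f0; apply: (measurable_fun_fubini_tonelli_F (m2 := lebesgue_tuple R n)
  (fun z : T * Rn R n => tuple_kernel k t z.2 * f (cons_tup z))).
  apply: emeasurable_funM; last exact: measurable_cons_section.
  exact: (@measurableT_comp _ _ _ _ _ _ (fun t' => tuple_kernel k t t') setT
    (fun z : T * Rn R n => z.2)
    (measurable_section2 t (measurable_tuple_kernel k (n := n))) measurable_snd).
by move=> z; rewrite mule_ge0// tuple_kernel_ge0.
Qed.

Lemma le_tuple_average k n (f g : Rn R n -> \bar R) x :
  (forall y, 0 <= f y) -> (forall y, f y <= g y) ->
  tuple_average k f x <= tuple_average k g x.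
Proof.
move=> f0 fg; apply: le_integralT => y; first by rewrite mule_ge0// tuple_kernel_ge0.
by apply: lee_wpmul2l => //; exact: tuple_kernel_ge0.
Qed.

Lemma tuple_average_ge0 k n (f : Rn R n -> \bar R) x :
  (forall y, 0 <= f y) -> 0 <= tuple_average k f x.
Proof. by move=> f0; apply: integral_ge0 => y _; rewrite mule_ge0// tuple_kernel_ge0. Qed.

Lemma mixed_operator_ge0 n (p q : n.-tuple R) (f : Rn R n -> \bar R) x :
  (forall y, 0 <= f y) -> 0 <= mixed_operator p q f x.
Proof.
elim: n p q f x => //= n IH p q f x f0; case: ifP => _.
  by apply: IH => t; exact: max_average_ge0.
by apply: (frac_sum_ge0 hcells) => y; exact: IH.
Qed.

Lemma measurable_max_average_cons n (f : Rn R n.+1 -> \bar R) x :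
  measurable_fun setT f -> (forall y, 0 <= f y) ->
  measurable_fun setT (fun t : Rn R n =>
    max_average mu cells lam m (fun y => f (cons_tup (y, t))) x).
Proof.
move=> mf f0.
have ms : measurable_fun setT (fun z : Rn R n * T => f (cons_tup (z.2, z.1))).
  apply: (@measurableT_comp _ _ _ _ _ _ _ setT
    (fun z : Rn R n * T => (z.2, z.1)) (measurable_cons_section mf)).
  exact: measurable_pair.
exact: (measurable_section1 x (measurable_max_average_param hcells m ms _)).
Qed.

(** A single scale: this is what remains for the variables that follow the first
    one in which the exponent changes. *)
Lemma tuple_average_le_operator k n (p q : n.-tuple R) (f : Rn R n -> \bar R) x :
  (k < m)%N -> measurable_fun setT f -> (forall y, 0 <= f y) ->
  (lam k `^ (\sum_(i < n) ((tnth p i)^-1 - (tnth q i)^-1)))%:E * tuple_average k f x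
  <= mixed_operator p q f x.
Proof.
move=> km; elim: n p q f x => [p q f x mf f0|n IH p q f x mf f0].
  rewrite big_ord0 powRr0 mul1e /tuple_average integral_lebesgue_tuple0; last first.
    by apply: emeasurable_funM => //; exact: measurable_cst.
  by rewrite /= mul1e (tuple0 x).
have l0 := lam_gt0 (hcells true) k.
have lp (a : R) : 0 <= (lam k `^ a)%:E :> \bar R by rewrite lee_fin powR_ge0.
have mfx y : measurable_fun setT (fun t : Rn R n => f (cons_tup (y, t))).
  exact: (measurable_section2 y (measurable_cons_section mf)).
have -> : (\sum_(i < n.+1) ((tnth p i)^-1 - (tnth q i)^-1) =
    ((thead p)^-1 - (thead q)^-1) + \sum_(i < n)
      ((tnth [tuple of behead p] i)^-1 - (tnth [tuple of behead q] i)^-1))%R.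
  by rewrite big_ord_recl; congr (_ + _)%R; apply: eq_bigr => i _; rewrite !tnth_lift0.
rewrite powRD ?(gt_eqF l0) ?implybT// EFinM -muleA.
rewrite -[x in tuple_average k f x]cons_tup_eta /=.
set x' := [tuple of behead x].
case: ifPn => [/eqP pq|pq].
  rewrite pq subrr powRr0 mul1e.
  rewrite tuple_average_out//; apply: (@le_trans _ _ ((lam k `^ (\sum_(i < n)
      ((tnth [tuple of behead p] i)^-1 - (tnth [tuple of behead q] i)^-1)))%:E *
      tuple_average k (fun t => max_average mu cells lam m
        (fun y => f (cons_tup (y, t))) (thead x)) x')).
    apply: lee_wpmul2l => //; apply: le_tuple_average => t.
      exact: (average_ge0 hcells).
    exact: average_le_max.
  apply: IH; first exact: measurable_max_average_cons.
  by move=> t; exact: max_average_ge0.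
rewrite tuple_average_in//; apply: (@le_trans _ _
   ((lam k `^ ((thead p)^-1 - (thead q)^-1))%:E *
    average mu cells lam k (fun y => mixed_operator [tuple of behead p]
      [tuple of behead q] (fun t => f (cons_tup (y, t))) x') (thead x))); last first.
  rewrite /frac_sum (bigD1 (Ordinal km))//= leeDl// sume_ge0// => j _.
  rewrite mule_ge0 ?lee_fin ?powR_ge0//; apply: (average_ge0 hcells) => y.
  exact: mixed_operator_ge0.
apply: lee_wpmul2l => //.
apply: (@le_trans _ _ (average mu cells lam k (fun y => (lam k `^ (\sum_(i < n)
      ((tnth [tuple of behead p] i)^-1 - (tnth [tuple of behead q] i)^-1)))%:E *
      tuple_average k (fun t => f (cons_tup (y, t))) x') (thead x))).
  rewrite averageZ ?powR_ge0//.
  - exact: (measurable_tuple_average_section k x' mf f0).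
  - by move=> y; exact: tuple_average_ge0.
apply: (le_average hcells) => y; last exact: IH.
by rewrite mule_ge0// tuple_average_ge0.
Qed.

(** Once some exponent changes, the sum over the scales of a product of averages
    is at most the product of one sum over the scales and of maximal functions. *)
Lemma sum_tuple_average_le_operator n (p q : n.-tuple R) (f : Rn R n -> \bar R) x :
  (exists i, tnth p i <> tnth q i) ->
  measurable_fun setT f -> (forall y, 0 <= f y) ->
  \sum_(k < m) ((lam k `^ (\sum_(i < n) ((tnth p i)^-1 - (tnth q i)^-1)))%:E *
    tuple_average k f x) <= mixed_operator p q f x.
Proof.
elim: n p q f x => [p q f x [[]]//|n IH p q f x ex mf f0].
have lp k (a : R) : 0 <= (lam k `^ a)%:E :> \bar R by rewrite lee_fin powR_ge0.
have mfx y : measurable_fun setT (fun t : Rn R n => f (cons_tup (y, t))).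
  exact: (measurable_section2 y (measurable_cons_section mf)).
set s := (\sum_(i < n)
      ((tnth [tuple of behead p] i)^-1 - (tnth [tuple of behead q] i)^-1))%R.
have -> : (\sum_(i < n.+1) ((tnth p i)^-1 - (tnth q i)^-1) =
    ((thead p)^-1 - (thead q)^-1) + s)%R.
  by rewrite big_ord_recl; congr (_ + _)%R; apply: eq_bigr => i _; rewrite !tnth_lift0.
rewrite (eq_bigr (fun k : 'I_m => (lam k `^ ((thead p)^-1 - (thead q)^-1))%:E *
    ((lam k `^ s)%:E * tuple_average k f (cons_tup (thead x, [tuple of behead x])))));
  last first.
  move=> k _; have l0 := lam_gt0 (hcells true) k.
  by rewrite powRD ?(gt_eqF l0) ?implybT// EFinM -muleA cons_tup_eta.
rewrite /=; set x' := [tuple of behead x].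
case: ifPn => [/eqP pq|pq].
  apply: (@le_trans _ _ (\sum_(k < m) ((lam k `^ s)%:E *
      tuple_average k (fun t => max_average mu cells lam m
        (fun y => f (cons_tup (y, t))) (thead x)) x'))).
    apply: lee_sum => k _; rewrite pq subrr powRr0 mul1e.
    apply: lee_wpmul2l => //.
    rewrite tuple_average_out//; apply: le_tuple_average => t.
      exact: (average_ge0 hcells).
    exact: average_le_max.
  apply: IH.
  - case: ex => i; have [->|i0] := eqVneq i ord0; first by rewrite -!/(thead _) pq.
    case: (unliftP ord0 i) i0 => [j ->|->]; last by rewrite eqxx.
    by rewrite !tnth_lift0 => _ H; exists j.
  - exact: measurable_max_average_cons.
  - by move=> t; exact: max_average_ge0.
apply: lee_sum => k _; apply: lee_wpmul2l => //.
rewrite tuple_average_in//.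
rewrite -averageZ ?powR_ge0//; last 2 first.
- exact: (measurable_tuple_average_section k x' mf f0).
- by move=> y; exact: tuple_average_ge0.
apply: (le_average hcells) => y; first by rewrite mule_ge0// tuple_average_ge0.
exact: tuple_average_le_operator.
Qed.

End operators.
End tuples.

(** * Mixed-norm bounds for the dyadic operator *)

Section mixed_operator_bound.
Context (R : realType).
Local Open Scope ereal_scope.
Local Notation T := (measurableTypeR R).
Local Notation mu := (@lebesgue_measure R).

Section measurability.
Variables (cells : bool -> nat -> T -> R) (lam : nat -> R)
  (hcells : forall w, dyadic_filtration mu (cells w) lam) (m : nat).
Local Notation op := (mixed_operator cells lam m).

Section head_variable.
Context d (U : measurableType d) (n : nat) (f : U * Rn R n.+1 -> \bar R)
  (mf : measurable_fun setT f) (f0 : forall z, 0 <= f z).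

Lemma measurable_head_inner :
  measurable_fun setT (fun z : (U * T) * Rn R n => f (z.1.1, cons_tup (z.1.2, z.2))).
Proof.
apply: (@measurableT_comp _ _ _ _ _ _ f setT
  (fun z : (U * T) * Rn R n => (z.1.1, cons_tup (z.1.2, z.2))) mf).
apply: measurable_pair; first exact: (measurableT_comp measurable_fst measurable_fst).
apply: (@measurableT_comp _ _ _ _ _ _ (@cons_tup R n) setT
  (fun z : (U * T) * Rn R n => (z.1.2, z.2)) (measurable_cons_tup (n := n))).
apply: measurable_pair => //.
exact: (measurableT_comp measurable_snd measurable_fst).
Qed.

Lemma measurable_head_max : measurable_fun setT (fun z : (U * T) * Rn R n =>
  max_average mu cells lam m (fun y => f (z.1.1, cons_tup (y, z.2))) z.1.2).
Proof.
have mg : measurable_fun setT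
    (fun w : (U * Rn R n) * T => f (w.1.1, cons_tup (w.2, w.1.2))).
  apply: (@measurableT_comp _ _ _ _ _ _ _ setT
    (fun w : (U * Rn R n) * T => ((w.1.1, w.2), w.1.2)) measurable_head_inner).
  apply: measurable_pair; last exact: (measurableT_comp measurable_snd measurable_fst).
  apply: measurable_pair => //.
  exact: (measurableT_comp measurable_fst measurable_fst).
have mm := measurable_max_average_param hcells m mg (fun w => f0 _).
apply: (@measurableT_comp _ _ _ _ _ _ _ setT
  (fun z : (U * T) * Rn R n => ((z.1.1, z.2), z.1.2)) mm).
apply: measurable_pair; last exact: (measurableT_comp measurable_snd measurable_fst).
apply: measurable_pair => //.
exact: (measurableT_comp measurable_fst measurable_fst).
Qed.

End head_variable.

Lemma measurable_mixed_operator_param n (p q : n.-tuple R) d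
    (U : measurableType d) (f : U * Rn R n -> \bar R) :
  measurable_fun setT f -> (forall z, 0 <= f z) ->
  measurable_fun setT (fun z : U * Rn R n => op p q (fun t => f (z.1, t)) z.2).
Proof.
elim: n p q d U f => [p q d U f mf f0|n IH p q d U f mf f0] /=.
  by apply: (measurableT_comp mf); exact: measurable_pair.
have mb : measurable_fun setT
    (fun z : U * Rn R n.+1 => [tuple of behead z.2] : Rn R n).
  exact: (measurableT_comp (measurable_tail (n := n)) measurable_snd).
have mh : measurable_fun setT (fun z : U * Rn R n.+1 => thead z.2 : T).
  exact: (measurableT_comp (measurable_thead (n := n)) measurable_snd).
case: (thead p == thead q).
  have mo := IH [tuple of behead p] [tuple of behead q] _ _ _ (measurable_head_max mf f0)
    (fun z => max_average_ge0 _ _ _ _ _ _).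
  apply: (@measurableT_comp _ _ _ _ _ _ _ setT (fun z : U * Rn R n.+1 =>
    ((z.1, thead z.2 : T), [tuple of behead z.2] : Rn R n)) mo).
  apply: measurable_pair => //; exact: measurable_pair.
have mo := IH [tuple of behead p] [tuple of behead q] _ _ _ (measurable_head_inner mf)
    (fun z => f0 _).
have mo' : measurable_fun setT (fun w : (U * Rn R n) * T =>
    op [tuple of behead p] [tuple of behead q]
      (fun t => f (w.1.1, cons_tup (w.2, t))) w.1.2).
  apply: (@measurableT_comp _ _ _ _ _ _ _ setT
    (fun w : (U * Rn R n) * T => ((w.1.1, w.2), w.1.2)) mo).
  apply: measurable_pair; last exact: (measurableT_comp measurable_snd measurable_fst).
  apply: measurable_pair => //.
  exact: (measurableT_comp measurable_fst measurable_fst).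
have ms := measurable_frac_sum_param hcells m ((thead p)^-1 - (thead q)^-1) mo'
  (fun w => mixed_operator_ge0 hcells m _ _ _ (fun t => f0 _)).
apply: (@measurableT_comp _ _ _ _ _ _ _ setT (fun z : U * Rn R n.+1 =>
    ((z.1, [tuple of behead z.2] : Rn R n), thead z.2 : T)) ms).
apply: measurable_pair => //; exact: measurable_pair.
Qed.

End measurability.

Lemma mixed_operator_cons cells lam m n (p q : n.+1.-tuple R)
    (f : Rn R n.+1 -> \bar R) (x : T) (t : Rn R n) :
  mixed_operator cells lam m p q f (cons_tup (x, t)) =
  if thead p == thead q then
    mixed_operator cells lam m [tuple of behead p] [tuple of behead q]
      (fun t' => max_average mu cells lam m (fun y => f (cons_tup (y, t'))) x) t
  else frac_sum mu cells lam m ((thead p)^-1 - (thead q)^-1)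
      (fun y => mixed_operator cells lam m [tuple of behead p] [tuple of behead q]
        (fun t' => f (cons_tup (y, t'))) t) x.
Proof. by rewrite /= behead_cons_tup. Qed.

(** The head variable is absorbed in the inner norm, so that the induction runs
    over all good norms at once. If the head exponents agree, the maximal function
    in the head variable is bounded because the norm is good; otherwise the
    Hardy-Littlewood-Sobolev inequality applies to the scalar function of the
    norms. *)
Lemma mixed_operator_bounded n (p q : n.-tuple R) :
  (forall i, 1 < tnth p i /\ tnth p i <= tnth q i)%R ->
  forall d (U : measurableType d) (N : (U -> \bar R) -> \bar R), good_norm N ->
  exists C : R, (0 < C)%R /\
  forall cells lam, (forall w, dyadic_filtration mu (cells w) lam) ->
  forall m (f : U * Rn R n -> \bar R),
  measurable_fun setT f -> (forall z, 0 <= f z) ->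
  mixed_norm q (fun t => N (fun u => mixed_operator cells lam m p q (fun t' => f (u, t')) t))
  <= C%:E * mixed_norm p (fun t => N (fun u => f (u, t))).
Proof.
elim: n p q => [p q _ d U N gN|n IH p q hpq d U N gN].
  by exists 1%R; split => // cells lam hcells m f mf f0; rewrite mul1e.
have hN := good_function_norm gN.
have N0 h : 0 <= N h by exact: (fnorm_ge0 hN).
have [p1 pq1] := hpq ord0; rewrite -!/(thead _) in p1 pq1.
have q1 : (1 < thead q)%R by exact: lt_le_trans pq1.
have hpq' i : (1 < tnth [tuple of behead p] i /\
    tnth [tuple of behead p] i <= tnth [tuple of behead q] i)%R.
  by have := hpq (lift ord0 i); rewrite !tnth_lift0.
have q'0 i : (0 < tnth [tuple of behead q] i)%R.
  by case: (hpq' i) => a b; apply: lt_le_trans b; exact: lt_trans a.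
have p'1 i : (1 <= tnth [tuple of behead p] i)%R by case: (hpq' i) => /ltW.
have p'0 i : (0 < tnth [tuple of behead p] i)%R by exact: lt_le_trans (p'1 i).
have gN' : good_norm (iter_norm N mu (thead p)) by exact: good_norm_iter.
have [C [C0 HC]] := IH _ _ hpq' _ _ _ gN'.
have [D [D0 HD]] : exists D : R, (0 < D)%R /\
  forall cells lam, (forall w, dyadic_filtration mu (cells w) lam) ->
  forall m (h : U * T -> \bar R), measurable_fun setT h -> (forall z, 0 <= h z) ->
  Lnorm mu (thead q)%:E (fun x => N (fun u =>
    if thead p == thead q then max_average mu cells lam m (fun y => h (u, y)) x
    else frac_sum mu cells lam m ((thead p)^-1 - (thead q)^-1) (fun y => h (u, y)) x))
  <= D%:E * Lnorm mu (thead p)%:E (fun x => N (fun u => h (u, x))).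
  have [pq|pq] := eqVneq (thead p) (thead q).
    rewrite -pq; have [D [D0 HD]] := max_average_bounded hN p1 (good_maximal gN p1).
    by exists D; split => // cells lam hcells m h mh h0; exact: HD.
  have ltpq : (thead p < thead q)%R by rewrite lt_neqAle pq.
  have [D [D0 HD]] := frac_sum_bounded p1 ltpq.
  exists D; split => // cells lam hcells m h mh h0.
  apply: le_trans (HD _ _ _ _ _ hcells m _ _ _); last 2 first.
  - exact: (fnorm_measurable hN).
  - by move=> y; exact: N0.
  apply: le_Lnorm; first exact: lt_trans q1.
  move=> x; rewrite !gee0_abs//; first exact: (fnorm_frac_sum hcells m hN).
  by apply: (frac_sum_ge0 hcells) => y; exact: N0.
exists (C * D)%R; split; first exact: mulr_gt0.
move=> cells lam hcells m f mf f0.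
have mfi := measurable_head_inner mf.
have mN (t : Rn R n) : measurable_fun setT (fun z : U * T => f (z.1, cons_tup (z.2, t))).
  exact: (measurable_section1 t mfi).
have [pq|pq] := boolP (thead p == thead q).
  have pqE := eqP pq.
  have mhm := measurable_head_max hcells m mf f0.
  have H := HC cells lam hcells m _ mhm (fun z => max_average_ge0 _ _ _ _ _ _).
  rewrite (_ : mixed_norm q _ = mixed_norm [tuple of behead q] (fun t =>
      iter_norm N mu (thead p) (fun z => mixed_operator cells lam m
        [tuple of behead p] [tuple of behead q] (fun t' => max_average mu cells lam m
          (fun y => f (z.1, cons_tup (y, t'))) z.2) t))); last first.
    rewrite [LHS]/=; congr mixed_norm; apply/funext => t; rewrite /iter_norm -pqE.
    congr Lnorm; apply/funext => x; congr N; apply/funext => u.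
    by rewrite eqxx; congr mixed_operator; exact: val_inj.
  apply: le_trans H _; rewrite EFinM -muleA; apply: lee_wpmul2l; first by rewrite lee_fin ltW.
  rewrite /=; apply: le_trans; last apply: mixed_normZ_le => //.
  - apply: le_mixed_norm => // t; rewrite /iter_norm !gee0_abs ?Lnorm_ge0 ?mule_ge0 ?Lnorm_ge0 ?lee_fin ?(ltW D0)//.
    have := HD cells lam hcells m _ (mN t) (fun z => f0 _).
    by rewrite pq -pqE.
  - exact: ltW.
  - exact: (fnorm_measurable (good_function_norm gN') mfi).
  - by move=> t; exact: Lnorm_ge0.
have mo := measurable_mixed_operator_param hcells m [tuple of behead p] [tuple of behead q]
  mfi (fun z => f0 _).
have mop (t : Rn R n) : measurable_fun setT (fun z : U * T =>
    mixed_operator cells lam m [tuple of behead p] [tuple of behead q]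
      (fun t' => f (z.1, cons_tup (z.2, t'))) t).
  exact: (measurable_section1 t mo).
have mop0 (z : U * T) t : 0 <= mixed_operator cells lam m [tuple of behead p]
   [tuple of behead q] (fun t' => f (z.1, cons_tup (z.2, t'))) t.
  by apply: (mixed_operator_ge0 hcells) => y.
have H := HC cells lam hcells m _ mfi (fun z => f0 _).
rewrite mulrC EFinM -muleA.
have D0' : 0 <= D%:E by rewrite lee_fin ltW.
apply: le_trans (lee_wpmul2l D0' H).
apply: le_trans; last apply: mixed_normZ_le => //.
- apply: le_mixed_norm => // t; rewrite /iter_norm !gee0_abs ?Lnorm_ge0 ?mule_ge0 ?Lnorm_ge0//.
  have := HD cells lam hcells m _ (mop t) (fun z => mop0 z t).
  rewrite (negbTE pq); apply: le_trans; apply: le_Lnorm => [|x]; first exact: lt_trans q1.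
  rewrite !gee0_abs//; under [X in N X]funext do rewrite mixed_operator_cons (negbTE pq).
  exact: lexx.
- by move=> i; case: (hpq' i) => a; apply: le_trans; exact: ltW.
- exact: (fnorm_measurable (good_function_norm gN') mo (fun z => mop0 z.1 z.2)).
- by move=> t; exact: Lnorm_ge0.
Qed.

End mixed_operator_bound.

(** * Domination of the Riesz kernel by dyadic kernels *)

Section kernel_domination.
Context (R : realType).
Local Notation T := (measurableTypeR R).
Local Notation mu := (@lebesgue_measure R).

Lemma edist_ge0 n (x y : Rn R n) : 0 <= edist x y.
Proof. exact: sqrtr_ge0. Qed.

Lemma coord_le_edist n (x y : Rn R n) i : `|tnth x i - tnth y i| <= edist x y.
Proof.
rewrite -sqrtr_sqr ler_sqrt; last by apply: sumr_ge0 => j _; exact: sqr_ge0.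
by rewrite (bigD1 i)//= lerDl sumr_ge0// => j _; exact: sqr_ge0.
Qed.

Lemma edist0 n (x y : Rn R n) : edist x y = 0 -> x = y.
Proof.
move=> d0; apply: eq_from_tnth => i; apply/eqP; rewrite -subr_eq0 -normr_le0 -d0.
exact: coord_le_edist.
Qed.

(** In each variable, one of the two grids has a cell that contains both
    coordinates. *)
Lemma tuple_kernel_ge (eps : R) k n (x y : Rn R n) : 0 < eps -> (0 < k)%N ->
  (forall i, `|tnth x i - tnth y i| * 4 <= grid_length eps k) ->
  (((grid_length eps k)^-1 ^+ n)%:E <=
   tuple_kernel (grid_cell eps) (grid_length eps) k x y)%E.
Proof.
move=> e0 k0; have l0 : 0 < grid_length eps k by rewrite mulr_gt0 ?exprn_gt0.
have li : 0 <= (grid_length eps k)^-1 by rewrite invr_ge0 ltW.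
have hc w := dyadic_filtration_grid w e0.
elim: n x y => [|n IH] x y xy; first by rewrite expr0.
rewrite exprS EFinM; apply: lee_pmul => //.
- by rewrite lee_fin exprn_ge0.
- have [w E] := grids_cover e0 k0 (xy ord0).
  rewrite -!/(thead _) in E.
  have ck v := cell_kernel_ge0 (hc v) k (thead x) (thead y).
  have : ((grid_length eps k)^-1%:E <=
      cell_kernel (grid_cell eps w) (grid_length eps) k (thead x) (thead y))%E.
    by rewrite /cell_kernel E eqxx.
  by case: w {E} => H; apply: le_trans H _; [rewrite leeDl|rewrite leeDr].
- by apply: (IH [tuple of behead x] [tuple of behead y]) => i; rewrite -!tnth_lift0.
Qed.

(** Between the smallest and the largest scale, the Riesz kernel is carried by
    the one scale that is comparable with the distance. *)
Lemma riesz_kernel_le (eps gam : R) m n (x y : Rn R n) : 0 < eps -> gam <= n%:R ->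
  eps < edist x y * 4 -> edist x y * 4 <= grid_length eps m ->
  ((edist x y `^ (gam - n%:R))%:E <= (8 `^ (n%:R - gam))%:E *
   \sum_(k < m.+1) ((grid_length eps k `^ gam)%:E *
     tuple_kernel (grid_cell eps) (grid_length eps) k x y))%E.
Proof.
move=> e0 gn d1 d2.
have l0 k : 0 < grid_length eps k by rewrite mulr_gt0 ?exprn_gt0.
have hc w := dyadic_filtration_grid w e0.
have ex : exists k, edist x y * 4 <= grid_length eps k by exists m.
case: (ex_minnP ex) => k dk kmin.
have k0 : (0 < k)%N.
  by case: k dk kmin => // + _; rewrite /grid_length expr0 mulr1 leNgt d1.
have km : (k < m.+1)%N by rewrite ltnS kmin.
have dk' : grid_length eps k < edist x y * 8.
  have : grid_length eps k.-1 < edist x y * 4.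
    by rewrite ltNge; apply/negP => /kmin; rewrite leqNgt prednK// leqnn.
  by rewrite -[in X in _ -> X](prednK k0) /grid_length exprS; lra.
have d0 : 0 < edist x y by lra.
have tk0 j : (0 <= (grid_length eps j `^ gam)%:E *
     tuple_kernel (grid_cell eps) (grid_length eps) j x y)%E.
  by rewrite mule_ge0 ?lee_fin ?powR_ge0// (tuple_kernel_ge0 hc).
apply: (@le_trans _ _ ((8 `^ (n%:R - gam))%:E * ((grid_length eps k `^ gam)%:E *
     tuple_kernel (grid_cell eps) (grid_length eps) k x y))%E); last first.
  apply: lee_wpmul2l; first by rewrite lee_fin powR_ge0.
  by rewrite (bigD1 (Ordinal km))//= leeDl// sume_ge0.
apply: (@le_trans _ _ (8 `^ (n%:R - gam) *
    (grid_length eps k `^ gam * (grid_length eps k)^-1 ^+ n))%:E); last first.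
  rewrite !EFinM; apply: lee_wpmul2l; first by rewrite lee_fin powR_ge0.
  apply: lee_wpmul2l; first by rewrite lee_fin powR_ge0.
  apply: tuple_kernel_ge => // i; apply: le_trans dk.
  by rewrite ler_wpM2r// coord_le_edist.
rewrite lee_fin.
have -> : grid_length eps k `^ gam * (grid_length eps k)^-1 ^+ n =
   (grid_length eps k `^ (n%:R - gam))^-1.
  rewrite -powRN opprB powRD ?(gt_eqF (l0 k)) ?implybT//; congr (_ * _).
  by rewrite powRN powR_mulrn ?(ltW (l0 k))// exprVn.
have -> : edist x y `^ (gam - n%:R) = (edist x y `^ (n%:R - gam))^-1.
  by rewrite -powRN opprB.
have s0 : 0 <= n%:R - gam by rewrite subr_ge0.
rewrite ler_pdivlMr ?powR_gt0// mulrC ler_pdivrMr ?powR_gt0//.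
rewrite -powRM ?(ltW d0)//; apply: ge0_ler_powR => //; rewrite ?nnegrE.
- exact: ltW.
- by rewrite mulr_ge0 ?ltW.
- by rewrite mulrC ltW.
Qed.

End kernel_domination.

(** * Monotone limits of mixed norms *)

Section monotone_limits.
Context (R : realType).
Local Open Scope ereal_scope.
Local Notation T := (measurableTypeR R).
Local Notation mu := (@lebesgue_measure R).

(** Powers are increasing bijections, so they commute with suprema. *)
Lemma cvg_poweR (r : R) (u : nat -> \bar R) (l : \bar R) : (0 < r)%R ->
  (forall j, 0 <= u j) -> {homo u : i j / (i <= j)%N >-> i <= j} ->
  u j @[j --> \oo] --> l -> u j `^ r @[j --> \oo] --> l `^ r.
Proof.
move=> r0 u0 du ul.
have dv : {homo (fun j => u j `^ r) : i j / (i <= j)%N >-> i <= j}.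
  by move=> i j /du ij; apply: ge0_le_poweR => //; exact: ltW.
have := ereal_nondecreasing_cvgn dv; set S := ereal_sup _.
have lE : l = ereal_sup (range u).
  exact: (cvg_unique _ ul (ereal_nondecreasing_cvgn du)).
suff -> : S = l `^ r by [].
have leS j : u j `^ r <= S by apply: ereal_sup_ubound; exists j.
have lel j : u j <= l by rewrite lE; apply: ereal_sup_ubound; exists j.
have S0 : 0 <= S by exact: le_trans (poweR_ge0 _ _) (leS 0%N).
have l0 : 0 <= l by exact: le_trans (u0 0%N) (lel 0%N).
apply/eqP; rewrite eq_le; apply/andP; split.
  by apply: ge_ereal_sup => _ [j _ <-]; apply: ge0_le_poweR => //; exact: ltW.
rewrite -(@poweRVK _ r S) ?gt_eqF//; apply: ge0_le_poweR => //; first exact: ltW.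
rewrite lE; apply: ge_ereal_sup => _ [j _ <-].
rewrite -(@poweRK _ r (u j)) ?gt_eqF//; apply: ge0_le_poweR => //.
  by rewrite invr_ge0 ltW.
exact: poweR_ge0.
Qed.

Lemma cvg_integral d (V : measurableType d) (nu : {measure set V -> \bar R})
    (f : nat -> V -> \bar R) (g : V -> \bar R) :
  (forall j, measurable_fun setT (f j)) -> (forall j x, 0 <= f j x) ->
  (forall x, {homo f^~ x : i j / (i <= j)%N >-> i <= j}) ->
  (forall x, f j x @[j --> \oo] --> g x) ->
  \int[nu]_x f j x @[j --> \oo] --> \int[nu]_x g x.
Proof.
move=> mf f0 df fg.
rewrite (eq_integral (fun x => limn (f^~ x))); last first.
  by move=> x _; rewrite (cvg_lim _ (fg x)).
exact: cvg_monotone_convergence.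
Qed.

Lemma cvg_Lnorm d (V : measurableType d) (nu : {measure set V -> \bar R})
    (r : R) (f : nat -> V -> \bar R) (g : V -> \bar R) : (0 < r)%R ->
  (forall j, measurable_fun setT (f j)) -> (forall j x, 0 <= f j x) ->
  (forall x, {homo f^~ x : i j / (i <= j)%N >-> i <= j}) ->
  (forall x, f j x @[j --> \oo] --> g x) ->
  Lnorm nu r%:E (f j) @[j --> \oo] --> Lnorm nu r%:E g.
Proof.
move=> r0 mf f0 df fg.
have df' x : {homo (fun j => `|f j x| `^ r) : i j / (i <= j)%N >-> i <= j}.
  move=> i j /(df x) ij; apply: ge0_le_poweR => //; first exact: ltW.
  by rewrite !gee0_abs.
have mf' j : measurable_fun setT (fun x => `|f j x| `^ r).
  by apply: measurable_fun_poweR; exact: measurableT_comp.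
rewrite unlock; apply: cvg_poweR; first by rewrite invr_gt0.
- by move=> j; apply: integral_ge0 => x _; exact: poweR_ge0.
- move=> i j ij; apply: le_integralT => x; first exact: poweR_ge0.
  exact: df'.
- apply: cvg_integral => // [j x|x]; first exact: poweR_ge0.
  apply: cvg_poweR => // [i j /(df x)|]; first by rewrite !gee0_abs.
  exact: cvg_abse.
Qed.

Lemma cvg_mixed_norm n (p : n.-tuple R) (f : nat -> Rn R n -> \bar R)
    (g : Rn R n -> \bar R) : (forall i, 0 < tnth p i)%R ->
  (forall j, measurable_fun setT (f j)) -> (forall j x, 0 <= f j x) ->
  (forall x, {homo f^~ x : i j / (i <= j)%N >-> i <= j}) ->
  (forall x, f j x @[j --> \oo] --> g x) ->
  mixed_norm p (f j) @[j --> \oo] --> mixed_norm p g.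
Proof.
elim: n p f g => [p f g _ mf f0 df fg|n IH p f g p0 mf f0 df fg] /=.
  exact: cvg_abse.
have p00 : (0 < thead p)%R by exact: p0.
apply: IH => //.
- by move=> i; rewrite tnth_behead.
- by move=> j; exact: measurable_Lnorm_cons.
- by move=> j t; exact: Lnorm_ge0.
- move=> t i j ij; apply: le_Lnorm => // x; rewrite !gee0_abs//; exact: df.
- move=> t; apply: cvg_Lnorm => //.
  + by move=> j; exact: (measurable_section1 t (measurable_cons_section (mf j))).
Qed.

End monotone_limits.

(** * Riesz potentials *)

Section riesz.
Context (R : realType).
Local Notation T := (measurableTypeR R).
Local Notation mu := (@lebesgue_measure R).

Lemma measurable_edist n : measurable_fun setT (fun z : Rn R n * Rn R n => edist z.1 z.2).
Proof.
apply: (@measurableT_comp _ _ _ _ _ _ (@Num.sqrt R)).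
  by apply: continuous_measurable_fun; exact: sqrt_continuous.
apply: measurable_sum => i; apply: measurable_funX; apply: measurable_funB.
  exact: (measurableT_comp (measurable_tnth i) measurable_fst).
exact: (measurableT_comp (measurable_tnth i) measurable_snd).
Qed.

Definition riesz_potential n (gam : R) (f : Rn R n -> \bar R) (x : Rn R n) : \bar R :=
  (\int[lebesgue_tuple R n]_y ((edist x y `^ (gam - n%:R))%:E * f y))%E.

(** The kernel at the distances seen by the grid of mesh [2 ^ - j] with
    [2 j + 1] ranks. *)
Definition riesz_cut n (gam : R) j (x y : Rn R n) : R :=
  if 2 ^- j < edist x y * 4 <= 2 ^+ j then edist x y `^ (gam - n%:R) else 0.

Lemma riesz_cut_ge0 n gam j (x y : Rn R n) : 0 <= riesz_cut gam j x y.
Proof. by rewrite /riesz_cut; case: ifP => // _; exact: powR_ge0. Qed.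

Lemma measurable_riesz_cut n gam j :
  measurable_fun setT (fun z : Rn R n * Rn R n => riesz_cut gam j z.1 z.2).
Proof.
have me := @measurable_edist n.
have me4 : measurable_fun setT (fun z : Rn R n * Rn R n => edist z.1 z.2 * 4).
  exact: measurable_funM.
apply: measurable_fun_ifT => //.
  apply: measurable_and; [exact: measurable_fun_ltr|exact: measurable_fun_ler].
exact: (measurableT_comp (measurable_powR _) me).
Qed.

Lemma riesz_cut_nondecreasing n gam (x y : Rn R n) :
  {homo (fun j => riesz_cut gam j x y) : i j / (i <= j)%N >-> i <= j}.
Proof.
move=> i j ij; rewrite /riesz_cut; case: ifPn => [/andP[a b]|_].
  rewrite ifT//; apply/andP; split; last by apply: le_trans b _; rewrite ler_eXn2l// ltr1n.
  by apply: le_lt_trans a; rewrite lef_pV2 ?posrE ?exprn_gt0// ler_eXn2l// ltr1n.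
by case: ifP => // _; exact: powR_ge0.
Qed.

Lemma riesz_cut_near n gam (x y : Rn R n) : gam != n%:R ->
  \forall j \near \oo, riesz_cut gam j x y = edist x y `^ (gam - n%:R).
Proof.
move=> gn; have [d0|d0] := eqVneq (edist x y) 0.
  near=> j; rewrite /riesz_cut d0 mul0r ltNge invr_ge0 exprn_ge0//=.
  by rewrite powR0// subr_eq0.
have dp : 0 < edist x y by rewrite lt_neqAle eq_sym d0 edist_ge0.
near=> j; rewrite /riesz_cut ifT//; apply/andP; split.
  rewrite invf_plt ?posrE ?exprn_gt0 ?mulr_gt0//.
  by apply: upper_nthrootP; near: j; exact: nbhs_infty_ge.
by apply/ltW/upper_nthrootP; near: j; exact: nbhs_infty_ge.
Unshelve. all: by end_near. Qed.

Lemma riesz_cut_le n (gam : R) j (x y : Rn R n) : gam <= n%:R ->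
  ((riesz_cut gam j x y)%:E <= (8 `^ (n%:R - gam))%:E *
   \sum_(k < (j + j).+1) ((grid_length (2 ^- j) k `^ gam)%:E *
     tuple_kernel (grid_cell (2 ^- j)) (grid_length (2 ^- j)) k x y))%E.
Proof.
move=> gn; have e0 : 0 < 2 ^- j :> R by rewrite invr_gt0 exprn_gt0.
rewrite /riesz_cut; case: ifPn => [/andP[a b]|_].
  apply: riesz_kernel_le => //.
  by rewrite /grid_length exprD mulrA mulVf ?mul1r// expf_neq0.
rewrite mule_ge0 ?lee_fin ?powR_ge0// sume_ge0// => k _.
rewrite mule_ge0 ?lee_fin ?powR_ge0//.
exact: (tuple_kernel_ge0 (fun w => dyadic_filtration_grid w e0)).
Qed.

Definition riesz_cut_potential n gam j (f : Rn R n -> \bar R) (x : Rn R n) : \bar R :=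
  (\int[lebesgue_tuple R n]_y ((riesz_cut gam j x y)%:E * f y))%E.

Lemma measurable_riesz_cut_integrand n gam j (f : Rn R n -> \bar R) :
  measurable_fun setT f ->
  measurable_fun setT (fun z : Rn R n * Rn R n => (riesz_cut gam j z.1 z.2)%:E * f z.2)%E.
Proof.
move=> mf; apply: emeasurable_funM.
  by apply/measurable_EFinP; exact: measurable_riesz_cut.
exact: measurableT_comp.
Qed.

Lemma measurable_riesz_cut_potential n gam j (f : Rn R n -> \bar R) :
  measurable_fun setT f -> (forall x, 0 <= f x)%E ->
  measurable_fun setT (riesz_cut_potential gam j f).
Proof.
move=> mf f0; apply: (measurable_fun_fubini_tonelli_F (m2 := lebesgue_tuple R n)
  (fun z : Rn R n * Rn R n => (riesz_cut gam j z.1 z.2)%:E * f z.2)%E).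
  exact: measurable_riesz_cut_integrand.
by move=> z; rewrite mule_ge0// lee_fin riesz_cut_ge0.
Qed.

Lemma riesz_cut_potential_cvg n gam (f : Rn R n -> \bar R) x : gam != n%:R ->
  measurable_fun setT f -> (forall x, 0 <= f x)%E ->
  riesz_cut_potential gam j f x @[j --> \oo] --> riesz_potential gam f x.
Proof.
move=> gn mf f0; apply: cvg_integral.
- by move=> j; exact: (measurable_section2 x (measurable_riesz_cut_integrand gam j mf)).
- by move=> j y; rewrite mule_ge0// lee_fin riesz_cut_ge0.
- move=> y i j ij; apply: lee_wpmul2r => //.
  by rewrite lee_fin riesz_cut_nondecreasing.
- move=> y; apply: cvg_near_cst; have := riesz_cut_near x y gn.
  by apply: filterS => j ->.
Qed.

Lemma riesz_cut_potential_le n (p q : n.-tuple R) j (f : Rn R n -> \bar R) x :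
  (exists i, tnth p i <> tnth q i) ->
  let gam := \sum_(i < n) ((tnth p i)^-1 - (tnth q i)^-1) in gam <= n%:R ->
  measurable_fun setT f -> (forall x, 0 <= f x)%E ->
  (riesz_cut_potential gam j f x <= (8 `^ (n%:R - gam))%:E *
   mixed_operator (grid_cell (2 ^- j)) (grid_length (2 ^- j)) (j + j).+1 p q f x)%E.
Proof.
move=> ex gam gn mf f0; have e0 : 0 < 2 ^- j :> R by rewrite invr_gt0 exprn_gt0.
have hc w := dyadic_filtration_grid w e0.
have tk0 k (y : Rn R n) := tuple_kernel_ge0 hc k x y.
have lp k : (0 <= (grid_length (2 ^- j) k `^ gam)%:E :> \bar R)%E by rewrite lee_fin powR_ge0.
have l8 : (0 <= (8 `^ (n%:R - gam))%:E :> \bar R)%E by rewrite lee_fin powR_ge0.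
have mt k : measurable_fun setT (fun y : Rn R n =>
    tuple_kernel (grid_cell (2 ^- j)) (grid_length (2 ^- j)) k x y * f y)%E.
  apply: emeasurable_funM => //.
  exact: (measurable_section2 x (measurable_tuple_kernel hc k (n := n))).
apply: (@le_trans _ _ (\int[lebesgue_tuple R n]_y ((8 `^ (n%:R - gam))%:E *
   \sum_(k < (j + j).+1) ((grid_length (2 ^- j) k `^ gam)%:E *
     (tuple_kernel (grid_cell (2 ^- j)) (grid_length (2 ^- j)) k x y * f y))))%E).
  apply: le_integralT => y; first by rewrite mule_ge0// lee_fin riesz_cut_ge0.
  apply: le_trans (lee_wpmul2r (f0 y) (riesz_cut_le j x y gn)) _.
  rewrite -muleA; apply: lee_wpmul2l => //.
  rewrite ge0_sume_distrl; last by move=> k _; rewrite mule_ge0.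
  by under eq_bigr do rewrite -muleA.
rewrite ge0_integralZl//; last 2 first.
- by apply: emeasurable_sum => k; exact: measurable_funeM.
- by move=> y _; apply: sume_ge0 => k _; rewrite !mule_ge0.
apply: lee_wpmul2l => //; rewrite ge0_integral_sum//; last 2 first.
- by move=> k; exact: measurable_funeM.
- by move=> k y _; rewrite !mule_ge0.
apply: le_trans (sum_tuple_average_le_operator hc _ _ ex mf f0).
apply: lee_sum => k _; rewrite ge0_integralZl// => y _; by rewrite mule_ge0.
Qed.

(** The Hardy-Littlewood-Sobolev inequality in mixed norms. The truncated
    potentials are dominated by the dyadic operator of mesh [2 ^ - j], with bounds
    that do not depend on [j]. *)
Theorem riesz_potential_bounded n (p q : n.-tuple R) :
  (forall i, 1 < tnth p i /\ tnth p i <= tnth q i) ->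
  (exists i, tnth p i <> tnth q i) ->
  let gam := \sum_(i < n) ((tnth p i)^-1 - (tnth q i)^-1) in
  exists C : R, 0 < C /\ forall f : Rn R n -> \bar R,
  measurable_fun setT f -> (forall x, 0 <= f x)%E ->
  (mixed_norm q (riesz_potential gam f) <= C%:E * mixed_norm p f)%E.
Proof.
move=> hpq ex gam.
have p0 i : 0 < tnth p i by case: (hpq i) => a _; exact: lt_trans a.
have p1 i : 1 <= tnth p i by case: (hpq i) => /ltW.
have q0 i : 0 < tnth q i by case: (hpq i) => _; exact: lt_le_trans.
have q1 i : 1 <= tnth q i by case: (hpq i) => _; exact: le_trans.
have gn : gam < n%:R.
  case: ex => i0 _; rewrite -[n in n%:R]card_ord -sumr_const; apply: ltr_sum => [|i _].
    by apply/hasP; exists i0 => //; rewrite mem_index_enum.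
  rewrite ltrBlDr; apply: (@le_lt_trans _ _ 1); first by rewrite invf_le1.
  by rewrite ltrDl invr_gt0.
have [C [C0 HC]] := mixed_operator_bounded hpq (good_norm_unit R).
have l8 : 0 <= 8 `^ (n%:R - gam) by rewrite powR_ge0.
exists (8 `^ (n%:R - gam) * C); split; first by rewrite mulr_gt0 ?powR_gt0.
move=> f mf f0.
have F0 j x : (0 <= riesz_cut_potential gam j f x)%E.
  by apply: integral_ge0 => y _; rewrite mule_ge0// lee_fin riesz_cut_ge0.
have cv : mixed_norm q (riesz_cut_potential gam j f) @[j --> \oo] -->
    mixed_norm q (riesz_potential gam f).
  apply: cvg_mixed_norm => //.
  - by move=> j; exact: measurable_riesz_cut_potential.
  - move=> x i j ij; apply: le_integralT => y.
      by rewrite mule_ge0// lee_fin riesz_cut_ge0.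
    by apply: lee_wpmul2r => //; rewrite lee_fin riesz_cut_nondecreasing.
  - by move=> x; apply: riesz_cut_potential_cvg => //; rewrite lt_eqF.
apply: cvge_le cv; apply: nearW => j.
have e0 : 0 < 2 ^- j :> R by rewrite invr_gt0 exprn_gt0.
have hc w := dyadic_filtration_grid w e0.
have := HC _ _ hc (j + j).+1 (fun z : unit * Rn R n => f z.2)
  (measurableT_comp mf measurable_snd) (fun z => f0 z.2).
set op := mixed_operator _ _ _ _ _.
have op0 x : (0 <= op f x)%E by exact: mixed_operator_ge0.
rewrite (_ : (fun t => `|f (tt, t).2|)%E = f); last first.
  by apply/funext => t; rewrite gee0_abs.
rewrite (_ : (fun t => `|op (fun t' => f (tt, t').2) t|)%E = op f); last first.
  by apply/funext => t; rewrite gee0_abs.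
move=> H; rewrite EFinM -muleA; apply: le_trans (lee_wpmul2l _ H); last by rewrite lee_fin.
have mop : measurable_fun setT (op f).
  exact: (measurable_section2 tt (measurable_mixed_operator_param hc (j + j).+1 p q
    (measurableT_comp mf measurable_snd) (fun z : unit * Rn R n => f0 z.2))).
apply: le_trans (mixed_normZ_le q1 l8 mop op0).
apply: le_mixed_norm => // x.
rewrite !gee0_abs// ?mule_ge0//; exact: (riesz_cut_potential_le _ _ ex (ltW gn)).
Qed.

End riesz.

(** * Mixed norms and null sets *)

Section null_sets.
Context (R : realType).
Local Open Scope ereal_scope.
Local Notation T := (measurableTypeR R).
Local Notation mu := (@lebesgue_measure R).

Lemma measurable_section_tuple n (Z : set (Rn R n.+1)) (t : Rn R n) :
  measurable Z -> measurable [set x : T | Z (cons_tup (x, t))].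
Proof.
move=> mZ; rewrite -[X in measurable X]setTI.
have : measurable_fun setT (fun x : T => cons_tup (x, t)).
  apply: (@measurableT_comp _ _ _ _ _ _ (@cons_tup R n) setT (fun x : T => (x, t))
    (measurable_cons_tup (n := n))).
  exact: measurable_pair.
exact.
Qed.

Lemma null_sections n (Z : set (Rn R n.+1)) :
  measurable Z -> lebesgue_tuple R n.+1 Z = 0 ->
  exists Z' : set (Rn R n), [/\ measurable Z', lebesgue_tuple R n Z' = 0 &
    forall t, ~ Z' t -> mu [set x : T | Z (cons_tup (x, t))] = 0].
Proof.
move=> mZ Z0; have mi : measurable_fun setT (fun x => (\1_Z x)%:E : \bar R).
  by apply/measurable_EFinP; exact: measurable_indic.
have i0 x : 0 <= (\1_Z x)%:E :> \bar R by rewrite lee_fin.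
pose phi t := \int[mu]_x (\1_Z (cons_tup (x, t)))%:E.
have mphi : measurable_fun setT phi.
  exact: (measurable_fun_fubini_tonelli_G (m1 := mu) _ (measurable_cons_section mi)).
have phi0 t : 0 <= phi t by apply: integral_ge0 => x _; exact: i0.
have iphi : \int[lebesgue_tuple R n]_t phi t = 0.
  transitivity (\int[lebesgue_tuple R n.+1]_x (\1_Z x)%:E).
    by rewrite (integral_lebesgue_tupleS mi i0).
  by rewrite integral_indic// setIT.
have mZ' : measurable [set t | phi t != 0].
  rewrite (_ : [set t | _] = ~` (phi @^-1` [set 0])); last first.
    by apply/seteqP; split => t /= /eqP.
  by apply: measurableC; rewrite -[X in measurable X]setTI; exact: mphi.
exists [set t | phi t != 0]; split => //.
- apply: measure_negligible => //.
  have /(ae_eq_integral_abs (lebesgue_tuple R n) measurableT mphi) :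
      \int[lebesgue_tuple R n]_t `|phi t| = 0.
    by rewrite -[RHS]iphi; apply: eq_integral => t _; rewrite gee0_abs.
  by apply: negligibleS => t /= /eqP H; apply/not_implyP; split.
- move=> t /negP; rewrite negbK => /eqP.
  rewrite /phi (_ : (fun x => _) = (fun x => (\1_[set x : T | Z (cons_tup (x, t))] x)%:E)).
    by rewrite integral_indic ?setIT//; exact: measurable_section_tuple.
  by [].
Qed.

Lemma le_Lnorm_null d (V : measurableType d) (nu : {measure set V -> \bar R})
    (r : R) (f g : V -> \bar R) (Z : set V) : (0 < r)%R ->
  measurable_fun setT g -> measurable Z -> nu Z = 0 ->
  (forall x, ~ Z x -> `|f x| <= `|g x|) ->
  Lnorm nu r%:E f <= Lnorm nu r%:E g.
Proof.
move=> r0 mg mZ Z0 fg.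
pose h x := if x \in Z then +oo else g x.
have mh : measurable_fun setT h.
  apply: measurable_fun_ifT => //; apply: (measurable_fun_bool true).
  rewrite setTI (_ : _ @^-1` _ = Z)//.
  by apply/seteqP; split => x /= Zx; [exact: set_mem|exact: mem_set].
apply: (@le_trans _ _ (Lnorm nu r%:E h)).
  apply: le_Lnorm => // x; rewrite /h; case: ifPn => [_|/negP xZ]; first by rewrite leey.
  by apply: fg => Zx; apply: xZ; rewrite inE.
rewrite unlock le_eqVlt; apply/orP; left; apply/eqP; congr (_ `^ _).
apply: ae_eq_integral => //.
- by apply: measurable_fun_poweR; exact: measurableT_comp.
- by apply: measurable_fun_poweR; exact: measurableT_comp.
exists Z; split => // x /= H; apply: contrapT => xZ; apply: H => _.
by rewrite /h memNset.
Qed.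

(** Mixed norms do not see null sets, because almost every section of a null
    set is null. *)
Lemma le_mixed_norm_null n (p : n.-tuple R) (f g : Rn R n -> \bar R) (Z : set (Rn R n)) :
  (forall i, 0 < tnth p i)%R ->
  measurable_fun setT g -> (forall x, 0 <= g x) ->
  measurable Z -> lebesgue_tuple R n Z = 0 ->
  (forall x, ~ Z x -> `|f x| <= g x) -> mixed_norm p f <= mixed_norm p g.
Proof.
elim: n p f g Z => [p f g Z _ _ g0 mZ Z0 fg|n IH p f g Z p0 mg g0 mZ Z0 fg] /=.
  rewrite (gee0_abs (g0 _)); apply: fg => Zx.
  by move: Z0; rewrite /= diracE mem_set// => /eqP; rewrite onee_eq0.
have [Z' [mZ' Z'0 sec]] := null_sections mZ Z0.
apply: (IH _ _ _ Z') => //.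
- by move=> i; rewrite tnth_behead.
- exact: measurable_Lnorm_cons.
- by move=> t; exact: Lnorm_ge0.
- move=> t /sec nZ; rewrite gee0_abs ?Lnorm_ge0//.
  apply: (@le_Lnorm_null _ _ _ _ _ _ [set x | Z (cons_tup (x, t))]) => //.
  + exact: p0.
  + exact: (measurable_section1 t (measurable_cons_section mg)).
  + exact: measurable_section_tuple.
  + by move=> x /fg; rewrite (gee0_abs (g0 _)).
Qed.

End null_sets.

(** * Boundedness of the commutator of a Lipschitz function *)

Section commutator_upper_bound.
Context (R : realType) (n : nat).
Local Notation nu := (lebesgue_tuple R n).

Lemma measurable_riesz_kernel (gam : R) :
  measurable_fun setT (fun z : Rn R n * Rn R n => edist z.1 z.2 `^ (gam - n%:R)).
Proof. exact: (measurableT_comp (measurable_powR _) (@measurable_edist R n)). Qed.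

Let measurable_riesz_section (gam : R) x :
  measurable_fun setT (fun y : Rn R n => edist x y `^ (gam - n%:R)).
Proof.
exact: (measurableT_comp (measurable_riesz_kernel gam) (pair1_measurable x)).
Qed.

Lemma measurable_riesz_potential (gam : R) (f : Rn R n -> \bar R) :
  measurable_fun setT f -> (forall x, 0 <= f x)%E ->
  measurable_fun setT (riesz_potential gam f).
Proof.
move=> mf f0; apply: (measurable_fun_fubini_tonelli_F (m2 := nu)
  (fun z : Rn R n * Rn R n => (edist z.1 z.2 `^ (gam - n%:R))%:E * f z.2)%E).
  apply: emeasurable_funM; last exact: measurableT_comp.
  by apply/measurable_EFinP; exact: measurable_riesz_kernel.
by move=> z; rewrite mule_ge0// lee_fin powR_ge0.
Qed.

Lemma riesz_potential_ge0 (gam : R) (f : Rn R n -> \bar R) x :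
  (forall x, 0 <= f x)%E -> (0 <= riesz_potential gam f x)%E.
Proof. by move=> f0; apply: integral_ge0 => y _; rewrite mule_ge0// lee_fin powR_ge0. Qed.

Lemma measurable_commutator_integrand (alpha : R) (b f : Rn R n -> R) x :
  measurable_fun setT b -> measurable_fun setT f ->
  measurable_fun setT (fun y => (b x - b y) * f y / edist x y `^ (n%:R - alpha)).
Proof.
move=> mb mf.
rewrite (_ : (fun _ => _) = (fun y => (b x - b y) * f y * edist x y `^ (alpha - n%:R))).
  apply: measurable_funM; last exact: measurable_riesz_section.
  by apply: measurable_funM => //; exact: measurable_funB.
by apply/funext => y; rewrite -powRN opprB.
Qed.

(** The factor [b x - b y] gains the power [beta] of the distance. *)
Lemma commutator_le_riesz (alpha beta C : R) (b g f : Rn R n -> R)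
    (Z : set (Rn R n)) x :
  0 <= C -> beta != 0 -> measurable_fun setT b -> measurable_fun setT f ->
  (forall x y, `|g x - g y| <= C * edist x y `^ beta) ->
  measurable Z -> nu Z = 0%E -> (forall x, ~ Z x -> b x = g x) -> ~ Z x ->
  (`|commutator b alpha f x| <=
   C%:E * riesz_potential (alpha + beta) (fun y => `|f y|%:E) x)%E.
Proof.
move=> C0 b0 mb mf hg mZ Z0 bg Zx.
have mi := measurable_commutator_integrand alpha x mb mf.
have mk : measurable_fun setT (fun y => (edist x y `^ (alpha + beta - n%:R))%:E *
    `|f y|%:E)%E.
  apply: emeasurable_funM.
    by apply/measurable_EFinP; exact: measurable_riesz_section.
  by apply/measurable_EFinP; exact: measurableT_comp.
apply: le_trans (le_abse_integral _ _ _) _ => //; first exact/measurable_EFinP.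
rewrite /riesz_potential -ge0_integralZl//; last first.
  by move=> y _; rewrite mule_ge0 ?lee_fin ?powR_ge0.
apply: ae_ge0_le_integral => //.
- by apply: measurableT_comp => //; exact/measurable_EFinP.
- by move=> y _; rewrite !mule_ge0 ?lee_fin ?powR_ge0.
- exact: measurable_funeM.
exists Z; split => // y /= H; apply: contrapT => Zy; apply: H => _.
rewrite lee_fin (bg _ Zx) (bg _ Zy) !normrM normfV (ger0_norm (powR_ge0 _ _)).
have [d0|d0] := eqVneq (edist x y) 0.
  by rewrite (edist0 d0) subrr normr0 !mul0r !mulr_ge0// powR_ge0.
have dp : 0 < edist x y by rewrite lt_neqAle eq_sym d0 edist_ge0.
rewrite -powRN opprB mulrAC mulrA ler_wpM2r//.
apply: le_trans (ler_wpM2r (powR_ge0 _ _) (hg x y)) _.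
by rewrite -mulrA -powRD ?d0 ?implybT// addrA (addrC beta).
Qed.

Theorem commutator_bounded (alpha beta : R) (p q : n.-tuple R) (b : Rn R n -> R) :
  (forall i, 1 < tnth p i /\ tnth p i <= tnth q i) ->
  (exists i, tnth p i <> tnth q i) -> beta != 0 ->
  alpha + beta = \sum_(i < n) (tnth p i)^-1 - \sum_(i < n) (tnth q i)^-1 ->
  measurable_fun setT b -> in_lipschitz beta b ->
  mixed_bounded p q (commutator b alpha).
Proof.
move=> hpq ex b0 hsum mb [g [C hC] [Z [mZ Z0 sZ]]].
have q0 i : 0 < tnth q i.
  by case: (hpq i) => a; apply: lt_le_trans; exact: lt_trans a.
have p1 i : 1 <= tnth p i by case: (hpq i) => /ltW.
have q1 i : 1 <= tnth q i by case: (hpq i) => _; exact: le_trans.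
have bg x : ~ Z x -> b x = g x by move=> Zx; apply: contrapT => H; apply: Zx; exact: sZ.
pose C' := Num.max C 0.
have C'0 : 0 <= C' by rewrite le_max lexx orbT.
have hC' x y : `|g x - g y| <= C' * edist x y `^ beta.
  apply: le_trans (hC x y) _; rewrite ler_wpM2r ?powR_ge0//.
  by rewrite le_max lexx.
have [D [D0 HD]] := riesz_potential_bounded hpq ex.
rewrite sumrB -hsum in HD.
exists (C' * D) => f [mf _].
have maf : measurable_fun setT (fun y => `|f y|%:E).
  by apply/measurable_EFinP; exact: measurableT_comp.
have af0 y : (0 <= `|f y|%:E :> \bar R)%E by rewrite lee_fin.
have mr := measurable_riesz_potential (alpha + beta) maf af0.
have r0 x := riesz_potential_ge0 (alpha + beta) x af0.
apply: (@le_trans _ _ (mixed_norm q (fun x =>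
    C'%:E * riesz_potential (alpha + beta) (fun y => `|f y|%:E) x)%E)).
  apply: (le_mixed_norm_null (Z := Z)) => //.
  - exact: measurable_funeM.
  - by move=> x; rewrite mule_ge0.
  - by move=> x; exact: commutator_le_riesz.
apply: le_trans (mixed_normZ_le q1 C'0 mr r0) _.
rewrite EFinM -muleA; apply: lee_wpmul2l => //.
apply: le_trans (HD _ maf af0) _; apply: lee_wpmul2l; first by rewrite lee_fin ltW.
apply: le_mixed_norm => [i|x /=]; last by rewrite normr_id.
exact: lt_le_trans (p1 i).
Qed.

End commutator_upper_bound.

(** * Cubes *)

Section cubes.
Context (R : realType).
Local Notation T := (measurableTypeR R).
Local Notation mu := (@lebesgue_measure R).

(** A ball of the sup norm, of side [2 * r]: membership is symmetric in the centre
    and the point, and the indicator is a product over the coordinates. *)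
Definition cube n (z : Rn R n) (r : R) : set (Rn R n) :=
  [set x | forall i, `|tnth x i - tnth z i| <= r].

Lemma indic_cubeE n (z x : Rn R n) r :
  \1_(cube z r) x = \prod_(i < n) (`|tnth x i - tnth z i| <= r)%R%:R :> R.
Proof.
rewrite indicE; have [xz|xz] := boolP (x \in cube z r).
  by rewrite big1// => i _; move: xz; rewrite inE => ->.
have /existsNP[i Hi] : ~ cube z r x by move=> H; rewrite mem_set in xz.
by rewrite (bigD1 i)//=; move/negP/negbTE : Hi => ->; rewrite mul0r.
Qed.

Lemma indic_cube_cons n (z : Rn R n.+1) r (x : T) (t : Rn R n) :
  \1_(cube z r) (cons_tup (x, t)) =
  (`|x - thead z| <= r)%R%:R * \1_(cube [tuple of behead z] r) t :> R.
Proof.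
rewrite !indic_cubeE big_ord_recl; congr (_ * _); apply: eq_bigr => i _.
by rewrite !tnth_lift0 behead_cons_tup.
Qed.

Lemma measurable_indic_cube2 n r :
  measurable_fun setT (fun z : Rn R n * Rn R n => \1_(cube z.1 r) z.2 : R).
Proof.
under eq_fun do rewrite indic_cubeE.
apply: measurable_prod => i _.
have mb : measurable_fun setT
    (fun z : Rn R n * Rn R n => `|tnth z.2 i - tnth z.1 i| <= r).
  apply: measurable_fun_ler => //; apply: measurableT_comp => //.
  apply: measurable_funB.
    exact: (measurableT_comp (measurable_tnth i) measurable_snd).
  exact: (measurableT_comp (measurable_tnth i) measurable_fst).
rewrite (_ : (fun _ => _) = (fun z : Rn R n * Rn R n =>
    if `|tnth z.2 i - tnth z.1 i| <= r then 1 else 0 : R)).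
  exact: measurable_fun_ifT.
by apply/funext => z; case: (_ <= _).
Qed.

Lemma measurable_indic_cube n (z : Rn R n) r :
  measurable_fun setT (\1_(cube z r) : Rn R n -> R).
Proof. exact: (measurableT_comp (measurable_indic_cube2 r) (pair1_measurable z)). Qed.

Lemma measurable_cube n (z : Rn R n) r : measurable (cube z r).
Proof.
have := measurable_indic_cube z r measurableT (measurable_set1 (1 : R)).
rewrite setTI; congr measurable; apply/seteqP; split => x /=; rewrite indicE.
  by have [|_ /eqP] := boolP (x \in _); rewrite ?inE// eq_sym oner_eq0.
by move=> xz; rewrite mem_set.
Qed.

Lemma cubeC n (x z : Rn R n) r : \1_(cube z r) x = \1_(cube x r) z :> R.
Proof. by rewrite !indic_cubeE; apply: eq_bigr => i _; rewrite distrC. Qed.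

Lemma cube_subset n (x z : Rn R n) r s :
  (forall i, `|tnth x i - tnth z i| <= s - r) -> cube x r `<=` cube z s.
Proof.
move=> xz y yx i; have := ler_distD (tnth x i) (tnth y i) (tnth z i).
by have := xz i; have := yx i; lra.
Qed.

Lemma measurable_indic_interval (a r : R) :
  measurable_fun setT (fun x : T => ((`|x - a| <= r)%R%:R)%:E : \bar R).
Proof.
apply/measurable_EFinP; rewrite (_ : (fun _ => _) = (fun x : T =>
    if `|x - a| <= r then 1 else 0 : R)); last by apply/funext => x; case: (_ <= _).
apply: measurable_fun_ifT => //; apply: measurable_fun_ler => //.
by apply: measurableT_comp => //; exact: measurable_funB.
Qed.

Lemma integral_interval (a r : R) : 0 <= r ->
  (\int[mu]_(x in setT) ((`|x - a| <= r)%R%:R)%:E = (2 * r)%:E)%E.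
Proof.
move=> r0; transitivity (\int[mu]_x (\1_(`[a - r, a + r]%classic : set T) x)%:E)%E.
  apply: eq_integral => x _; rewrite indicE; congr (_%:R%:E); congr nat_of_bool.
  rewrite mem_setE in_itv/= ler_distlC; lra.
rewrite integral_indic// setIT /= lebesgue_measure_itv/= lte_fin.
case: ltP => H; first by rewrite -EFinD; congr (_%:E); lra.
by congr (_%:E); lra.
Qed.

Lemma integral_cube n (z : Rn R n) r : 0 <= r ->
  (\int[lebesgue_tuple R n]_x (\1_(cube z r) x)%:E = ((2 * r) ^+ n)%:E)%E.
Proof.
move=> r0; have mi m (w : Rn R m) : measurable_fun setT (fun x => (\1_(cube w r) x)%:E : \bar R).
  by apply/measurable_EFinP; exact: measurable_indic_cube.
elim: n z => [z|n IH z].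
  by rewrite integral_lebesgue_tuple0// indic_cubeE big_ord0 expr0.
rewrite (integral_lebesgue_tupleS (mi _ _))//.
transitivity (\int[lebesgue_tuple R n]_t
    ((2 * r)%:E * (\1_(cube [tuple of behead z] r) t)%:E))%E.
  apply: eq_integral => t _; rewrite -(integral_interval (thead z) r0) -ge0_integralZr//.
  - by apply: eq_integral => x _; rewrite indic_cube_cons.
  - exact: measurable_indic_interval.
by rewrite ge0_integralZl ?IH ?exprS//; [exact: mi|rewrite lee_fin mulr_ge0].
Qed.

(** The indicator is a product of functions of one variable, so each norm yields
    one factor. *)
Lemma mixed_norm_cube_le n (p : n.-tuple R) (z : Rn R n) r : 0 < r ->
  (forall i, 1 <= tnth p i) ->
  (mixed_norm p (fun x => (\1_(cube z r) x)%:E) <=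
   ((2 * r) `^ (\sum_(i < n) (tnth p i)^-1))%:E)%E.
Proof.
move=> r0; elim: n p z => [p z _|n IH p z p1] /=.
  by rewrite big_ord0 powRr0 lee_fin indic_cubeE big_ord0 normr1.
have p10 : 1 <= thead p by exact: p1.
have p00 : 0 < thead p by exact: lt_le_trans p10.
have l0 : 0 < 2 * r by rewrite mulr_gt0.
rewrite (_ : (fun t => _) = (fun t : Rn R n => ((2 * r) `^ (thead p)^-1)%:E *
    (\1_(cube [tuple of behead z] r) t)%:E)%E); last first.
  apply/funext => t; rewrite ge0_Lnorm; last by move=> x; rewrite lee_fin.
  have powb (c : bool) (s : R) : 0 < s -> ((c%:R)%:E `^ s = (c%:R)%:E :> \bar R)%E.
    by move=> s0; case: c; rewrite poweR_EFin ?mulr1n ?mulr0n ?powR1// powR0// gt_eqF.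
  rewrite (eq_integral (fun x : T => ((`|x - thead z| <= r)%R%:R)%:E *
      (\1_(cube [tuple of behead z] r) t)%:E)%E); last first.
    by move=> x _; rewrite indic_cube_cons indicE -EFinM -natrM mulnb powb.
  rewrite ge0_integralZr//; last exact: measurable_indic_interval.
  rewrite integral_interval ?(ltW r0)// poweRM ?lee_fin ?(ltW l0)//.
  by rewrite poweR_EFin indicE powb// invr_gt0.
have p1' i : 1 <= tnth [tuple of behead p] i by rewrite tnth_behead.
have mi : measurable_fun setT (fun x => (\1_(cube [tuple of behead z] r) x)%:E : \bar R).
  by apply/measurable_EFinP; exact: measurable_indic_cube.
apply: le_trans (mixed_normZ_le p1' (powR_ge0 _ _) mi _) _ => //.
rewrite big_ord_recl powRD ?(gt_eqF l0) ?implybT// EFinM; apply: lee_wpmul2l.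
  by rewrite lee_fin powR_ge0.
apply: le_trans (IH _ _ p1') _; rewrite lee_fin.
by under [X in _ <= _ `^ X]eq_bigr do rewrite tnth_lift0.
Qed.

(** Jensen's inequality for the uniform probability on the interval. *)
Lemma integral_interval_le (q a r : R) (h : T -> \bar R) : 0 < r -> 1 <= q ->
  measurable_fun setT h -> (forall x, 0 <= h x)%E ->
  (\int[mu]_x (((`|x - a| <= r)%R%:R)%:E * h x) <=
   ((2 * r) `^ (1 - q^-1))%:E * Lnorm mu q%:E h)%E.
Proof.
move=> r0 q1 mh h0; have q0 : 0 < q by exact: lt_le_trans q1.
have l0 : 0 < 2 * r by rewrite mulr_gt0.
have mi := measurable_indic_interval a r.
pose w (x : T) := ((2 * r)^-1%:E * ((`|x - a| <= r)%R%:R)%:E : \bar R)%E.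
have mw : measurable_fun setT w by exact: measurable_funeM.
have li0 : (0 <= (2 * r)^-1%:E :> \bar R)%E by rewrite lee_fin invr_ge0 ltW.
have w0 x : (0 <= w x)%E by rewrite mule_ge0// lee_fin.
have w1 : (\int[mu]_x w x <= 1)%E.
  rewrite ge0_integralZl// ?integral_interval ?(ltW r0)//.
    by rewrite -EFinM mulVf ?gt_eqF.
have J := jensen_poweR q1 mw mh w0 h0 w1.
have I0 : (0 <= \int[mu]_x (h x `^ q))%E by apply: integral_ge0 => x _; exact: poweR_ge0.
have A0 : (0 <= \int[mu]_x (h x * w x))%E by apply: integral_ge0 => x _; rewrite mule_ge0.
have -> : (\int[mu]_x (((`|x - a| <= r)%R%:R)%:E * h x) =
    (2 * r)%:E * \int[mu]_x (h x * w x))%E.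
  rewrite -ge0_integralZl//; last 3 first.
  - exact: emeasurable_funM.
  - by move=> x _; rewrite mule_ge0.
  - by rewrite lee_fin ltW.
  apply: eq_integral => x _; rewrite /w (muleC (h x)) !muleA -EFinM.
  by rewrite mulfV ?gt_eqF// mul1r.
rewrite ge0_Lnorm//; apply: (le_poweR_root q0).
- by rewrite mule_ge0// lee_fin ltW.
- by rewrite mule_ge0 ?poweR_ge0// lee_fin powR_ge0.
rewrite !poweRM ?lee_fin ?powR_ge0 ?poweR_ge0 ?(ltW l0)// poweRVK ?gt_eqF//.
rewrite !poweR_EFin -powRrM mulrBl mul1r mulVf ?gt_eqF//.
rewrite powRD ?(gt_eqF l0) ?implybT// EFinM -muleA; apply: lee_wpmul2l.
  by rewrite lee_fin powR_ge0.
rewrite powRN powRr1 ?(ltW l0)//; apply: le_trans J _.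
rewrite -ge0_integralZl//; last 2 first.
- exact: measurable_fun_poweR.
- by move=> x _; exact: poweR_ge0.
apply: le_integralT => x; first by rewrite mule_ge0 ?poweR_ge0.
rewrite muleC; apply: lee_wpmul2r; first exact: poweR_ge0.
by rewrite /w -EFinM lee_fin ler_piMr ?invr_ge0 ?(ltW l0)// lern1 leq_b1.
Qed.

(** The one-variable inequality is applied to the norms of the sections. *)
Lemma integral_cube_le n (q : n.-tuple R) (z : Rn R n) r (h : Rn R n -> \bar R) :
  0 < r -> (forall i, 1 <= tnth q i) ->
  measurable_fun setT h -> (forall x, 0 <= h x)%E ->
  (\int[lebesgue_tuple R n]_x ((\1_(cube z r) x)%:E * h x) <=
   ((2 * r) `^ (\sum_(i < n) (1 - (tnth q i)^-1)))%:E * mixed_norm q h)%E.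
Proof.
move=> r0; have l0 : 0 < 2 * r by rewrite mulr_gt0.
have mi m (w : Rn R m) : measurable_fun setT (fun x => (\1_(cube w r) x)%:E : \bar R).
  by apply/measurable_EFinP; exact: measurable_indic_cube.
elim: n q z h => [q z h _ mh h0|n IH q z h q1 mh h0].
  rewrite big_ord0 powRr0 mul1e integral_lebesgue_tuple0; last by apply: emeasurable_funM; [exact: mi|].
  by rewrite indic_cubeE big_ord0 mul1e /= gee0_abs.
have q10 : 1 <= thead q by exact: q1.
have q1' i : 1 <= tnth [tuple of behead q] i by rewrite tnth_behead.
have mht t : measurable_fun setT (fun x : T => h (cons_tup (x, t))).
  exact: (measurable_section1 t (measurable_cons_section mh)).
rewrite integral_lebesgue_tupleS; last 2 first.
- by apply: emeasurable_funM; [exact: mi|].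
- by move=> x; rewrite mule_ge0// lee_fin.
have mL := measurable_Lnorm_cons (thead q) mh h0.
apply: (@le_trans _ _ (\int[lebesgue_tuple R n]_t
    ((\1_(cube [tuple of behead z] r) t)%:E *
     (((2 * r) `^ (1 - (thead q)^-1))%:E *
      Lnorm mu (thead q)%:E (fun x => h (cons_tup (x, t))))))%E).
  apply: le_integralT => t.
    by apply: integral_ge0 => x _; rewrite mule_ge0// lee_fin.
  apply: le_trans (lee_wpmul2l _ (integral_interval_le (thead z) r0 q10 (mht t) _)) => //.
  rewrite -ge0_integralZl//.
  - apply: le_integralT => x; first by rewrite mule_ge0// lee_fin.
    by rewrite indic_cube_cons muleA -EFinM mulrC.
  - by apply: emeasurable_funM => //; exact: measurable_indic_interval.
  - by move=> x _; rewrite mule_ge0// lee_fin.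
apply: le_trans (IH _ _ _ q1' _ _) _.
- exact: measurable_funeM.
- by move=> t; rewrite mule_ge0 ?Lnorm_ge0// lee_fin powR_ge0.
have -> : (2 * r) `^ (\sum_(i < n.+1) (1 - (tnth q i)^-1)) =
    (2 * r) `^ (\sum_(i < n) (1 - (tnth [tuple of behead q] i)^-1)) *
    (2 * r) `^ (1 - (thead q)^-1).
  have H (s u : R) : (2 * r) `^ (s + u) = (2 * r) `^ s * (2 * r) `^ u.
    by rewrite powRD// (gt_eqF l0) implybT.
  rewrite big_ord_recl H mulrC; congr (_ `^ _ * _).
  by apply: eq_bigr => i _; rewrite tnth_lift0.
rewrite EFinM -muleA.
apply: lee_wpmul2l; first by rewrite lee_fin powR_ge0.
apply: mixed_normZ_le => //; first exact: powR_ge0.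
by move=> t; exact: Lnorm_ge0.
Qed.

End cubes.

(** * Mean oscillation and the commutator *)

Section oscillation.
Context (R : realType) (n : nat).
Local Notation nu := (lebesgue_tuple R n).
Implicit Types (z x y : Rn R n) (b : Rn R n -> R).

Lemma edist_le_sup x y (r : R) : 0 <= r ->
  (forall i, `|tnth x i - tnth y i| <= r) -> edist x y <= n%:R * r.
Proof.
move=> r0 xy; rewrite -[leRHS]ger0_norm ?mulr_ge0// -sqrtr_sqr ler_wsqrtr//.
apply: (@le_trans _ _ (\sum_(i < n) r ^+ 2)).
  by apply: ler_sum => i _; rewrite -real_normK ?num_real// lerXn2r ?nnegrE.
rewrite sumr_const card_ord -[leLHS]mulr_natl exprMn ler_wpM2r ?sqr_ge0//.
by rewrite -natrX ler_nat; case: (n) => // k; rewrite expnS leq_pmulr ?expn_gt0.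
Qed.

Lemma measurable_edist_ball (a : Rn R n) (r : R) : measurable [set x | edist x a <= r].
Proof.
have me : measurable_fun setT (fun x => edist x a).
  exact: (measurableT_comp (@measurable_edist R n) (pair2_measurable a)).
rewrite (_ : [set x | _] = setT `&` (fun x => edist x a) @^-1` `]-oo, r]).
  exact: me.
by rewrite setTI; apply/seteqP; split => x /=; rewrite in_itv.
Qed.

Lemma integrable_indic_cube z (r : R) : 0 <= r ->
  nu.-integrable setT (fun x => (\1_(cube z r) x)%:E).
Proof.
move=> r0; apply/integrableP; split.
  by apply/measurable_EFinP; exact: measurable_indic_cube.
rewrite (eq_integral (fun x => (\1_(cube z r) x)%:E)); last first.
  by move=> x _; rewrite gee0_abs// lee_fin.
by rewrite integral_cube// ltry.
Qed.

Lemma integrable_cube b z (r : R) : 0 <= r -> loc_integrable b ->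
  nu.-integrable setT (fun x => (\1_(cube z r) x * b x)%:E).
Proof.
move=> r0 [mb ib]; have mQ := measurable_cube z r.
rewrite (_ : (fun _ => _) = (EFin \o b) \_ (cube z r)); last first.
  by rewrite epatch_indic; apply/funext => x /=; rewrite mulrC EFinM.
apply/(integrable_mkcond _ mQ).
apply: (integrableS (measurable_edist_ball z (n%:R * r)) mQ _ (ib z _)).
by move=> x xz /=; exact: edist_le_sup.
Qed.

Definition cube_mean b z (r : R) : R :=
  fine (\int[nu]_x (\1_(cube z r) x * b x)%:E)%E / (2 * r) ^+ n.

Lemma integral_sub_const b z (r t : R) : 0 < r -> loc_integrable b ->
  (\int[nu]_x (\1_(cube z r) x * (b x - t))%:E =
   ((2 * r) ^+ n * (cube_mean b z r - t))%:E)%E.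
Proof.
move=> r0 hb; have r0' := ltW r0; have ib := integrable_cube z r0' hb.
have i1 := integrable_indic_cube z r0'.
have l0 : (2 * r) ^+ n != 0 by rewrite expf_neq0// mulf_neq0// gt_eqF.
rewrite (eq_integral (fun x => (\1_(cube z r) x * b x)%:E -
    t%:E * (\1_(cube z r) x)%:E)%E); last first.
  by move=> x _; rewrite -EFinM -EFinB; congr (_%:E); ring.
rewrite integralB//; last exact: integrableZl.
rewrite integralZl// integral_cube// -(fineK (integrable_fin_num measurableT ib)).
rewrite -EFinM -EFinB; congr (_%:E).
by rewrite mulrBr /cube_mean mulrCA mulfV// mulr1 (mulrC t).
Qed.

Lemma integrable_cube_sub b z (r t : R) : 0 <= r -> loc_integrable b ->
  nu.-integrable setT (fun x => (\1_(cube z r) x * (b x - t))%:E).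
Proof.
move=> r0 hb; have ib := integrable_cube z r0 hb.
have i1 := integrable_indic_cube z r0.
rewrite (_ : (fun _ => _) = (fun x => (\1_(cube z r) x * b x)%:E -
    t%:E * (\1_(cube z r) x)%:E)%E); last first.
  by apply/funext => x; rewrite -EFinM -EFinB; congr (_%:E); ring.
by apply: integrableB => //; exact: integrableZl.
Qed.

Section mean_oscillation.
Variables (b : Rn R n -> R) (z : Rn R n) (r : R).
Hypotheses (hb : loc_integrable b) (r0 : 0 < r).
Local Notation Q := (cube z r).
Local Notation t := (cube_mean b z r).

Let e x : R := \1_Q x * Num.max (b x - t) 0.
Let a x : R := \1_Q x * Num.max (t - b x) 0.
Let F x : R := \1_Q x * (b x <= t)%R%:R.
Let G x : R := \1_Q x * (t < b x)%R%:R.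

Let mb : measurable_fun setT b. Proof. by case: hb. Qed.
Let mQ : measurable_fun setT (\1_Q : Rn R n -> R). Proof. exact: measurable_indic_cube. Qed.

Let me : measurable_fun setT e.
Proof. by apply: measurable_funM => //; apply: measurable_maxr => //; exact: measurable_funB. Qed.

Let ma : measurable_fun setT a.
Proof. by apply: measurable_funM => //; apply: measurable_maxr => //; exact: measurable_funB. Qed.

Let mF : measurable_fun setT F.
Proof.
apply: measurable_funM => //.
rewrite (_ : (fun _ => _) = (fun x => if b x <= t then 1 else 0 : R)).
  by apply: measurable_fun_ifT => //; exact: measurable_fun_ler.
by apply/funext => x; case: (_ <= _).
Qed.

Let mG : measurable_fun setT G.
Proof.
apply: measurable_funM => //.
rewrite (_ : (fun _ => _) = (fun x => if t < b x then 1 else 0 : R)).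
  by apply: measurable_fun_ifT => //; exact: measurable_fun_ltr.
by apply/funext => x; case: (_ < _).
Qed.

Let e0 x : 0 <= e x. Proof. by rewrite mulr_ge0// le_max lexx orbT. Qed.
Let a0 x : 0 <= a x. Proof. by rewrite mulr_ge0// le_max lexx orbT. Qed.
Let F0 x : 0 <= F x. Proof. by rewrite mulr_ge0. Qed.
Let G0 x : 0 <= G x. Proof. by rewrite mulr_ge0. Qed.

Let ie : nu.-integrable setT (fun x => (e x)%:E).
Proof.
apply: le_integrable (integrable_cube_sub z t (ltW r0) hb) => //.
  exact/measurable_EFinP.
move=> x _; rewrite !abse_EFin lee_fin !normrM ler_wpM2l//.
rewrite (ger0_norm (x := Num.max _ _)) ?le_max ?lexx ?orbT//.
by rewrite ge_max ler_norm normr_ge0.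
Qed.

Let ia : nu.-integrable setT (fun x => (a x)%:E).
Proof.
apply: le_integrable (integrable_cube_sub z t (ltW r0) hb) => //.
  exact/measurable_EFinP.
move=> x _; rewrite !abse_EFin lee_fin !normrM ler_wpM2l//.
rewrite (ger0_norm (x := Num.max _ _)) ?le_max ?lexx ?orbT//.
by rewrite distrC ge_max ler_norm normr_ge0.
Qed.

Let D := fine (\int[nu]_x (e x)%:E)%E.

Let iD : (\int[nu]_x (e x)%:E)%E = D%:E.
Proof. by rewrite fineK// (integrable_fin_num measurableT ie). Qed.

Let iDa : (\int[nu]_x (a x)%:E)%E = D%:E.
Proof.
have := integral_sub_const z t r0 hb; rewrite subrr mulr0.
rewrite (eq_integral (fun x => (e x)%:E - (a x)%:E)%E); last first.
  move=> x _; rewrite -EFinB; congr (_%:E); rewrite /e /a -mulrBr; congr (_ * _).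
  by case: (leP (b x - t) 0) => H; case: (leP (t - b x) 0) => H'; lra.
rewrite integralB// iD -(fineK (integrable_fin_num measurableT ia)) -EFinB.
by case=> /eqP; rewrite subr_eq0 => /eqP ->.
Qed.

Let D0 : 0 <= D.
Proof. by rewrite fine_ge0// integral_ge0// => x _; rewrite lee_fin. Qed.

(** On the part of the cube where [b] exceeds its mean the commutator acts on
    the indicator of the rest without cancellation. *)
Let commutator_lower_bound (alpha : R) x : alpha <= n%:R ->
  ((((n%:R * (2 * r)) `^ (n%:R - alpha))^-1 *
     (e x * fine (\int[nu]_y (F y)%:E) + G x * D))%:E <=
  `|commutator b alpha F x|)%E.
Proof.
move=> an; set c := (_ `^ _)^-1; set phi := fine _.
have c0 : 0 <= c by rewrite invr_ge0 powR_ge0.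
have iF : (\int[nu]_y (F y)%:E)%E = phi%:E.
  rewrite fineK// (integrable_fin_num measurableT)//.
  apply: le_integrable (integrable_indic_cube z (ltW r0)) => //.
    exact/measurable_EFinP.
  move=> y _; rewrite !gee0_abs ?lee_fin//.
  by rewrite ler_piMr// lern1 leq_b1.
have [Gx|Gx] := eqVneq (G x) 0.
  have -> : e x = 0.
    move: Gx; rewrite /G /e; case: ltP => [_|bt _].
      by rewrite mulr1 => ->; rewrite mul0r.
    by rewrite (max_idPr _) ?mulr0// subr_le0.
  by rewrite Gx !mul0r addr0 mulr0 abse_ge0.
have [Qx tb] : cube z r x /\ t < b x.
  move: Gx; rewrite /G indicE; have [xQ|] := boolP (x \in Q); last by rewrite mul0r eqxx.
  by rewrite mul1r; case: ltP => //; [rewrite inE in xQ|rewrite eqxx].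
have Gx1 : G x = 1 by rewrite /G indicE mem_set// tb mul1r.
apply: le_trans (lee_abs _).
have -> : ((c * (e x * phi + G x * D))%:E =
    \int[nu]_y (c%:E * ((e x)%:E * (F y)%:E + (a y)%:E)))%E.
  rewrite ge0_integralZl//; last 2 first.
  - apply: emeasurable_funD; last exact/measurable_EFinP.
    by apply: measurable_funeM; exact/measurable_EFinP.
  - by move=> y _; rewrite adde_ge0 ?mule_ge0 ?lee_fin.
  rewrite ge0_integralD//; last 4 first.
  - by move=> y _; rewrite mule_ge0 ?lee_fin.
  - by apply: measurable_funeM; exact/measurable_EFinP.
  - by move=> y _; rewrite lee_fin.
  - exact/measurable_EFinP.
  rewrite ge0_integralZl ?lee_fin//; last 2 first.
  - exact/measurable_EFinP.
  - by move=> y _; rewrite lee_fin.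
  by rewrite iDa iF Gx1 mul1r EFinM EFinD EFinM.
apply: le_integralT => y; first by rewrite mule_ge0 ?adde_ge0 ?mule_ge0 ?lee_fin.
rewrite -[X in (X <= _)%E]/((c * (e x * F y + a y))%:E) lee_fin.
have [Fy|Fy] := eqVneq (F y) 0.
  suff -> : a y = 0 by rewrite Fy !mulr0 mul0r addr0 mulr0.
  move: Fy; rewrite /F /a; case: leP => [_|bt _].
    by rewrite mulr1 => ->; rewrite mul0r.
  by rewrite (max_idPr _) ?mulr0// subr_le0 ltW.
have [Qy bt] : cube z r y /\ b y <= t.
  move: Fy; rewrite /F indicE; have [xQ|] := boolP (y \in Q); last by rewrite mul0r eqxx.
  by rewrite mul1r; case: leP => //; [rewrite inE in xQ|rewrite eqxx].
have Fy1 : F y = 1 by rewrite /F indicE mem_set// bt mul1r.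
have -> : e x = b x - t.
  by rewrite /e indicE mem_set// mul1r (max_idPl _)// subr_ge0 ltW.
have -> : a y = t - b y.
  by rewrite /a indicE mem_set// mul1r (max_idPl _)// subr_ge0.
rewrite Fy1 !mulr1 mulrC addrA subrK.
apply: ler_wpM2l; first by rewrite subr_ge0 (le_trans bt)// ltW.
have d0 : 0 < edist x y.
  rewrite lt_neqAle eq_sym edist_ge0 andbT; apply/eqP => /edist0 xy.
  by move: tb; rewrite xy ltNge bt.
rewrite /c lef_pV2 ?posrE ?powR_gt0//; last first.
  apply: lt_le_trans d0 _; apply: edist_le_sup => [|i]; first by rewrite mulr_ge0// ltW.
  have := ler_distD (tnth z i) (tnth x i) (tnth y i).
  by have := Qx i; have := Qy i; rewrite (distrC (tnth y i)); lra.
apply: ge0_ler_powR; rewrite ?nnegrE ?subr_ge0// ?edist_ge0//.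
  by rewrite !mulr_ge0// ltW.
apply: edist_le_sup => [|i]; first by rewrite mulr_ge0// ltW.
have := ler_distD (tnth z i) (tnth x i) (tnth y i).
by have := Qx i; have := Qy i; rewrite (distrC (tnth y i)); lra.
Qed.

(** Test the commutator on the indicator [F] of the part where [b] is at most its
    mean. On the remaining part, with indicator [G], the commutator is at least
    [e x * phi + G x * D] times a lower bound of the kernel on the cube, where
    [phi] is the integral of [F] and [D] that of the negative part [a] of
    [b - t]. As [t] is the mean, [D] is also the integral of the positive part
    [e]; so the integral of this lower bound over the cube is [D] times the
    measure of the whole cube, whatever the sizes of the two parts. The upper
    bound comes from the mixed norm of the indicator of the cube. *)
Lemma mean_oscillation_le (alpha C : R) (p q : n.-tuple R) :
  (0 < n)%N -> alpha <= n%:R -> 0 <= C ->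
  (forall i, 1 <= tnth p i) -> (forall i, 1 <= tnth q i) ->
  (forall f, mixed_Lebesgue p f ->
    (mixed_norm q (commutator b alpha f) <= C%:E * mixed_norm p (EFin \o f))%E) ->
  (\int[nu]_x (\1_Q x * `|b x - t|)%:E <= (2 * C * (n%:R * (2 * r)) `^ (n%:R - alpha) *
    (2 * r) `^ (\sum_(i < n) (tnth p i)^-1 - \sum_(i < n) (tnth q i)^-1))%:E)%E.
Proof.
move=> n0 an C0 p1 q1 hC; set sp := \sum_(i < n) (tnth p i)^-1.
set sq := \sum_(i < n) (tnth q i)^-1; set w := (_ `^ (n%:R - alpha)).
have l0 : 0 < 2 * r by rewrite mulr_gt0.
have ln0 : 0 < (2 * r) ^+ n by rewrite exprn_gt0.
have w0 : 0 < w by rewrite powR_gt0// mulr_gt0// ltr0n.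
have p0 i : 0 < tnth p i by exact: lt_le_trans ltr01 (p1 i).
have q0 i : 0 < tnth q i by exact: lt_le_trans ltr01 (q1 i).
have ind_le1 (c : bool) : c%:R <= 1 :> R by rewrite lern1 leq_b1.
have NF : (mixed_norm p (EFin \o F) <= ((2 * r) `^ sp)%:E)%E.
  apply: le_trans (mixed_norm_cube_le z r0 p1); apply: le_mixed_norm => // x /=.
  by rewrite lee_fin !ger0_norm// ler_piMr.
have FL : mixed_Lebesgue p F by split => //; exact: le_lt_trans NF (ltry _).
pose phi := fine (\int[nu]_y (F y)%:E)%E; pose psi := fine (\int[nu]_y (G y)%:E)%E.
have iF : (\int[nu]_y (F y)%:E)%E = phi%:E.
  rewrite fineK// (integrable_fin_num measurableT)//.
  apply: le_integrable (integrable_indic_cube z (ltW r0)) => //.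
    exact/measurable_EFinP.
  by move=> y _; rewrite !gee0_abs ?lee_fin// ler_piMr.
have iG : (\int[nu]_y (G y)%:E)%E = psi%:E.
  rewrite fineK// (integrable_fin_num measurableT)//.
  apply: le_integrable (integrable_indic_cube z (ltW r0)) => //.
    exact/measurable_EFinP.
  by move=> y _; rewrite !gee0_abs ?lee_fin// ler_piMr.
have phi0 : 0 <= phi by rewrite fine_ge0// integral_ge0// => x _; rewrite lee_fin.
have FG : phi + psi = (2 * r) ^+ n.
  apply: EFin_inj; rewrite EFinD -iF -iG -(integral_cube z (ltW r0)) -ge0_integralD//.
  - apply: eq_integral => x _; rewrite -EFinD; congr (_%:E).
    by rewrite /F /G -mulrDr; case: ltP => _; rewrite ?addr0 ?add0r mulr1.
  - by move=> x _; rewrite lee_fin.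
  - exact/measurable_EFinP.
  - by move=> x _; rewrite lee_fin.
  - exact/measurable_EFinP.
pose H x := (w^-1 * (e x * phi + G x * D))%:E : \bar R.
have H0 x : (0 <= H x)%E.
  by rewrite lee_fin mulr_ge0 ?invr_ge0 ?(ltW w0)// addr_ge0// mulr_ge0.
have mH : measurable_fun setT H.
  apply/measurable_EFinP; apply: measurable_funM => //.
  by apply: measurable_funD; exact: measurable_funM.
have NH : (mixed_norm q H <= (C * (2 * r) `^ sp)%:E)%E.
  apply: le_trans (le_mixed_norm (g := commutator b alpha F) q0 _) _ => [x|].
    by rewrite (gee0_abs (H0 x)); exact: commutator_lower_bound.
  apply: le_trans (hC _ FL) _; rewrite EFinM; apply: lee_wpmul2l => //.
have IH : (\int[nu]_x ((\1_Q x)%:E * H x) = (w^-1 * (D * (2 * r) ^+ n))%:E)%E.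
  transitivity (\int[nu]_x ((w^-1)%:E * (phi%:E * (e x)%:E + D%:E * (G x)%:E)))%E.
    apply: eq_integral => x _; rewrite /H -[RHS]/((w^-1 * (phi * e x + D * G x))%:E) -EFinM.
    congr (_%:E).
    by rewrite /e /G indicE; case: (x \in Q); rewrite ?mulr1n ?mulr0n; ring.
  have mpe : measurable_fun setT (fun x => phi%:E * (e x)%:E)%E.
    by apply: measurable_funeM; exact/measurable_EFinP.
  have mDG : measurable_fun setT (fun x => D%:E * (G x)%:E)%E.
    by apply: measurable_funeM; exact/measurable_EFinP.
  rewrite ge0_integralZl//; last 3 first.
  - exact: emeasurable_funD.
  - by move=> x _; rewrite adde_ge0// mule_ge0 ?lee_fin.
  - by rewrite lee_fin invr_ge0 ltW.
  rewrite ge0_integralD//; last 2 first.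
  - by move=> x _; rewrite mule_ge0 ?lee_fin.
  - by move=> x _; rewrite mule_ge0 ?lee_fin.
  rewrite !ge0_integralZl ?lee_fin//; last 4 first.
  - exact/measurable_EFinP.
  - by move=> x _; rewrite lee_fin.
  - exact/measurable_EFinP.
  - by move=> x _; rewrite lee_fin.
  rewrite iD iG -[LHS]/((w^-1 * (phi * D + D * psi))%:E); congr (_%:E).
  rewrite -FG; congr (_ * _); ring.
have Dle : D <= C * w * (2 * r) `^ (sp - sq).
  have := integral_cube_le z r0 q1 mH H0; rewrite IH => DH.
  have := le_trans DH (lee_wpmul2l _ NH); rewrite -EFinM !lee_fin powR_ge0 => /(_ isT).
  have -> : \sum_(i < n) (1 - (tnth q i)^-1) = n%:R - sq.
    by rewrite sumrB sumr_const card_ord.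
  rewrite powRB ?(gt_eqF l0) ?implybT// powR_mulrn ?(ltW l0)//.
  rewrite powRB ?(gt_eqF l0) ?implybT//.
  set ls := _ `^ sp; set lq := _ `^ sq => h.
  have lq0 : 0 < lq by rewrite powR_gt0.
  have : D * (2 * r) ^+ n <= (C * w * (ls / lq)) * (2 * r) ^+ n.
    rewrite -(ler_pM2l (x := w^-1)) ?invr_gt0//; apply: le_trans h _.
    rewrite le_eqVlt; apply/orP; left; apply/eqP; field.
    by rewrite !gt_eqF.
  by rewrite ler_pM2r.
rewrite (eq_integral (fun x => (e x)%:E + (a x)%:E)%E); last first.
  move=> x _; rewrite -EFinD; congr (_%:E); rewrite /e /a -mulrDr; congr (_ * _).
  have [H1|H1] := leP 0 (b x - t).
    by rewrite ger0_norm// (max_idPr _) ?addr0//; lra.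
  by rewrite ltr0_norm// (max_idPl _) ?add0r ?opprB//; lra.
rewrite ge0_integralD//; last 4 first.
- by move=> x _; rewrite lee_fin.
- exact/measurable_EFinP.
- by move=> x _; rewrite lee_fin.
- exact/measurable_EFinP.
by rewrite iD iDa -EFinD lee_fin; lra.
Qed.

End mean_oscillation.
End oscillation.

(** * Lipschitz functions and mean oscillation *)

Section campanato.
Context (R : realType) (n : nat).
Local Notation nu := (lebesgue_tuple R n).
Variables (b : Rn R n -> R) (K beta : R).
Hypotheses (hb : loc_integrable b) (K0 : 0 <= K) (beta0 : 0 < beta).
Hypothesis oscillation : forall z r, 0 < r ->
  (\int[nu]_x (\1_(cube z r) x * `|b x - cube_mean b z r|)%:E <=
   (K * r ^+ n * r `^ beta)%:E)%E.
Local Notation m := (cube_mean b).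

Let mb : measurable_fun setT b. Proof. by case: hb. Qed.

(** The two cubes have comparable measures, so the oscillation over the larger one
    controls the deviation of the mean over the smaller one. *)
Lemma cube_mean_compare x y r s : 0 < s -> s <= r -> r <= 2 * s ->
  cube x s `<=` cube y r -> `|m x s - m y r| <= K * r `^ beta.
Proof.
move=> s0 sr rs sub; have r0 : 0 < r by exact: lt_le_trans sr.
have l0 : 0 < (2 * s) ^+ n by rewrite exprn_gt0// mulr_gt0.
rewrite -(ler_pM2l (x := r ^+ n)) ?exprn_gt0//.
apply: (@le_trans _ _ ((2 * s) ^+ n * `|m x s - m y r|)).
  by rewrite ler_wpM2r// lerXn2r// nnegrE ltW// mulr_gt0.
rewrite mulrA (mulrC _ K) -lee_fin -[X in X * _]gtr0_norm// -normrM.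
apply: le_trans (oscillation y r0).
rewrite -abse_EFin -(integral_sub_const x (m y r) s0 hb).
have mi (f : Rn R n -> R) (w : Rn R n) (u : R) : measurable_fun setT f ->
    measurable_fun setT (fun x => (\1_(cube w u) x * f x)%:E : \bar R).
  move=> mf; apply/measurable_EFinP; apply: measurable_funM => //.
  exact: measurable_indic_cube.
apply: le_trans (le_abse_integral _ _ _) _ => //.
  by apply: mi; exact: measurable_funB.
apply: le_integralT => v; first exact: abse_ge0.
rewrite abse_EFin lee_fin normrM ler_wpM2r// ger0_norm// !indicE ler_nat.
by have [/set_mem/sub/mem_set ->|//] := boolP (v \in cube x s).
Qed.

Let A := K * geom beta.

Let half_lt1 : 2 `^ (- beta) < 1 :> R.
Proof.
by have := geom_gt0 beta0; rewrite invr_gt0 subr_gt0.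
Qed.

Let A0 : 0 <= A.
Proof. by rewrite mulr_ge0// ltW// geom_gt0. Qed.

(** Halve the radius until it is comparable with [s]; the successive differences
    are dominated by a geometric series. *)
Lemma cube_mean_chain x r s : 0 < s -> s <= r -> `|m x s - m x r| <= A * r `^ beta.
Proof.
move=> s0 sr.
have [N] : exists N, r <= 2 ^+ N * s.
  exists (Num.bound (r / s)); rewrite -ler_pdivrMr//.
  exact/ltW/upper_nthrootP.
elim: N r sr => [r sr|N IH r sr rN].
  rewrite expr0 mul1r => rs; have -> : r = s by apply/eqP; rewrite eq_le rs.
  by rewrite subrr normr0 mulr_ge0 ?powR_ge0.
have r0 : 0 < r by exact: lt_le_trans sr.
have sub u w : u <= w -> cube x u `<=` cube x w.
  by move=> uw; apply: cube_subset => i; rewrite subrr normr0 subr_ge0.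
have KA : K = A * (1 - 2 `^ (- beta)).
  by rewrite /A mulfVK// subr_eq0 gt_eqF.
have [rs|rs] := leP r (2 * s).
  apply: le_trans (cube_mean_compare s0 sr rs (sub _ _ sr)) _.
  rewrite ler_wpM2r ?powR_ge0// KA ler_piMr// lerBlDr lerDl powR_ge0//.
have h1 : `|m x s - m x (r / 2)| <= A * (r / 2) `^ beta.
  by apply: IH; [lra|rewrite exprS in rN; lra].
have h2 : `|m x (r / 2) - m x r| <= K * r `^ beta.
  by apply: cube_mean_compare; [lra|lra|lra|apply: sub; lra].
apply: le_trans (ler_distD (m x (r / 2)) _ _) _.
apply: le_trans (lerD h1 h2) _.
rewrite powRM ?(ltW r0)//.
rewrite -(powR_inv1 (a := 2))// -powRrM mulN1r KA.
by rewrite le_eqVlt; apply/orP; left; apply/eqP; ring.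
Qed.

(** The intervals of centre [m x r] and radius [A * r `^ beta] meet pairwise, by
    [cube_mean_chain]; the supremum of their left ends lies in all of them. *)
Definition mean_limit x : R := sup [set m x r - A * r `^ beta | r in [set r | 0 < r]].

Lemma mean_limit_close x r : 0 < r -> `|mean_limit x - m x r| <= A * r `^ beta.
Proof.
move=> r0; set S := [set m x r - A * r `^ beta | r in [set r | 0 < r]].
have powle u w : 0 < u -> u <= w -> A * u `^ beta <= A * w `^ beta.
  move=> u0 uw; rewrite ler_wpM2l// ge0_ler_powR ?nnegrE ?(ltW beta0) ?(ltW u0)//.
  exact: ltW (lt_le_trans u0 uw).
have up u w : 0 < u -> 0 < w -> m x u - A * u `^ beta <= m x w + A * w `^ beta.
  move=> u0 w0; have [uw|wu] := leP u w.
    have := cube_mean_chain x u0 uw; rewrite ler_distl => /andP[_ H].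
    have : 0 <= A * u `^ beta by rewrite mulr_ge0 ?powR_ge0.
    lra.
  have := cube_mean_chain x w0 (ltW wu); rewrite distrC ler_distl => /andP[_ H].
  have : 0 <= A * w `^ beta by rewrite mulr_ge0 ?powR_ge0.
  lra.
rewrite ler_distl; apply/andP; split.
  apply: ub_le_sup; last by exists r.
  by exists (m x r + A * r `^ beta) => _ [u u0 <-]; exact: up.
apply: ge_sup; first by exists (m x r - A * r `^ beta); exists r.
by move=> _ [u u0 <-]; exact: up.
Qed.

Let L := A + K * 2 `^ beta + A * 2 `^ beta.

(** The cube about [x] of radius [edist x y] lies in the cube about [y] of twice
    that radius. *)
Lemma mean_limit_lipschitz x y : `|mean_limit x - mean_limit y| <= L * edist x y `^ beta.
Proof.
have [d0|d0] := eqVneq (edist x y) 0.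
  rewrite (edist0 d0) subrr normr0 mulr_ge0 ?powR_ge0//.
  have h2 : 0 <= 2 `^ beta :> R by exact: powR_ge0.
  have hA : 0 <= A * 2 `^ beta by exact: mulr_ge0.
  have hK : 0 <= K * 2 `^ beta by exact: mulr_ge0.
  by rewrite /L !addr_ge0.
have dp : 0 < edist x y by rewrite lt_neqAle eq_sym d0 edist_ge0.
set d := edist x y in dp *.
have h1 := mean_limit_close x dp.
have d2 : 0 < 2 * d by rewrite mulr_gt0.
have h2 := mean_limit_close y d2.
have h3 : `|m x d - m y (2 * d)| <= K * (2 * d) `^ beta.
  apply: cube_mean_compare => //; first by lra.
  apply: cube_subset => i; apply: le_trans (coord_le_edist x y i) _.
  by rewrite -/d; lra.
rewrite powRM ?(ltW dp)// in h2 h3.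
move: h1 h2 h3; rewrite !ler_distl /L => /andP[a1 a2] /andP[b1 b2] /andP[c1 c2].
by apply/andP; split; lra.
Qed.

Let measurable_param_integral (H : Rn R n * Rn R n -> \bar R) :
  measurable_fun setT H ->
  measurable_fun setT (fun x => \int[nu]_y H (x, y))%E.
Proof.
move=> mH.
have mp := measurable_fun_fubini_tonelli_F (m2 := nu) _ (measurable_funepos mH)
  (funepos_ge0 H).
have mn := measurable_fun_fubini_tonelli_F (m2 := nu) _ (measurable_funeneg mH)
  (funeneg_ge0 H).
rewrite (_ : (fun x => _) =
    (fun x => fubini_F nu H^\+%E x - fubini_F nu H^\-%E x)%E); last first.
  apply/funext => x; rewrite integralE; congr (_ - _)%E.
    by apply: eq_integral => y _; rewrite !funeposE.
  by apply: eq_integral => y _; rewrite !funenegE.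
exact: emeasurable_funB.
Qed.

Let measurable_cube_mean r : measurable_fun setT (fun x => m x r).
Proof.
apply: measurable_funM => //; apply: (measurableT_comp (fine_measurable measurableT)).
apply: (measurable_param_integral
  (H := fun z : Rn R n * Rn R n => (\1_(cube z.1 r) z.2 * b z.2)%:E)).
apply/measurable_EFinP; apply: measurable_funM; first exact: measurable_indic_cube2.
exact: measurableT_comp.
Qed.

Let half_cvg (c : R) : c * (2 ^- k) `^ beta @[k --> \oo] --> (0 : R).
Proof.
rewrite (_ : (fun _ => _) = (fun k => c * (2 `^ (- beta)) ^+ k)); last first.
  apply/funext => k; congr (_ * _).
  by rewrite -powR_mulrn ?powR_ge0// -powRrM mulNr -mulrN mulrC powRrM -powR_mulrn// powRN.
rewrite -[X in _ --> X](mulr0 c); apply: cvgM; first exact: cvg_cst.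
by apply: cvg_expr; rewrite ger0_norm ?powR_ge0.
Qed.

Lemma measurable_mean_limit : measurable_fun setT mean_limit.
Proof.
apply: (@measurable_fun_cvg _ _ _ _ (fun k x => m x (2 ^- k))) => // x _.
apply/cvgrPdist_le => e e0; have := half_cvg A.
move/cvgr0Pnorm_le => /(_ e e0); apply: filterS => k H.
apply: le_trans (mean_limit_close x _) (le_trans (ler_norm _) H).
by rewrite invr_gt0 exprn_gt0.
Qed.

Let u x := `|b x - mean_limit x|.

Let u0 x : 0 <= u x. Proof. exact: normr_ge0. Qed.

Let mu : measurable_fun setT u.
Proof. apply: measurableT_comp => //; apply: measurable_funB => //; exact: measurable_mean_limit. Qed.

Let K3 := K + 2 ^+ n * (A + L * n%:R `^ beta).

Let oscillation_limit z r : 0 < r ->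
  (\int[nu]_x (\1_(cube z r) x * u x)%:E <= (K3 * r ^+ n * r `^ beta)%:E)%E.
Proof.
move=> r0; have r0' := ltW r0.
have L0 : 0 <= L.
  by rewrite /L !addr_ge0// mulr_ge0 ?powR_ge0.
pose w := (A + L * n%:R `^ beta) * r `^ beta.
have w0 : 0 <= w.
  exact: mulr_ge0 (addr_ge0 A0 (mulr_ge0 L0 (powR_ge0 _ _))) (powR_ge0 _ _).
have mi : measurable_fun setT (\1_(cube z r) : Rn R n -> R) by exact: measurable_indic_cube.
apply: (@le_trans _ _ (\int[nu]_x ((\1_(cube z r) x * `|b x - m z r|)%:E +
    w%:E * (\1_(cube z r) x)%:E))%E).
  apply: le_integralT => x; first by rewrite lee_fin mulr_ge0.
  rewrite -EFinM -EFinD lee_fin [w * _]mulrC -mulrDr.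
  rewrite indicE; have [xz|_] := boolP (x \in cube z r); last by rewrite !mul0r.
  rewrite !mul1r /u; move/set_mem in xz.
  have h1 := mean_limit_close z r0; have h2 := mean_limit_lipschitz x z.
  have h3 : L * edist x z `^ beta <= L * (n%:R `^ beta * r `^ beta).
    rewrite -powRM// ler_wpM2l// ge0_ler_powR ?nnegrE ?edist_ge0 ?mulr_ge0 ?(ltW beta0)//.
    exact: edist_le_sup.
  have -> : b x - mean_limit x = (b x - m z r) - (mean_limit z - m z r) -
      (mean_limit x - mean_limit z) by ring.
  apply: le_trans (ler_normB _ _) _; rewrite /w mulrDl addrA -[L * _ * _]mulrA.
  apply: lerD (le_trans h2 h3).
  by apply: le_trans (ler_normB _ _) _; rewrite lerD2l.
have m1 : measurable_fun setT (fun x => (\1_(cube z r) x * `|b x - m z r|)%:E : \bar R).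
  apply/measurable_EFinP; apply: measurable_funM => //.
  by apply: measurableT_comp => //; exact: measurable_funB.
have m3 : measurable_fun setT (fun x => (\1_(cube z r) x)%:E : \bar R).
  exact/measurable_EFinP.
have m2 := measurable_funeM w%:E m3.
have p1 x : setT x -> (0 <= (\1_(cube z r) x * `|b x - m z r|)%:E :> \bar R)%E.
  by move=> _; rewrite lee_fin mulr_ge0.
have p3 x : setT x -> (0 <= (\1_(cube z r) x)%:E :> \bar R)%E by rewrite lee_fin.
have p2 x : setT x -> (0 <= w%:E * (\1_(cube z r) x)%:E)%E.
  by move=> _; rewrite mule_ge0 ?lee_fin.
rewrite (ge0_integralD nu measurableT p1 m1 p2 m2).
rewrite (ge0_integralZl nu measurableT m3 p3) ?lee_fin//.
rewrite integral_cube//; apply: le_trans (leeD2r _ (oscillation z r0)) _.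
rewrite -EFinM -EFinD lee_fin /K3 /w exprMn.
by rewrite le_eqVlt; apply/orP; left; apply/eqP; ring.
Qed.

Let origin : Rn R n := [tuple of nseq n (0 : R)].

(** Integrate the oscillations over the cubes of radius [r] centred in a larger
    cube: every point of the smaller cube belongs to the cubes whose centres form a
    set of measure [(2 * r) ^ n]. *)
Let deviation_small (N : nat) r : 0 < r -> r <= 1 ->
  (\int[nu]_x (\1_(cube origin N%:R) x * u x)%:E <=
   ((N%:R + 1) ^+ n * K3 * r `^ beta)%:E)%E.
Proof.
move=> r0 r1; have r0' := ltW r0.
have ln0 : 0 < (2 * r) ^+ n by rewrite exprn_gt0// mulr_gt0.
pose B := cube origin (N%:R + 1).
have mB : measurable_fun setT (\1_B : Rn R n -> R) by exact: measurable_indic_cube.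
pose H (z : Rn R n * Rn R n) : \bar R := (\1_B z.1 * (\1_(cube z.1 r) z.2 * u z.2))%:E.
have H0 z : (0 <= H z)%E by rewrite lee_fin !mulr_ge0.
have mH : measurable_fun setT H.
  apply/measurable_EFinP; apply: measurable_funM; first exact: measurableT_comp.
  apply: measurable_funM; first exact: measurable_indic_cube2.
  exact: measurableT_comp.
have N1 : 0 <= N%:R + 1 :> R by rewrite addr_ge0.
have K30 : 0 <= K3.
  have := oscillation_limit origin ltr01; rewrite expr1n powR1 !mulr1 -lee_fin.
  by apply: le_trans; apply: integral_ge0 => x _; rewrite lee_fin mulr_ge0.
have up : (\int[nu]_z \int[nu]_x H (z, x) <=
    ((2 * (N%:R + 1)) ^+ n * (K3 * r ^+ n * r `^ beta))%:E)%E.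
  apply: (@le_trans _ _ (\int[nu]_z ((K3 * r ^+ n * r `^ beta)%:E * (\1_B z)%:E))%E).
    apply: le_integralT => z; first exact: integral_ge0.
    rewrite /H /= indicE; case: (z \in B); last first.
      by rewrite mule0 integral0_eq// => x _; rewrite mul0r.
    by rewrite mule1; under eq_integral do rewrite mul1r; exact: oscillation_limit.
  rewrite ge0_integralZl//; last 2 first.
  - exact/measurable_EFinP.
  - by rewrite lee_fin !mulr_ge0 ?exprn_ge0 ?powR_ge0.
  by rewrite integral_cube// -EFinM mulrC.
have low : (((2 * r) ^+ n)%:E * \int[nu]_x (\1_(cube origin N%:R) x * u x)%:E <=
    \int[nu]_x \int[nu]_z H (z, x))%E.
  have mN : measurable_fun setT (fun x => (\1_(cube origin N%:R) x * u x)%:E : \bar R).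
    by apply/measurable_EFinP; apply: measurable_funM => //; exact: measurable_indic_cube.
  have pN x : setT x -> (0 <= (\1_(cube origin N%:R) x * u x)%:E :> \bar R)%E.
    by move=> _; rewrite lee_fin mulr_ge0.
  rewrite -(ge0_integralZl nu measurableT mN pN) ?lee_fin ?(ltW ln0)//.
  apply: le_integralT => x; first by rewrite mule_ge0 ?lee_fin ?mulr_ge0// ltW.
  rewrite indicE; have [xN|_] := boolP (x \in cube origin N%:R); last first.
    by rewrite mul0r mule0 integral_ge0.
  have mx : measurable_fun setT (fun z => (\1_(cube x r) z)%:E : \bar R).
    by apply/measurable_EFinP; exact: measurable_indic_cube.
  have px z : setT z -> (0 <= (\1_(cube x r) z)%:E :> \bar R)%E by rewrite lee_fin.
  rewrite mul1r -(integral_cube x r0') -(ge0_integralZr nu measurableT mx px) ?lee_fin//.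
  apply: le_integralT => z; first by rewrite mule_ge0 ?lee_fin.
  rewrite /H/= -EFinM lee_fin [\1_(cube z r) x]cubeC mulrA ler_wpM2r//.
  rewrite !indicE; have [zx|_] := boolP (z \in cube x r); last by rewrite mulr0.
  rewrite mem_set ?mul1r//; move: zx xN => /set_mem zx /set_mem xN.
  apply: (cube_subset _ zx) => i; apply: le_trans (xN i) _; lra.
rewrite -(@lee_pmul2l _ ((2 * r) ^+ n)%:E) ?lte_fin//.
apply: le_trans low _.
rewrite -(fubini_tonelli (m1 := nu) (m2 := nu) H mH H0).
apply: le_trans up _; rewrite -EFinM lee_fin !exprMn.
by rewrite le_eqVlt; apply/orP; left; apply/eqP; ring.
Qed.

(** The integral of the deviation over a fixed cube is at most a multiple of
    [r `^ beta] for every small [r], so it vanishes. *)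
Lemma mean_limit_ae : {ae nu, forall x, b x = mean_limit x}.
Proof.
have zero (N : nat) : (\int[nu]_x (\1_(cube origin N%:R) x * u x)%:E = 0)%E.
  set I := (\int[nu]_x _)%E.
  have I0 : (0 <= I)%E by apply: integral_ge0 => x _; rewrite lee_fin mulr_ge0.
  have Ifin : I \is a fin_num.
    rewrite ge0_fin_numE//; apply: le_lt_trans (deviation_small N ltr01 (lexx 1)) _.
    exact: ltry.
  apply/eqP; rewrite eq_le I0 andbT -(fineK Ifin) lee_fin.
  apply: (cvgr_to_ge (half_cvg ((N%:R + 1) ^+ n * K3))); apply: nearW => k.
  rewrite -lee_fin (fineK Ifin); apply: deviation_small.
    by rewrite invr_gt0 exprn_gt0.
  by rewrite invf_le1 ?exprn_gt0// exprn_ege1// ler1n.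
have ae N : {ae nu, forall x, (\1_(cube origin N%:R) x * u x)%:E = 0%E}.
  have mN : measurable_fun setT (fun x => (\1_(cube origin N%:R) x * u x)%:E : \bar R).
    by apply/measurable_EFinP; apply: measurable_funM => //; exact: measurable_indic_cube.
  have /(ae_eq_integral_abs nu measurableT mN) :
      (\int[nu]_x `|(\1_(cube origin N%:R) x * u x)%:E| = 0)%E.
    rewrite -[RHS](zero N); apply: eq_integral => x _; rewrite gee0_abs// lee_fin.
    by rewrite mulr_ge0.
  by apply: filterS => x /(_ I).
have := ae_foralln ae; apply: filterS => x Hx.
pose N := (Num.bound (\sum_(i < n) `|tnth x i|)).
have xN : cube origin N%:R x.
  move=> i; rewrite tnth_nseq subr0; apply: le_trans (ltW (archi_boundP _)).
    by rewrite (bigD1 i)//= lerDl sumr_ge0.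
  by rewrite sumr_ge0.
have := Hx N; rewrite indicE mem_set// mul1r => -[] /eqP.
by rewrite normr_eq0 subr_eq0 => /eqP.
Qed.

(** Campanato's characterization of Lipschitz functions. *)
Theorem in_lipschitz_of_oscillation : in_lipschitz beta b.
Proof.
exists mean_limit; last exact: mean_limit_ae.
by exists L; exact: mean_limit_lipschitz.
Qed.

End campanato.

(** * The equivalence *)

Section commutator_lower_bound.
Context (R : realType) (n : nat).

Theorem in_lipschitz_of_commutator_bounded (alpha beta : R) (p q : n.-tuple R)
    (b : Rn R n -> R) :
  (0 < n)%N -> alpha <= n%:R -> 0 < beta ->
  (forall i, 1 < tnth p i /\ tnth p i <= tnth q i) ->
  alpha + beta = \sum_(i < n) (tnth p i)^-1 - \sum_(i < n) (tnth q i)^-1 ->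
  loc_integrable b -> mixed_bounded p q (commutator b alpha) ->
  in_lipschitz beta b.
Proof.
move=> n0 an b0 hpq hsum hb [C hC].
have p1 i : 1 <= tnth p i by case: (hpq i) => /ltW.
have q1 i : 1 <= tnth q i by case: (hpq i) => _; exact: le_trans.
pose C' := Num.max C 0.
have C'0 : 0 <= C' by rewrite le_max lexx orbT.
have hC' f : mixed_Lebesgue p f ->
    (mixed_norm q (commutator b alpha f) <= C'%:E * mixed_norm p (EFin \o f))%E.
  move=> /hC H; apply: le_trans H _; apply: lee_wpmul2r; first exact: mixed_norm_ge0.
  by rewrite lee_fin le_max lexx.
pose K := 2 * C' * n%:R `^ (n%:R - alpha) * 2 `^ (n%:R + beta).
apply: (@in_lipschitz_of_oscillation _ _ b K beta) => //.
  by rewrite !mulr_ge0 ?powR_ge0.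
move=> z r r0; apply: le_trans (mean_oscillation_le z hb r0 n0 an C'0 p1 q1 hC') _.
rewrite -hsum lee_fin /K le_eqVlt; apply/orP; left; apply/eqP.
have l0 : 0 < 2 * r by rewrite mulr_gt0.
have -> : (n%:R * (2 * r)) `^ (n%:R - alpha) =
    n%:R `^ (n%:R - alpha) * (2 * r) `^ (n%:R - alpha) by rewrite powRM// ltW.
have E : (2 * r) `^ (n%:R - alpha) * (2 * r) `^ (alpha + beta) =
    2 `^ (n%:R + beta) * (r ^+ n * r `^ beta).
  rewrite -powR_mulrn ?(ltW r0)//.
  have H (x u w : R) : 0 < x -> x `^ u * x `^ w = x `^ (u + w).
    by move=> x0; rewrite powRD// (gt_eqF x0) implybT.
  by rewrite !H// addrA subrK powRM// ltW.
by rewrite -!mulrA E !mulrA.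
Qed.

End commutator_lower_bound.

Theorem theorem5p3 (R : realType) (n : nat) (alpha beta : R)
    (p q : n.-tuple R) (b : Rn R n -> R)
    (halpha : 0 < alpha < n%:R) (hbeta : 0 < beta < 1)
    (hpq : forall i : 'I_n, 1 < tnth p i /\ tnth p i <= tnth q i)
    (hne : exists i0 : 'I_n, tnth p i0 <> tnth q i0)
    (hsum : alpha + beta =
       \sum_(i < n) (tnth p i)^-1 - \sum_(i < n) (tnth q i)^-1)
    (hb : loc_integrable b) :
  in_lipschitz beta b <-> mixed_bounded p q (commutator b alpha).
Proof.
have /andP[alpha0 alphan] := halpha; have /andP[beta0 _] := hbeta.
split.
  by apply: commutator_bounded => //; [rewrite gt_eqF|case: hb].
apply: in_lipschitz_of_commutator_bounded => //; last exact: ltW.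
by rewrite -(ltr_nat R); exact: lt_trans alphan.
Qed.
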